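(* The deformation complex of the inclusion of operads $\mathsf{Lie}\to\mathsf{PreLie}$, sending the Lie bracket $[a_1,a_2]$ to $a_1\triangleleft a_2-a_2\triangleleft a_1$, is acyclic; that is, $H_\bullet(\mathrm{Def}(\mathsf{Lie}\to\mathsf{PreLie}))=0$.
   Context: All vector spaces are over a field $\Bbbk$ of characteristic zero; chain complexes are homological (differential of degree $-1$); $s$ denotes suspension (degree $1$); the Koszul sign rule is used. $\mathsf{Lie}$ is the operad of Lie algebras. $\mathsf{PreLie}$ is the operad of pre-Lie algebras: it is generated by one binary operation $a_1\triangleleft a_2$ (degree $0$, no symmetry) subject to $(a_1\triangleleft a_2)\triangleleft a_3-a_1\triangleleft(a_2\triangleleft a_3)=(a_1\triangleleft a_3)\triangleleft a_2-a_1\triangleleft(a_3\triangleleft a_2)$. Deformation complex: let $\mathcal{P}=\mathcal{T}(\mathcal{X})/(\mathcal{R})$ be a Koszul operad generated by $\mathcal{X}$ with quadratic relations $\mathcal{R}$, let $\mathcal{P}^{\text{¡}}$ be its Koszul dual cooperad (the quadratic cooperad cogenerated by $s\mathcal{X}$ with corelations $s^2\mathcal{R}$), and let $f\colon\mathcal{P}\to\mathcal{Q}$ be a map of operads (zero differentials). Put $$\mathrm{Hom}^{\mathbb{S}}(\mathcal{P}^{\text{¡}},\mathcal{Q})=\prod_{n\ge1}\mathrm{Hom}(\mathcal{P}^{\text{¡}}(n),\mathcal{Q}(n))^{\mathbb{S}_n}$$ (the arity one component, i.e. the counit of $\mathcal{P}^{\text{¡}}$, is not removed). The product $\phi\triangleleft\psi$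 is computed by applying the infinitesimal decomposition map of $\mathcal{P}^{\text{¡}}$ (sum of all decompositions into two-vertex trees), applying $\phi$ to the root vertex and $\psi$ to the upper vertex, and composing in $\mathcal{Q}$; the bracket is $[\phi,\psi]=\phi\triangleleft\psi-(-1)^{|\phi||\psi|}\psi\triangleleft\phi$. Let $\alpha$ be the degree $-1$ element given by the composite $\mathcal{P}^{\text{¡}}\to s\mathcal{X}\to\mathcal{X}\to\mathcal{Q}$ of the projection onto cogenerators, desuspension, and $f|_{\mathcal{X}}$; it is a Maurer–Cartan element. Then $\mathrm{Def}(f\colon\mathcal{P}\to\mathcal{Q})=(\mathrm{Hom}^{\mathbb{S}}(\mathcal{P}^{\text{¡}},\mathcal{Q}),[-,-],d_\alpha)$ with $d_\alpha=[\alpha,-]$. *)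

(* Defs.v *)
From HB Require Import structures.
From mathcomp Require Import all_boot all_order all_algebra.
From mathcomp Require Import boolp.

Set Implicit Arguments.
Unset Strict Implicit.
Unset Printing Implicit Defensive.

Import GRing.Theory.
Local Open Scope ring_scope.

#[local] Obligation Tactic := idtac.
#[local] Unset Program Cases.

(******************************************************************************)
(* Symmetric operads are written as linear species: P(A) is indexed by finite *)
(* sets A, S_n acts on P(n) = P 'I_n, and the partial composition             *)
(*   P(A u {*}) (x) P(B) -> P(A u B)                                          *)
(* plugs an element of P(B) into the input *, encoded as None : option A.     *)
(******************************************************************************)

Lemma linear_sub (K : fieldType) (U V : lmodType K) (f : U -> V) :
  linear f -> forall u v, f (u - v) = f u - f v.
Proof.
by move=> lf u v; rewrite addrC -scaleN1r lf scaleN1r addrC.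
Qed.

Lemma linear_zero (K : fieldType) (U V : lmodType K) (f : U -> V) :
  linear f -> f 0 = 0.
Proof. by move=> lf; rewrite -(subrr 0) linear_sub // subrr. Qed.

Section VectorSpaces.
Variables (K : fieldType) (V : vectType K).

Lemma vspan_exists (P : V -> Prop) : exists U : {vspace V},
  (forall x, P x -> x \in U) /\
  (forall W : {vspace V}, (forall x, P x -> x \in W) -> (U <= W)%VS).
Proof.
pose cov (W : {vspace V}) := forall x, P x -> x \in W.
pose d n := `[< exists W, cov W /\ \dim W = n >].
have ex_d : exists n, d n.
  by exists (\dim {:V}); apply/asboolP; exists fullv; split=> // x _; apply: memvf.
case: (ex_minnP ex_d) => m /asboolP[U [covU dimU]] minm.
exists U; split=> // W covW.
have /minm : d (\dim (U :&: W)).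
  apply/asboolP; exists (U :&: W)%VS; split=> // x Px.
  by rewrite memv_cap covU ?covW.
rewrite -dimU => leUW.
have /eqP <- : (U :&: W == U)%VS by rewrite eqEdim capvSl.
exact: capvSr.
Qed.

Definition vspan (P : V -> Prop) : {vspace V} :=
  projT1 (cid (vspan_exists P)).

Lemma mem_vspan (P : V -> Prop) x : P x -> x \in vspan P.
Proof. by rewrite /vspan; case: cid => U [sub _] /= /sub. Qed.

Lemma vspan_sub (P : V -> Prop) (W : {vspace V}) :
  (forall x, P x -> x \in W) -> (vspan P <= W)%VS.
Proof. by rewrite /vspan; case: cid => U [_ sub] /= /sub. Qed.

Lemma vspan_ind (P P' : V -> Prop) :
  (forall x, P x -> P' x) -> P' 0 ->
  (forall k x y, P' x -> P' y -> P' (k *: x + y)) ->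
  forall x, x \in vspan P -> P' x.
Proof.
move=> PP' P0 Plin.
pose d n := `[< exists X : seq V, [/\ free X, size X = n &
  forall x, x \in X -> P x] >].
have ex_d : exists n, d n.
  by exists 0; apply/asboolP; exists [::]; split; rewrite ?nil_free.
have ub_d n : d n -> (n <= \dim {:V})%N.
  by case/asboolP => X [frX <- _]; rewrite -(eqnP frX) dimvS ?subvf.
case: (ex_maxnP ex_d ub_d) => m /asboolP[X [frX sX XP]] maxm x.
have sub : (vspan P <= <<X>>)%VS.
  apply: vspan_sub => y Py; case: (boolP (y \in <<X>>%VS)) => // nyX.
  have /maxm : d m.+1.
    apply/asboolP; exists (y :: X); split=> [||z]; rewrite ?free_cons ?nyX //=.
      by rewrite sX.
    by rewrite inE => /predU1P[->|/XP].
  by rewrite ltnn.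
move=> /(subvP sub) /(coord_span (X := in_tuple X)) ->.
elim/big_ind: _ => [|y z Py Pz|i _] //.
  by rewrite -[y]scale1r; apply: Plin.
by rewrite -[_ *: _]addr0; apply: Plin => //; apply/PP'/XP/mem_nth.
Qed.

Variable U : {vspace V}.

(* The quotient V / U, realized on a complement of U. *)
Definition vquot : vectType K := subvs_of (U^C)%VS.

Definition vpi : 'Hom(V, vquot) :=
  linfun (vsproj (U^C)%VS \o daddv_pi (U^C)%VS U).

Definition vlift (q : vquot) : V := vsval q.

Lemma vliftK q : vpi (vlift q) = q.
Proof.
rewrite lfunE /= daddv_pi_id ?vsvalK ?subvsP //.
by rewrite capvC capv_compl.
Qed.

Lemma vpi_eq0 x : (vpi x == 0) = (x \in U).
Proof.
have cap0 : (U^C :&: U = 0)%VS by rewrite capvC capv_compl.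
have -> : (vpi x == 0) = (daddv_pi U^C U x == 0).
  rewrite lfunE /= -(inj_eq subvs_inj) vsprojK ?linear0 //.
  exact: memv_pi.
have dec : daddv_pi U^C U x + daddv_pi U U^C x = x.
  by rewrite daddv_pi_add // addvC addv_complf memvf.
apply/eqP/idP => [p0 | xU].
  by rewrite -dec p0 add0r memv_pi.
have : daddv_pi U^C U x \in (U^C :&: U)%VS.
  rewrite memv_cap memv_pi /=.
  have -> : daddv_pi U^C U x = x - daddv_pi U U^C x.
    by rewrite -[in X in X - _]dec addrK.
  by rewrite rpredB ?memv_pi.
by rewrite cap0 memv0 => /eqP.
Qed.

Lemma vlift_pi x : vlift (vpi x) - x \in U.
Proof. by rewrite -vpi_eq0 linearB /= vliftK subrr. Qed.

End VectorSpaces.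

Record bijection (A B : Type) := Bijection {
  bfun :> A -> B;
  binv : B -> A;
  bfunK : cancel bfun binv;
  binvK : cancel binv bfun }.

Section Bijections.
Variables A A' A'' B B' C : Type.

Definition bid : bijection A A :=
  @Bijection _ _ id id (fun=> erefl) (fun=> erefl).

Definition bsym (f : bijection A B) : bijection B A :=
  Bijection (binvK f) (bfunK f).

Program Definition bcomp (g : bijection A' A'') (f : bijection A A') :=
  @Bijection A A'' (g \o f) (binv f \o binv g) _ _.
Next Obligation. by move=> g f x; rewrite /= !bfunK. Qed.
Next Obligation. by move=> g f x; rewrite /= !binvK. Qed.

Program Definition bsum (f : bijection A A') (g : bijection B B') :=
  @Bijection (A + B) (A' + B')
    (fun x => match x with inl a => inl (f a) | inr b => inr (g b) end)
    (fun x => match x with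
              | inl a => inl (binv f a) | inr b => inr (binv g b) end) _ _.
Next Obligation. by move=> f g [] x; rewrite /= bfunK. Qed.
Next Obligation. by move=> f g [] x; rewrite /= binvK. Qed.

Program Definition bopt (f : bijection A A') :=
  @Bijection (option A) (option A') (omap f) (omap (binv f)) _ _.
Next Obligation. by move=> f [x|] //=; rewrite bfunK. Qed.
Next Obligation. by move=> f [x|] //=; rewrite binvK. Qed.

Program Definition bunit_void :=
  @Bijection unit (option void) (fun=> None) (fun=> tt) _ _.
Next Obligation. by case. Qed.
Next Obligation. by case. Qed.

Program Definition bsum_void :=
  @Bijection B (void + B) inr
    (fun x => match x with inl v => of_void _ v | inr b => b end) _ _.
Next Obligation. by []. Qed.
Next Obligation. by case=> // -[]. Qed.

Program Definition bsum_unit :=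
  @Bijection (option A) (A + unit)
    (fun x => if x is Some a then inl a else inr tt)
    (fun x => if x is inl a then Some a else None) _ _.
Next Obligation. by case. Qed.
Next Obligation. by case=> // -[]. Qed.

Program Definition bsumA :=
  @Bijection (A + (B + C)) (A + B + C)
    (fun x => match x with
              | inl a => inl (inl a) | inr (inl b) => inl (inr b)
              | inr (inr c) => inr c end)
    (fun x => match x with
              | inl (inl a) => inl a | inl (inr b) => inr (inl b)
              | inr c => inr (inr c) end) _ _.
Next Obligation. by case=> [|[]]. Qed.
Next Obligation. by case=> [[]|]. Qed.

Program Definition bsumAC :=
  @Bijection (A + B + C) (A + C + B)
    (fun x => match x with
              | inl (inl a) => inl (inl a) | inl (inr b) => inr b
              | inr c => inl (inr c) end)
    (fun x => match x with
              | inl (inl a) => inl (inl a) | inl (inr c) => inr c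
              | inr b => inl (inr b) end) _ _.
Next Obligation. by case=> [[]|]. Qed.
Next Obligation. by case=> [[]|]. Qed.

Program Definition boptl :=
  @Bijection (option A + B) (option (A + B))
    (fun x => match x with
              | inl o => omap inl o | inr b => Some (inr b) end)
    (fun x => match x with
              | None => inl None | Some (inl a) => inl (Some a)
              | Some (inr b) => inr b end) _ _.
Next Obligation. by case=> [[]|]. Qed.
Next Obligation. by case=> [[]|]. Qed.

Program Definition boptr :=
  @Bijection (A + option B) (option (A + B))
    (fun x => match x with
              | inl a => Some (inl a) | inr o => omap inr o end)
    (fun x => match x with
              | None => inr None | Some (inl a) => inl a
              | Some (inr b) => inr (Some b) end) _ _.
Next Obligation. by case=> [|[]]. Qed.
Next Obligation. by case=> [[]|]. Qed.

Definition optswap (x : option (option A)) : option (option A) :=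
  match x with
  | None => Some None | Some None => None | Some (Some a) => Some (Some a) end.

Program Definition boptswap := @Bijection _ _ optswap optswap _ _.
Next Obligation. by case=> [[]|]. Qed.
Next Obligation. by case=> [[]|]. Qed.

End Bijections.

Section Operads.
Variable K : fieldType.

Record operad := Operad {
  op_sort :> finType -> vectType K;
  op_act : forall A B : finType, bijection A B -> op_sort A -> op_sort B;
  op_comp : forall A B : finType,
    op_sort (option A) -> op_sort B -> op_sort (A + B)%type;
  op_unit : op_sort unit;
  op_act_linear : forall (A B : finType) (f : bijection A B),
    linear (op_act f);
  op_act_id : forall (A : finType) (f : bijection A A) x,
    f =1 id -> op_act f x = x;
  op_act_comp : forall (A B C : finType) (f : bijection A B)
    (g : bijection B C) (h : bijection A C) x,
    h =1 g \o f -> op_act h x = op_act g (op_act f x);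
  op_comp_linearl : forall (A B : finType) (y : op_sort B),
    linear (fun x : op_sort (option A) => op_comp x y);
  op_comp_linearr : forall (A B : finType) (x : op_sort (option A)),
    linear (fun y : op_sort B => op_comp x y);
  op_comp_act : forall (A A' B B' : finType) (f : bijection A A')
    (g : bijection B B') x y,
    op_comp (op_act (bopt f) x) (op_act g y)
    = op_act (bsum f g) (op_comp x y);
  op_unitl : forall (B : finType) (y : op_sort B),
    op_comp (op_act bunit_void op_unit) y = op_act (bsum_void B) y;
  op_unitr : forall (A : finType) (x : op_sort (option A)),
    op_comp x op_unit = op_act (bsum_unit A) x;
  op_compA : forall (A B C : finType) (x : op_sort (option A))
    (y : op_sort (option B)) (z : op_sort C),
    op_act (bsumA A B C) (op_comp x (op_comp y z))
    = op_comp (op_act (boptr A B) (op_comp x y)) z;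
  op_compAC : forall (A B C : finType) (x : op_sort (option (option A)))
    (y : op_sort B) (z : op_sort C),
    op_comp (op_act (boptl A B) (op_comp x y)) z
    = op_act (bsumAC A C B)
        (op_comp (op_act (boptl A C)
                    (op_comp (op_act (boptswap A) x) z)) y) }.

Record operad_hom (P Q : operad) := OperadHom {
  oh_fun :> forall A : finType, 'Hom(P A, Q A);
  oh_act : forall (A B : finType) (f : bijection A B) x,
    oh_fun B (op_act f x) = op_act f (oh_fun A x);
  oh_comp : forall (A B : finType) (x : P (option A)) (y : P B),
    oh_fun _ (op_comp x y) = op_comp (oh_fun _ x) (oh_fun _ y);
  oh_unit : oh_fun _ (op_unit P) = op_unit Q }.

Definition is_ideal (P : operad) (I : forall A : finType, {vspace P A}) :=
  [/\ forall (A B : finType) (f : bijection A B) x,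
        x \in I A -> op_act f x \in I B,
      forall (A B : finType) (x : P (option A)) (y : P B),
        x \in I _ -> op_comp x y \in I _ &
      forall (A B : finType) (x : P (option A)) (y : P B),
        y \in I _ -> op_comp x y \in I _].

(* The intersection of all ideals containing R. *)
Definition gen_ideal (P : operad) (R : forall A : finType, P A -> Prop)
    (A : finType) : {vspace P A} :=
  vspan (fun x => forall I : forall A : finType, {vspace P A},
    is_ideal I -> (forall B y, R B y -> y \in I B) -> x \in I A).

Section QuotientOperad.
Variables (P : operad) (R : forall A : finType, P A -> Prop).
Let I := gen_ideal R.

Lemma gen_ideal_min (J : forall A : finType, {vspace P A}) :
  is_ideal J -> (forall B y, R y -> y \in J B) ->
  forall A : finType, (I A <= J A)%VS.
Proof. by move=> idJ RJ A; apply: vspan_sub => x; apply. Qed.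

Lemma mem_gen_ideal (A : finType) (x : P A) : R x -> x \in I A.
Proof. by move=> Rx; apply: mem_vspan => J _; apply. Qed.

Lemma mem_gen_idealP (A : finType) (x : P A) : x \in I A <->
  forall J : forall A : finType, {vspace P A},
    is_ideal J -> (forall B y, R y -> y \in J B) -> x \in J A.
Proof.
split=> [xI J idJ RJ | ]; last exact: mem_vspan.
exact: subvP (gen_ideal_min idJ RJ A) _ xI.
Qed.

Lemma gen_idealP : is_ideal I.
Proof.
split.
- move=> A B f x /mem_gen_idealP xI; apply/mem_gen_idealP => J idJ RJ.
  by case: (idJ) => actJ _ _; apply: actJ; apply: xI.
- move=> A B x y /mem_gen_idealP xI; apply/mem_gen_idealP => J idJ RJ.
  by case: (idJ) => _ compJ _; apply: compJ; apply: xI.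
- move=> A B x y /mem_gen_idealP yI; apply/mem_gen_idealP => J idJ RJ.
  by case: (idJ) => _ _ compJ; apply: compJ; apply: yI.
Qed.

Definition quot_sort (A : finType) : vectType K := vquot (I A).
Definition quot_pi (A : finType) : P A -> quot_sort A := vpi (I A).
Definition quot_act (A B : finType) (f : bijection A B) (q : quot_sort A) :=
  quot_pi (op_act f (vlift q)).
Definition quot_comp (A B : finType) (q : quot_sort (option A))
    (r : quot_sort B) : quot_sort (A + B)%type :=
  quot_pi (op_comp (vlift q) (vlift r)).

Lemma quot_pi_eq (A : finType) (x y : P A) :
  (quot_pi x = quot_pi y) <-> (x - y \in I A).
Proof.
rewrite -vpi_eq0 linearB /= subr_eq0 /quot_pi.
by split=> [->|/eqP].
Qed.

Lemma quot_pi_linear (A : finType) : linear (@quot_pi A).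
Proof. by move=> k x y; rewrite /quot_pi linearP. Qed.

Lemma quot_act_pi (A B : finType) (f : bijection A B) x :
  quot_act f (quot_pi x) = quot_pi (op_act f x).
Proof.
apply/quot_pi_eq; have [actI _ _] := gen_idealP.
rewrite -(linear_sub (op_act_linear f)).
by apply: actI; apply: vlift_pi.
Qed.

Lemma quot_comp_pi (A B : finType) (x : P (option A)) (y : P B) :
  quot_comp (quot_pi x) (quot_pi y) = quot_pi (op_comp x y).
Proof.
apply/quot_pi_eq; have [_ compIl compIr] := gen_idealP.
set x' := vlift _; set y' := vlift _.
have -> : op_comp x' y' - op_comp x y
        = op_comp (x' - x) y' + op_comp x (y' - y).
  rewrite (linear_sub (op_comp_linearl y')) (linear_sub (op_comp_linearr x)).
  by rewrite addrA subrK.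
by apply: rpredD; [apply: compIl|apply: compIr]; apply: vlift_pi.
Qed.

Lemma quot_piK (A : finType) (q : quot_sort A) : exists x, q = quot_pi x.
Proof. by exists (vlift q); rewrite /quot_pi vliftK. Qed.

Program Definition quot_operad : operad :=
  @Operad quot_sort quot_act quot_comp (quot_pi (op_unit P))
    _ _ _ _ _ _ _ _ _ _.
Next Obligation.
move=> A B f k q r; have [[x ->] [y ->]] := (quot_piK q, quot_piK r).
by rewrite -quot_pi_linear !quot_act_pi op_act_linear quot_pi_linear.
Qed.
Next Obligation.
move=> A f q fid; have [x ->] := quot_piK q.
by rewrite quot_act_pi op_act_id.
Qed.
Next Obligation.
move=> A B C f g h q hgf; have [x ->] := quot_piK q.
by rewrite !quot_act_pi (op_act_comp _ hgf).
Qed.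
Next Obligation.
move=> A B s k q r.
have [[x ->] [[y ->] [z ->]]] := (quot_piK q, (quot_piK r, quot_piK s)).
by rewrite -quot_pi_linear !quot_comp_pi op_comp_linearl quot_pi_linear.
Qed.
Next Obligation.
move=> A B s k q r.
have [[x ->] [[y ->] [z ->]]] := (quot_piK q, (quot_piK r, quot_piK s)).
by rewrite -quot_pi_linear !quot_comp_pi op_comp_linearr quot_pi_linear.
Qed.
Next Obligation.
move=> A A' B B' f g q r; have [[x ->] [y ->]] := (quot_piK q, quot_piK r).
by rewrite (quot_comp_pi x y) !quot_act_pi quot_comp_pi op_comp_act.
Qed.
Next Obligation.
move=> B q; have [x ->] := quot_piK q.
by rewrite !quot_act_pi quot_comp_pi op_unitl.
Qed.
Next Obligation.
move=> A q; have [x ->] := quot_piK q.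
by rewrite quot_act_pi quot_comp_pi op_unitr.
Qed.
Next Obligation.
move=> A B C q r s.
have [[x ->] [[y ->] [z ->]]] := (quot_piK q, (quot_piK r, quot_piK s)).
by rewrite (quot_comp_pi x y) (quot_comp_pi y z) (quot_comp_pi x) !quot_act_pi
  quot_comp_pi op_compA.
Qed.
Next Obligation.
move=> A B C q r s.
have [[x ->] [[y ->] [z ->]]] := (quot_piK q, (quot_piK r, quot_piK s)).
rewrite (quot_comp_pi x y) (quot_act_pi (boptl A B)) quot_comp_pi.
rewrite (quot_act_pi (boptswap A)) (quot_comp_pi _ z) (quot_act_pi (boptl A C)).
by rewrite quot_comp_pi (quot_act_pi (bsumAC A C B)) op_compAC.
Qed.

Program Definition quot_proj : operad_hom P quot_operad :=
  @OperadHom _ quot_operad (fun A => vpi (I A)) _ _ _.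
Next Obligation. by move=> A B f x; apply: esym; apply: quot_act_pi. Qed.
Next Obligation. by move=> A B x y; apply: esym; apply: quot_comp_pi. Qed.
Next Obligation. by []. Qed.

Lemma quot_proj_eq0 (A : finType) (x : P A) :
  quot_proj A x = 0 <-> x \in I A.
Proof. by rewrite -vpi_eq0; split=> [x0|/eqP //]; apply/eqP. Qed.

Section Descent.
Variables (Q : operad) (g : operad_hom P Q).
Hypothesis gR : forall (A : finType) (x : P A), R x -> g A x = 0.

Lemma descent_ker (A : finType) (x : P A) : x \in I A -> g A x = 0.
Proof.
move=> xI; apply/eqP; rewrite -memv_ker.
apply: subvP (gen_ideal_min (J := fun B => lker (g B)) _ _ A) _ xI.
  split=> [B C f y | B C y z | B C y z]; rewrite !memv_ker.
  - move=> /eqP y0; rewrite oh_act y0.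
    by rewrite (linear_zero (op_act_linear f)).
  - move=> /eqP y0; rewrite oh_comp y0.
    by rewrite (linear_zero (op_comp_linearl _)).
  - move=> /eqP z0; rewrite oh_comp z0.
    by rewrite (linear_zero (op_comp_linearr _)).
by move=> B y Ry; rewrite memv_ker gR.
Qed.

Definition descent_fun (A : finType) : 'Hom(quot_operad A, Q A) :=
  linfun (g A \o vsval).

Lemma descent_funE (A : finType) x : descent_fun A (quot_pi x) = g A x.
Proof.
rewrite lfunE /=; apply/eqP; rewrite -subr_eq0 -linearB.
by apply/eqP/descent_ker; apply: vlift_pi.
Qed.

Program Definition descent : operad_hom quot_operad Q :=
  @OperadHom quot_operad Q descent_fun _ _ _.
Next Obligation.
move=> A B f q; have [x ->] := quot_piK q.
by rewrite [op_act _ _]quot_act_pi !descent_funE oh_act.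
Qed.
Next Obligation.
move=> A B q r; have [[x ->] [y ->]] := (quot_piK q, quot_piK r).
by rewrite [op_comp _ _]quot_comp_pi !descent_funE oh_comp.
Qed.
Next Obligation. by rewrite [op_unit _]/= descent_funE oh_unit. Qed.

End Descent.
End QuotientOperad.
End Operads.

(******************************************************************************)
(* Lie and PreLie are presented as quotients of the free operad Mag on one    *)
(* binary operation without symmetry, with basis the planar binary trees      *)
(* whose leaves are in bijection with the arity. The antisymmetry of the Lie  *)
(* bracket is imposed together with the Jacobi identity.                      *)
(******************************************************************************)

Inductive tree (A : Type) := Leaf of A | Node of tree A & tree A.
Arguments Leaf {A}.
Arguments Node {A}.

Section Trees.

Fixpoint tree_encode (A : Type) (t : tree A) : GenTree.tree A :=
  match t with
  | Leaf a => GenTree.Leaf a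
  | Node t1 t2 => GenTree.Node 0 [:: tree_encode t1; tree_encode t2]
  end.

Fixpoint tree_decode (A : Type) (t : GenTree.tree A) : option (tree A) :=
  match t with
  | GenTree.Leaf a => Some (Leaf a)
  | GenTree.Node _ [:: t1; t2] =>
      match tree_decode t1, tree_decode t2 with
      | Some u1, Some u2 => Some (Node u1 u2)
      | _, _ => None
      end
  | _ => None
  end.

Lemma tree_encodeK A : pcancel (@tree_encode A) (@tree_decode A).
Proof. by elim=> //= t1 -> t2 ->. Qed.

HB.instance Definition _ (A : eqType) :=
  Equality.copy (tree A) (pcan_type (@tree_encodeK A)).
HB.instance Definition _ (A : choiceType) :=
  Choice.copy (tree A) (pcan_type (@tree_encodeK A)).
HB.instance Definition _ (A : countType) :=
  Countable.copy (tree A) (pcan_type (@tree_encodeK A)).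

Fixpoint leaves A (t : tree A) : seq A :=
  match t with
  | Leaf a => [:: a] | Node t1 t2 => leaves t1 ++ leaves t2 end.

Fixpoint weight A (t : tree A) : nat :=
  match t with
  | Leaf _ => 0 | Node t1 t2 => (weight t1 + weight t2).+1 end.

Fixpoint tbind A B (t : tree A) (f : A -> tree B) : tree B :=
  match t with
  | Leaf a => f a | Node t1 t2 => Node (tbind t1 f) (tbind t2 f) end.

Definition tmap A B (f : A -> B) (t : tree A) := tbind t (Leaf \o f).

Definition tgraft A B (s : tree (option A)) (u : tree B) : tree (A + B) :=
  tbind s (fun o => if o is Some a then Leaf (inl a) else tmap inr u).

Definition multilinear (A : finType) (t : tree A) : bool :=
  [forall a, count_mem a (leaves t) == 1%N].

Record mtree (A : finType) :=
  MTree { mtree_val :> tree A; mtreeP : multilinear mtree_val }.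

End Trees.

HB.instance Definition _ (A : finType) := [isSub of mtree A for @mtree_val A].
HB.instance Definition _ (A : finType) := [Countable of mtree A by <:].

Section TreeTheory.

Lemma tbindA A B C (t : tree A) (f : A -> tree B) (g : B -> tree C) :
  tbind (tbind t f) g = tbind t (fun a => tbind (f a) g).
Proof. by elim: t => //= t1 -> t2 ->. Qed.

Lemma eq_tbind A B (f g : A -> tree B) (t : tree A) :
  f =1 g -> tbind t f = tbind t g.
Proof. by move=> fg; elim: t => //= t1 -> t2 ->. Qed.

Lemma tbind_Leaf A (t : tree A) : tbind t Leaf = t.
Proof. by elim: t => //= t1 -> t2 ->. Qed.

Lemma leaves_bind A B (t : tree A) (f : A -> tree B) :
  leaves (tbind t f) = flatten [seq leaves (f a) | a <- leaves t].
Proof.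
by elim: t => [a|t1 IH1 t2 IH2] /=; rewrite ?cats0 // IH1 IH2 map_cat flatten_cat.
Qed.

Lemma leaves_map A B (f : A -> B) (t : tree A) :
  leaves (tmap f t) = map f (leaves t).
Proof. by rewrite leaves_bind; elim: (leaves t) => //= a s ->. Qed.

Lemma multilinear_map (A B : finType) (f : bijection A B) (t : tree A) :
  multilinear t -> multilinear (tmap f t).
Proof.
move=> /forallP tP; apply/forallP => b; rewrite leaves_map count_map.
rewrite -(eqP (tP (binv f b))); apply/eqP; apply: eq_count => a /=.
by rewrite -(inj_eq (can_inj (binvK f))) bfunK.
Qed.

Lemma count_graft_inl (A B : finType) (s : tree (option A)) (u : tree B) a :
  count_mem (inl a) (leaves (tgraft s u)) = count_mem (Some a) (leaves s).
Proof.
rewrite leaves_bind; elim: (leaves s) => //= -[c|] l IH /=; rewrite ?count_cat IH //.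
by rewrite leaves_map count_map -[RHS]add0n; congr (_ + _)%N; elim: (leaves u).
Qed.

Lemma count_graft_inr (A B : finType) (s : tree (option A)) (u : tree B) b :
  count_mem (inr b) (leaves (tgraft s u))
  = (count_mem None (leaves s) * count_mem b (leaves u))%N.
Proof.
rewrite leaves_bind; elim: (leaves s) => //= -[c|] l IH /=; rewrite ?count_cat IH //.
by rewrite leaves_map count_map mulSn; congr (_ + _)%N; apply: eq_count.
Qed.

Lemma multilinear_graft (A B : finType) (s : tree (option A)) (u : tree B) :
  multilinear s -> multilinear u -> multilinear (tgraft s u).
Proof.
move=> /forallP sP /forallP uP; apply/forallP => -[a|b].
  by rewrite count_graft_inl.
by rewrite count_graft_inr (eqP (sP None)) (eqP (uP b)).
Qed.

Fixpoint trees_upto (A : finType) (n : nat) : seq (tree A) :=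
  if n is m.+1 then
    map Leaf (enum A) ++ [seq Node t u | t <- trees_upto A m, u <- trees_upto A m]
  else [::].

Lemma mem_trees_upto (A : finType) n (t : tree A) :
  (size (leaves t) <= n)%N -> t \in trees_upto A n.
Proof.
have pos (u : tree A) : (0 < size (leaves u))%N.
  by elim: u => //= t1 H1 t2 H2; rewrite size_cat addn_gt0 H1.
elim: n t => [t|n IHn [a|t1 t2]] /=.
- by rewrite leqNgt pos.
- by move=> _; rewrite mem_cat map_f ?mem_enum.
rewrite size_cat => le_n; rewrite mem_cat; apply/orP; right.
apply: allpairs_f; apply: IHn; rewrite -ltnS; apply: leq_trans le_n.
  by rewrite -addn1 leq_add2l pos.
by rewrite -add1n leq_add2r pos.
Qed.

Definition mtree_enum (A : finType) : seq (mtree A) :=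
  undup (pmap insub (trees_upto A #|A|)).

Lemma mtree_enumP (A : finType) : Finite.axiom (mtree_enum A).
Proof.
apply: Finite.uniq_enumP; first exact: undup_uniq.
move=> t; rewrite mem_undup mem_pmap_sub; apply: mem_trees_upto.
have /forallP tP := mtreeP t.
rewrite cardE -(perm_size (_ : perm_eq (leaves t) (enum A))) //.
apply/allP => a _ /=; rewrite (eqP (tP a)) count_uniq_mem ?enum_uniq //.
by rewrite mem_enum.
Qed.

End TreeTheory.

HB.instance Definition _ (A : finType) :=
  isFinite.Build (mtree A) (@mtree_enumP A).

Definition mrelabel (A B : finType) (f : bijection A B) (t : mtree A) : mtree B :=
  MTree (multilinear_map f (mtreeP t)).

Definition mgraft (A B : finType) (s : mtree (option A)) (u : mtree B) :
    mtree (A + B)%type :=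
  MTree (multilinear_graft (mtreeP s) (mtreeP u)).

Lemma multilinear_unit : multilinear (Leaf tt).
Proof. by apply/forallP => -[]. Qed.

Section Magmatic.
Variable K : fieldType.

Definition tspan (A : finType) : vectType K := {ffun mtree A -> K^o}.

(* The basis vector of a tree (and 0 if the tree is not multilinear). *)
Definition mono (A : finType) (t : tree A) : tspan A :=
  [ffun u : mtree A => (mtree_val u == t)%:R].

Definition mag_act (A B : finType) (f : bijection A B) (x : tspan A) : tspan B :=
  [ffun t => x (mrelabel (bsym f) t)].

Definition mag_comp (A B : finType) (x : tspan (option A)) (y : tspan B) :
    tspan (A + B)%type :=
  \sum_(s : mtree (option A)) \sum_(u : mtree B)
    (x s * y u) *: mono (mgraft s u).

Lemma monoE (A : finType) (t u : mtree A) :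
  mono t u = (u == t)%:R.
Proof. by rewrite ffunE. Qed.

Lemma tspan_expand (A : finType) (x : tspan A) :
  x = \sum_(t : mtree A) x t *: mono t.
Proof.
apply/ffunP => u; rewrite sum_ffunE (bigD1 u) //= ffunE monoE eqxx.
rewrite big1 => [|t nut]; last by rewrite ffunE monoE eq_sym (negbTE nut) scaler0.
by rewrite addr0 [_ *: _]mulr1.
Qed.

Lemma tspan_ext (A : finType) (V : lmodType K) (F G : tspan A -> V) :
  linear F -> linear G -> (forall t : mtree A, F (mono t) = G (mono t)) ->
  F =1 G.
Proof.
move=> lF lG FG x; rewrite [x]tspan_expand.
elim/big_ind: _ => [|y z Fy Fz|t _].
- by rewrite !linear_zero.
- by have := (lF 1 y z, lG 1 y z); rewrite !scale1r Fy Fz => -[-> ->].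
have := (lF (x t) (mono t) 0, lG (x t) (mono t) 0).
by rewrite (linear_zero lF) (linear_zero lG) !addr0 FG => -[-> ->].
Qed.

Lemma mag_act_linear (A B : finType) (f : bijection A B) : linear (mag_act f).
Proof. by move=> k x y; apply/ffunP => t; rewrite !ffunE. Qed.

Lemma mag_act_tree (A B : finType) (f : bijection A B) (t : tree A) :
  mag_act f (mono t) = mono (tmap f t).
Proof.
apply/ffunP => u; rewrite !ffunE; congr (nat_of_bool _)%:R.
have K1 (v : tree A) : tmap (binv f) (tmap f v) = v.
  rewrite /tmap tbindA -[RHS]tbind_Leaf; apply: eq_tbind => a /=.
  by rewrite bfunK.
have K2 (v : tree B) : tmap f (tmap (binv f) v) = v.
  rewrite /tmap tbindA -[RHS]tbind_Leaf; apply: eq_tbind => a /=.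
  by rewrite binvK.
by apply/eqP/eqP => /= [<-|->]; rewrite ?K1 ?K2.
Qed.

Lemma mag_act_mono (A B : finType) (f : bijection A B) (t : mtree A) :
  mag_act f (mono t) = mono (mrelabel f t).
Proof. exact: mag_act_tree. Qed.

Lemma mag_comp_linearl (A B : finType) (y : tspan B) :
  linear (fun x : tspan (option A) => mag_comp x y).
Proof.
move=> k x x'; rewrite /mag_comp scaler_sumr -big_split; apply: eq_bigr => s _.
rewrite scaler_sumr -big_split; apply: eq_bigr => u _ /=.
by rewrite !ffunE mulrDl scalerDl scalerA mulrA.
Qed.

Lemma mag_comp_linearr (A B : finType) (x : tspan (option A)) :
  linear (fun y : tspan B => mag_comp x y).
Proof.
move=> k y y'; rewrite /mag_comp scaler_sumr -big_split; apply: eq_bigr => s _.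
rewrite scaler_sumr -big_split; apply: eq_bigr => u _ /=.
by rewrite !ffunE mulrDr scalerDl scalerA mulrCA.
Qed.

Lemma mag_comp_mono (A B : finType) (s : mtree (option A)) (u : mtree B) :
  mag_comp (mono s) (mono u) = mono (mgraft s u).
Proof.
rewrite /mag_comp (bigD1 s) //= (bigD1 u) //= !monoE !eqxx mulr1 scale1r.
rewrite big1 ?addr0 => [|v nvu]; last by rewrite !monoE (negbTE nvu) mulr0 scale0r.
rewrite big1 ?addr0 // => v nvs; rewrite big1 // => w _.
by rewrite monoE (negbTE nvs) mul0r scale0r.
Qed.

End Magmatic.

Section TreeOperadLaws.

Lemma tmapE A B (f : A -> B) a : tmap f (Leaf a) = Leaf (f a).
Proof. by []. Qed.

Lemma tmap_id A (f : A -> A) t : f =1 id -> tmap f t = t.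
Proof.
by move=> fid; rewrite -[RHS]tbind_Leaf; apply: eq_tbind => a /=; rewrite fid.
Qed.

Lemma tmap_comp A B C (f : A -> B) (g : B -> C) t :
  tmap g (tmap f t) = tmap (g \o f) t.
Proof. by rewrite /tmap tbindA. Qed.

Lemma eq_tmap A B (f g : A -> B) t : f =1 g -> tmap f t = tmap g t.
Proof. by move=> fg; apply: eq_tbind => a /=; rewrite fg. Qed.

Lemma tmap_bind A B C (f : B -> C) (g : A -> tree B) t :
  tmap f (tbind t g) = tbind t (tmap f \o g).
Proof. by rewrite /tmap tbindA. Qed.

Lemma tbind_map A B C (f : A -> B) (g : B -> tree C) t :
  tbind (tmap f t) g = tbind t (g \o f).
Proof. by rewrite /tmap tbindA. Qed.

Lemma tgraft_map A A' B B' (f : bijection A A') (g : bijection B B') s u :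
  tgraft (tmap (bopt f) s) (tmap g u) = tmap (bsum f g) (tgraft s u).
Proof.
rewrite /tgraft tbind_map tmap_bind; apply: eq_tbind => -[a|] //=.
by rewrite !tmap_comp.
Qed.

Lemma tgraft_unitl B (u : tree B) :
  tgraft (tmap bunit_void (Leaf tt)) u = tmap (bsum_void B) u.
Proof. by []. Qed.

Lemma tgraft_unitr A (s : tree (option A)) :
  tgraft s (Leaf tt) = tmap (bsum_unit A) s.
Proof. by rewrite /tgraft /tmap; apply: eq_tbind => -[]. Qed.

Lemma tgraftA A B C (s : tree (option A)) (t : tree (option B)) (u : tree C) :
  tmap (bsumA A B C) (tgraft s (tgraft t u))
  = tgraft (tmap (boptr A B) (tgraft s t)) u.
Proof.
rewrite /tgraft tbind_map tmap_bind tbindA; apply: eq_tbind => -[a|] //=.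
rewrite tmap_comp tmap_bind tbind_map; apply: eq_tbind => -[b|] //=.
by rewrite tmap_comp.
Qed.

Lemma tgraftAC A B C (s : tree (option (option A))) (t : tree B) (u : tree C) :
  tgraft (tmap (boptl A B) (tgraft s t)) u
  = tmap (bsumAC A C B)
      (tgraft (tmap (boptl A C) (tgraft (tmap (boptswap A) s) u)) t).
Proof.
rewrite /tgraft !tbind_map !tbindA tmap_bind.
apply: eq_tbind => -[[a|]|] //=.
  by rewrite tbind_map tmap_bind.
by rewrite tbind_map tmap_comp.
Qed.

End TreeOperadLaws.

Section MagOperad.
Variable K : fieldType.

Lemma mag_act_id (A : finType) (f : bijection A A) (x : tspan K A) :
  f =1 id -> mag_act f x = x.
Proof.
move=> fid; move: x; apply: tspan_ext => [||t] //; first exact: mag_act_linear.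
by rewrite mag_act_mono /= tmap_id.
Qed.

Lemma mag_act_comp (A B C : finType) (f : bijection A B) (g : bijection B C)
    (h : bijection A C) (x : tspan K A) :
  h =1 g \o f -> mag_act h x = mag_act g (mag_act f x).
Proof.
move=> hgf; move: x; apply: tspan_ext => [||t].
- exact: mag_act_linear.
- by move=> k u v; rewrite !mag_act_linear.
by rewrite !mag_act_mono /= tmap_comp (eq_tmap _ hgf).
Qed.

Lemma mag_comp_act (A A' B B' : finType) (f : bijection A A')
    (g : bijection B B') (x : tspan K (option A)) (y : tspan K B) :
  mag_comp (mag_act (bopt f) x) (mag_act g y)
  = mag_act (bsum f g) (mag_comp x y).
Proof.
move: x; apply: tspan_ext => [k u v|k u v|s].
- by rewrite !(mag_act_linear, mag_comp_linearl).
- by rewrite !(mag_act_linear, mag_comp_linearl).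
move: y; apply: tspan_ext => [k u v|k u v|t].
- by rewrite !(mag_act_linear, mag_comp_linearr).
- by rewrite !(mag_act_linear, mag_comp_linearr).
by rewrite !(mag_act_mono, mag_comp_mono) /= tgraft_map.
Qed.

Definition mag_unit : tspan K unit := mono K (Leaf tt).

Lemma mag_unitE : mag_unit = mono K (MTree multilinear_unit).
Proof. by []. Qed.

Lemma mag_unitl (B : finType) (y : tspan K B) :
  mag_comp (mag_act bunit_void mag_unit) y = mag_act (bsum_void B) y.
Proof.
move: y; apply: tspan_ext => [k u v|k u v|t].
- by rewrite mag_comp_linearr.
- by rewrite mag_act_linear.
by rewrite mag_unitE !(mag_act_mono, mag_comp_mono).
Qed.

Lemma mag_unitr (A : finType) (x : tspan K (option A)) :
  mag_comp x mag_unit = mag_act (bsum_unit A) x.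
Proof.
move: x; apply: tspan_ext => [k u v|k u v|t].
- by rewrite mag_comp_linearl.
- by rewrite mag_act_linear.
by rewrite mag_unitE mag_act_mono mag_comp_mono /= tgraft_unitr.
Qed.

Lemma mag_compA (A B C : finType) (x : tspan K (option A))
    (y : tspan K (option B)) (z : tspan K C) :
  mag_act (bsumA A B C) (mag_comp x (mag_comp y z))
  = mag_comp (mag_act (boptr A B) (mag_comp x y)) z.
Proof.
move: x; apply: tspan_ext => [k u v|k u v|s].
- by rewrite mag_comp_linearl mag_act_linear.
- by rewrite mag_comp_linearl mag_act_linear mag_comp_linearl.
move: y; apply: tspan_ext => [k u v|k u v|t].
- by rewrite mag_comp_linearl mag_comp_linearr mag_act_linear.
- by rewrite mag_comp_linearr mag_act_linear mag_comp_linearl.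
move: z; apply: tspan_ext => [k u' v|k u' v|u].
- by rewrite !mag_comp_linearr mag_act_linear.
- by rewrite mag_comp_linearr.
by rewrite !(mag_act_mono, mag_comp_mono) /= tgraftA.
Qed.

Lemma mag_compAC (A B C : finType) (x : tspan K (option (option A)))
    (y : tspan K B) (z : tspan K C) :
  mag_comp (mag_act (boptl A B) (mag_comp x y)) z
  = mag_act (bsumAC A C B)
      (mag_comp (mag_act (boptl A C) (mag_comp (mag_act (boptswap A) x) z)) y).
Proof.
move: x; apply: tspan_ext => [k u v|k u v|s].
- by rewrite !(mag_comp_linearl, mag_act_linear).
- by rewrite !(mag_comp_linearl, mag_act_linear).
move: y; apply: tspan_ext => [k u v|k u v|t].
- by rewrite mag_comp_linearr mag_act_linear mag_comp_linearl.
- by rewrite mag_comp_linearr mag_act_linear.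
move: z; apply: tspan_ext => [k u' v|k u' v|u].
- by rewrite mag_comp_linearr.
- by rewrite mag_comp_linearr !(mag_comp_linearl, mag_act_linear).
by rewrite !(mag_act_mono, mag_comp_mono) /= tgraftAC.
Qed.

Definition Mag : operad K :=
  @Operad K (tspan K) (@mag_act K) (@mag_comp K) mag_unit
    (@mag_act_linear K) mag_act_id mag_act_comp
    (@mag_comp_linearl K) (@mag_comp_linearr K) mag_comp_act
    mag_unitl mag_unitr mag_compA mag_compAC.

End MagOperad.

Definition i2_1 : 'I_2 := @Ordinal 2 0 isT.
Definition i2_2 : 'I_2 := @Ordinal 2 1 isT.
Definition i3_1 : 'I_3 := @Ordinal 3 0 isT.
Definition i3_2 : 'I_3 := @Ordinal 3 1 isT.
Definition i3_3 : 'I_3 := @Ordinal 3 2 isT.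

(* a_1 * a_2 *)
Definition tree12 : tree 'I_2 := Node (Leaf i2_1) (Leaf i2_2).
(* a_2 * a_1 *)
Definition tree21 : tree 'I_2 := Node (Leaf i2_2) (Leaf i2_1).

(* (a_i * a_j) * a_k *)
Definition lcomb (i j k : 'I_3) : tree 'I_3 :=
  Node (Node (Leaf i) (Leaf j)) (Leaf k).
(* a_i * (a_j * a_k) *)
Definition rcomb (i j k : 'I_3) : tree 'I_3 :=
  Node (Leaf i) (Node (Leaf j) (Leaf k)).

(* [[a_1,a_2],a_3] + [[a_2,a_3],a_1] + [[a_3,a_1],a_2]. *)
Definition jacobi_trees : seq (tree 'I_3) :=
  [:: lcomb i3_1 i3_2 i3_3; lcomb i3_2 i3_3 i3_1; lcomb i3_3 i3_1 i3_2].

Section LiePreLie.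
Variable K : fieldType.

Inductive lie_rel : forall A : finType, Mag K A -> Prop :=
| lie_antisym : @lie_rel 'I_2 (mono K tree12 + mono K tree21)
| lie_jacobi : @lie_rel 'I_3 (\sum_(t <- jacobi_trees) mono K t).

Definition Lie : operad K := quot_operad lie_rel.

Inductive prelie_rel : forall A : finType, Mag K A -> Prop :=
| prelie_rsym : @prelie_rel 'I_3
    ((mono K (lcomb i3_1 i3_2 i3_3) - mono K (rcomb i3_1 i3_2 i3_3))
     - (mono K (lcomb i3_1 i3_3 i3_2) - mono K (rcomb i3_1 i3_3 i3_2))).

Definition PreLie : operad K := quot_operad prelie_rel.

Definition lie_bracket : Lie 'I_2 := quot_proj lie_rel _ (mono K tree12).

Definition prelie_prod : PreLie 'I_2 := quot_proj prelie_rel _ (mono K tree12).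
(* a_2 <| a_1 *)
Definition prelie_prod_op : PreLie 'I_2 :=
  quot_proj prelie_rel _ (mono K tree21).

Section Expand.
Variable V : lmodType K.

(* The sum of h over the signed trees obtained from t by expanding every      *)
(* vertex [x, y] into x * y - y * x.                                          *)
Fixpoint expand A (t : tree A) (h : tree A -> V) : V :=
  match t with
  | Leaf a => h (Leaf a)
  | Node t1 t2 => expand t1 (fun u1 => expand t2 (fun u2 =>
      h (Node u1 u2) - h (Node u2 u1)))
  end.

Lemma eq_expand A (t : tree A) (h h' : tree A -> V) :
  h =1 h' -> expand t h = expand t h'.
Proof.
elim: t h h' => [a|t1 IH1 t2 IH2] h h' hh' //=.
by apply: IH1 => u1; apply: IH2 => u2; rewrite !hh'.
Qed.

Lemma eq_expand_perm (A : eqType) (t : tree A) (h h' : tree A -> V) :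
  (forall u, perm_eq (leaves u) (leaves t) -> h u = h' u) ->
  expand t h = expand t h'.
Proof.
elim: t h h' => [a|t1 IH1 t2 IH2] h h' hh' /=; first exact: hh'.
apply: IH1 => u1 p1; apply: IH2 => u2 p2.
congr (_ - _); apply: hh' => /=; first exact: perm_cat.
by rewrite perm_catC perm_cat.
Qed.

Lemma expand_linear A (t : tree A) (h h' : tree A -> V) k :
  expand t (fun u => k *: h u + h' u) = k *: expand t h + expand t h'.
Proof.
elim: t h h' => [a|t1 IH1 t2 IH2] h h' //=.
rewrite -IH1; apply: eq_expand => u1; rewrite -IH2; apply: eq_expand => u2.
by rewrite scalerBr opprD addrACA.
Qed.

Lemma expand_sub A (t : tree A) (h h' : tree A -> V) :
  expand t (fun u => h u - h' u) = expand t h - expand t h'.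
Proof.
rewrite [RHS]addrC -scaleN1r -expand_linear; apply: eq_expand => u.
by rewrite scaleN1r addrC.
Qed.

Lemma expandC A B (t : tree A) (u : tree B) (h : tree A -> tree B -> V) :
  expand t (fun x => expand u (fun y => h x y))
  = expand u (fun y => expand t (fun x => h x y)).
Proof.
elim: t h => [a|t1 IH1 t2 IH2] h //=.
rewrite -IH1; apply: eq_expand => x1.
rewrite -IH2; apply: eq_expand => x2.
by rewrite expand_sub.
Qed.

Lemma expand_map A B (f : A -> B) (t : tree A) (h : tree B -> V) :
  expand (tmap f t) h = expand t (h \o tmap f).
Proof.
elim: t h => [a|t1 IH1 t2 IH2] h //=.
by rewrite IH1; apply: eq_expand => u1 /=; rewrite IH2.
Qed.

Lemma expand_graft0 (A B : eqType) (s : tree (option A)) (u u' : tree B)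
    (h : tree (A + B) -> V) : None \notin leaves s ->
  expand (tgraft s u) h = expand s (fun s' => h (tgraft s' u')).
Proof.
elim: s h => [[a|]|s1 IH1 s2 IH2] h //=; rewrite mem_cat negb_or.
move=> /andP[n1 n2]; rewrite IH1 //; apply: eq_expand => s1'.
by rewrite IH2.
Qed.

Lemma expand_graft (A B : eqType) (s : tree (option A)) (u : tree B)
    (h : tree (A + B) -> V) : count_mem None (leaves s) = 1%N ->
  expand (tgraft s u) h
  = expand s (fun s' => expand u (fun u' => h (tgraft s' u'))).
Proof.
elim: s h => [[a|]|s1 IH1 s2 IH2] h //=.
  by rewrite [tgraft _ _]/= expand_map.
rewrite count_cat => c12.
have [n1|p1] := posnP (count_mem None (leaves s1)).
  have n1' : None \notin leaves s1 by rewrite -has_pred1 has_count n1.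
  rewrite n1 add0n in c12.
  under eq_expand => w1 do rewrite IH2 //.
  rewrite expandC [RHS]expandC; apply: eq_expand => s2'.
  rewrite expandC.
  under [RHS]eq_expand => s1' do rewrite -expand_sub.
  by rewrite [RHS]expandC; apply: eq_expand => u'; rewrite (expand_graft0 _ u').
have n2 : None \notin leaves s2.
  rewrite -has_pred1 has_count -leqNgt -(leq_add2l (count_mem None (leaves s1))).
  by rewrite c12 addn0.
have c1 : count_mem None (leaves s1) = 1%N.
  by apply/eqP; rewrite eqn_leq p1 -c12 leq_addr.
rewrite IH1 //; apply: eq_expand => s1'.
under [RHS]eq_expand => s2' do rewrite -expand_sub.
rewrite [RHS]expandC; apply: eq_expand => u'.
by rewrite (expand_graft0 _ u').
Qed.

End Expand.

Lemma expand_comp (U V : lmodType K) (F : U -> V) A (t : tree A)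
    (h : tree A -> U) : linear F -> F (expand t h) = expand t (F \o h).
Proof.
move=> lF; elim: t h => [a|t1 IH1 t2 IH2] h //=.
rewrite IH1; apply: eq_expand => u1; rewrite /= IH2; apply: eq_expand => u2 /=.
by rewrite linear_sub.
Qed.

Lemma multilinear_perm (A : finType) (t u : tree A) :
  perm_eq (leaves u) (leaves t) -> multilinear t -> multilinear u.
Proof.
by move=> p /forallP tP; apply/forallP => a; rewrite (seq.permP p) tP.
Qed.

Definition commut_fun (A : finType) (x : Mag K A) : Mag K A :=
  \sum_(t : mtree A) x t *: expand t (@mono K A).

Lemma commut_linear (A : finType) : linear (@commut_fun A).
Proof.
move=> k x y; rewrite /commut_fun scaler_sumr -big_split; apply: eq_bigr => t _.
by rewrite !ffunE scalerDl scalerA.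
Qed.

HB.instance Definition _ (A : finType) :=
  GRing.isSemilinear.Build K (Mag K A) (Mag K A) _ (@commut_fun A)
    (GRing.semilinear_linear (@commut_linear A)).

Lemma commut_mono (A : finType) (t : tree A) : multilinear t ->
  commut_fun (mono K t) = expand t (@mono K A).
Proof.
move=> tP; rewrite /commut_fun (bigD1 (MTree tP)) //= ffunE eqxx scale1r.
by rewrite big1 ?addr0 // => u nu; rewrite ffunE [_ == t](negbTE nu) scale0r.
Qed.

Program Definition commut : operad_hom (Mag K) (Mag K) :=
  @OperadHom K (Mag K) (Mag K) (fun A => linfun (@commut_fun A)) _ _ _.
Next Obligation.
move=> A B f x; rewrite !lfunE /=.
move: x; apply: tspan_ext => [k x y|k x y|t].
- by rewrite mag_act_linear commut_linear.
- by rewrite commut_linear mag_act_linear.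
rewrite mag_act_mono !commut_mono ?mtreeP // (expand_comp _ _ (mag_act_linear f)).
by rewrite expand_map; apply: eq_expand => u /=; rewrite mag_act_tree.
Qed.
Next Obligation.
move=> A B x y; rewrite !lfunE /=.
move: x; apply: tspan_ext => [k u v|k u v|s].
- by rewrite mag_comp_linearl commut_linear.
- by rewrite commut_linear mag_comp_linearl.
move: y; apply: tspan_ext => [k u v|k u v|t].
- by rewrite mag_comp_linearr commut_linear.
- by rewrite commut_linear mag_comp_linearr.
rewrite mag_comp_mono !commut_mono ?mtreeP //=.
rewrite (expand_comp _ _ (mag_comp_linearl _)) expand_graft; last first.
  by have /forallP/(_ None)/eqP := mtreeP s.
apply: eq_expand_perm => s' ps.
rewrite /= (expand_comp _ _ (mag_comp_linearr _)).
apply: eq_expand_perm => u' pu /=.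
have sP := multilinear_perm ps (mtreeP s).
have uP := multilinear_perm pu (mtreeP t).
by rewrite -[s']/(mtree_val (MTree sP)) -[u']/(mtree_val (MTree uP)) mag_comp_mono.
Qed.
Next Obligation.
by rewrite lfunE /= commut_mono //; apply: multilinear_unit.
Qed.

Program Definition hom_comp (P Q R : operad K) (g : operad_hom Q R)
    (f : operad_hom P Q) : operad_hom P R :=
  @OperadHom K P R (fun A => (g A \o f A)%VF) _ _ _.
Next Obligation. by move=> P Q R g f A B b x; rewrite !lfunE /= !oh_act. Qed.
Next Obligation. by move=> P Q R g f A B x y; rewrite !lfunE /= !oh_comp. Qed.
Next Obligation. by move=> P Q R g f; rewrite !lfunE /= !oh_unit. Qed.

Lemma hom_compE (P Q R : operad K) (g : operad_hom Q R) (f : operad_hom P Q)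
    (A : finType) x : hom_comp g f A x = g A (f A x).
Proof. exact: lfunE. Qed.

Lemma commutE (A : finType) (x : Mag K A) : commut A x = commut_fun x.
Proof. exact: lfunE. Qed.

Lemma multilinear12 : multilinear tree12.
Proof. by apply/forallP => -[[|[|m]] ?]. Qed.

Lemma multilinear21 : multilinear tree21.
Proof. by apply/forallP => -[[|[|m]] ?]. Qed.

Lemma multilinear_jacobi t : t \in jacobi_trees -> multilinear t.
Proof.
by rewrite !inE => /or3P[] /eqP ->; apply/forallP => -[[|[|[|m]]] ?].
Qed.

Definition rot3 : bijection 'I_3 'I_3 :=
  @Bijection 'I_3 'I_3 (fun i => i + 1) (fun i => i - 1) (addrK 1) (subrK 1).

Lemma expand_lcomb (V : lmodType K) i j k (h : tree 'I_3 -> V) :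
  expand (lcomb i j k) h
  = (h (lcomb i j k) - h (rcomb k i j)) - (h (lcomb j i k) - h (rcomb k j i)).
Proof. by []. Qed.

Definition rsym (V : zmodType) (m : tree 'I_3 -> V) (i j k : 'I_3) : V :=
  (m (lcomb i j k) - m (rcomb i j k)) - (m (lcomb i k j) - m (rcomb i k j)).

Lemma expand_jacobi (V : lmodType K) (m : tree 'I_3 -> V) :
  \sum_(t <- jacobi_trees) expand t m
  = rsym m i3_1 i3_2 i3_3 + rsym m i3_2 i3_3 i3_1 + rsym m i3_3 i3_1 i3_2.
Proof.
rewrite /jacobi_trees !big_cons big_nil addr0 !expand_lcomb /rsym !opprB !addrA.
by rewrite [LHS](ACl (1*6*7*12*5*10*11*4*9*2*3*8)).
Qed.

Lemma rsym_act (i j k i' j' k' : 'I_3) :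
  i + 1 = i' -> j + 1 = j' -> k + 1 = k' ->
  mag_act rot3 (rsym (@mono K 'I_3) i j k) = rsym (@mono K 'I_3) i' j' k'.
Proof.
move=> <- <- <-.
have subE x y z w : mag_act rot3 (x - y - (z - w)) = mag_act (K := K) rot3 x
    - mag_act rot3 y - (mag_act rot3 z - mag_act rot3 w).
  by rewrite !(linear_sub (mag_act_linear rot3)).
rewrite /rsym subE; clear subE.
by congr (_ - _ - (_ - _)); apply: mag_act_tree.
Qed.

Lemma lie_to_prelie_rel (A : finType) (x : Mag K A) : lie_rel x ->
  hom_comp (quot_proj prelie_rel) commut A x = 0.
Proof.
case=> {A x}; rewrite hom_compE commutE; last first.
  apply/quot_proj_eq0; rewrite linear_sum /=.
  under eq_big_seq => t tJ do rewrite commut_mono ?multilinear_jacobi //.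
  rewrite expand_jacobi.
  have [actI _ _] := gen_idealP prelie_rel.
  have rI : rsym (@mono K 'I_3) i3_1 i3_2 i3_3 \in gen_ideal prelie_rel 'I_3.
    exact: mem_gen_ideal prelie_rsym.
  have e12 : i3_1 + 1 = i3_2 by apply: val_inj.
  have e23 : i3_2 + 1 = i3_3 by apply: val_inj.
  have e31 : i3_3 + 1 = i3_1 by apply: val_inj.
  have rI2 : rsym (@mono K 'I_3) i3_2 i3_3 i3_1 \in gen_ideal prelie_rel 'I_3.
    by rewrite -(rsym_act e12 e23 e31); apply: actI.
  have rI3 : rsym (@mono K 'I_3) i3_3 i3_1 i3_2 \in gen_ideal prelie_rel 'I_3.
    by rewrite -(rsym_act e23 e31 e12); apply: actI.
  exact: memvD (memvD rI rI2) rI3.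
rewrite linearD /= !commut_mono ?multilinear12 ?multilinear21 //=.
by rewrite addrA subrK subrr linear0.
Qed.

Definition lie_to_prelie : operad_hom Lie PreLie := descent lie_to_prelie_rel.

Lemma lie_to_prelie_bracket :
  lie_to_prelie _ lie_bracket = prelie_prod - prelie_prod_op.
Proof.
rewrite [LHS](descent_funE lie_to_prelie_rel) hom_compE commutE.
by rewrite commut_mono ?multilinear12 //= linearB.
Qed.

End LiePreLie.

(******************************************************************************)
(* The Koszul dual cooperad of Lie.                                           *)
(*   Let X be the S_2-module spanned by the antisymmetric Lie bracket. The    *)
(* component T^c(sX)(A) of the cofree cooperad is spanned by the planar       *)
(* binary trees t with leaves labelled by A, all vertices being decorated by  *)
(* s[-,-] of degree 1 and ordered as root, left subtree, right subtree;       *)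
(* exchanging the two subtrees t1, t2 of a vertex multiplies the element by   *)
(*   - (-1) ^ (|t1| |t2|),                                                    *)
(* the product of the sign of X and of the Koszul sign reordering the         *)
(* vertices. Thus an element c is determined by its coordinates c t along all *)
(* planar trees t (which transform accordingly), and T^c(sX)(A) is realized   *)
(* as a subspace of tspan K A. It lives in degree = weight = #|A| - 1.        *)
(******************************************************************************)

Section KoszulDual.
Variable K : fieldType.

(* The coordinate along u of the element of T^c(sX) given by t. *)
Fixpoint coord_tree (A : eqType) (t u : tree A) : K :=
  match t, u with
  | Leaf a, Leaf b => (a == b)%:R
  | Node t1 t2, Node u1 u2 =>
      coord_tree t1 u1 * coord_tree t2 u2
      - (-1) ^+ (weight t1 * weight t2) * (coord_tree t1 u2 * coord_tree t2 u1)
  | _, _ => 0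
  end.

Definition cotree (A : finType) (t : tree A) : tspan K A :=
  [ffun u : mtree A => coord_tree t u].

Definition cofree (A : finType) : {vspace tspan K A} :=
  vspan (fun c => exists t : mtree A, c = cotree t).

(* The number of vertices of s that come after the leaf None. *)
Fixpoint weight_after (A : Type) (s : tree (option A)) : nat :=
  match s with
  | Leaf _ => 0
  | Node s1 s2 =>
      if has (fun o => ~~ isSome o) (leaves s1)
      then (weight_after s1 + weight s2)%N else weight_after s2
  end.

(* The coefficient along s (x) u of the infinitesimal decomposition of c at   *)
(* the two-vertex tree with root inputs A u {*} and upper inputs B. In the    *)
(* vertex order of the grafted tree the block of u sits inside s; moving it   *)
(* to the right of s produces the Koszul sign. The decompositions where s or  *)
(* u is the trivial tree are included.                                        *)
Definition decomp (A B : finType) (c : tspan K (A + B)%type)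
    (s : mtree (option A)) (u : mtree B) : K :=
  (-1) ^+ (weight u * weight_after s) * c (mgraft s u).

(* d belongs to U (x) W, inside the functions of two variables. *)
Definition in_tensor (A B : finType) (U : {vspace tspan K A})
    (W : {vspace tspan K B}) (d : mtree A -> mtree B -> K) : Prop :=
  exists l : seq (tspan K A * tspan K B),
    (forall p, p \in l -> p.1 \in U /\ p.2 \in W) /\
    (forall s u, d s u = \sum_(p <- l) p.1 s * p.2 u).

Definition subcooperad (D : forall A : finType, {vspace tspan K A}) : Prop :=
  [/\ forall A : finType, (D A <= cofree A)%VS,
      forall (A B : finType) (f : bijection A B) c,
        c \in D A -> mag_act f c \in D B &
      forall (A B : finType) (c : tspan K (A + B)%type), c \in D _ ->
        in_tensor (D (option A)) (D B) (decomp c)].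

(* The corelations s^2 R, for R spanned by the Jacobi identity. Both vertex   *)
(* orders are root first, so that s^2 introduces no sign.                     *)
Definition corelations : {vspace tspan K 'I_3} :=
  <[\sum_(t <- jacobi_trees) cotree t]>%VS.

(* The quadratic cooperad cogenerated by sX with corelations s^2 R: the       *)
(* largest subcooperad C of T^c(sX) such that C -> T^c(sX)^(2) / s^2 R is     *)
(* zero. The weight 2 part of T^c(sX) is its arity 3 component.               *)
Definition LieDual (A : finType) : {vspace tspan K A} :=
  vspan (fun c => exists D : forall B : finType, {vspace tspan K B},
    [/\ subcooperad D, (D 'I_3 <= corelations)%VS & c \in D A]).

Lemma LieDual_max (D : forall A : finType, {vspace tspan K A}) :
  subcooperad D -> (D 'I_3 <= corelations)%VS ->
  forall A : finType, (D A <= LieDual A)%VS.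
Proof. by move=> *; apply/subvP => c cD; apply: mem_vspan; exists D. Qed.

Lemma LieDual_corel : (LieDual 'I_3 <= corelations)%VS.
Proof. by apply: vspan_sub => c [D [_ /subvP D3 /D3]]. Qed.

Lemma LieDual_act (A B : finType) (f : bijection A B) c :
  c \in LieDual A -> mag_act f c \in LieDual B.
Proof.
move: c; apply: vspan_ind => [c [D [subD D3 cD]]||k x y xB yB].
- by apply/(subvP (LieDual_max subD D3 B)); case: subD => _ actD _; apply: actD.
- by rewrite (linear_zero (mag_act_linear f)) mem0v.
- by rewrite mag_act_linear memvD ?memvZ.
Qed.

Lemma LieDual_subcooperad : subcooperad LieDual.
Proof.
split=> [A|A B f c|A B]; last first; first 1 last.
- exact: LieDual_act.
- by apply: vspan_sub => c [D [[/(_ A)/subvP subD _ _] _ /subD]].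
apply: vspan_ind => [c [D [subD D3 cD]]||k x y [l [lP lE]] [l' [lP' lE']]].
- have [_ _ /(_ _ _ _ cD) [l [lP lE]]] := subD.
  exists l; split=> // p /lP[p1 p2].
  by split; [apply: subvP p1|apply: subvP p2]; apply: LieDual_max.
- exists [::]; split=> // s u.
  by rewrite big_nil /decomp ffunE mulr0.
exists ([seq (k *: p.1, p.2) | p <- l] ++ l'); split.
  move=> p; rewrite mem_cat => /orP[/mapP[q /lP[q1 q2] ->]|/lP' //].
  by split; rewrite ?memvZ.
move=> s u; rewrite big_cat big_map -lE' /decomp !ffunE mulrDr; congr (_ + _).
rewrite [k *: _]/(k * _) mulrCA -[_ * x _]/(decomp x s u) lE big_distrr.
by apply: eq_bigr => p _ /=; rewrite !ffunE mulrA.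
Qed.

End KoszulDual.

Section SetSplit.
Variables (n : nat) (S : {set 'I_n}).

Definition split_fun (x : {i | i \notin S} + {i | i \in S}) : 'I_n :=
  match x with inl i => val i | inr i => val i end.

Definition split_inv (i : 'I_n) : {i | i \notin S} + {i | i \in S} :=
  match boolP (i \in S) with
  | AltTrue iS => inr (exist _ i iS)
  | AltFalse iS => inl (exist _ i iS)
  end.

Lemma split_funK : cancel split_fun split_inv.
Proof.
case=> [] [i iS] /=; rewrite /split_inv; case: {-}_ / boolP => iS' //=.
- by have := negP iS iS'.
- by congr inl; apply: val_inj.
- by congr inr; apply: val_inj.
- by have := negP iS' iS.
Qed.

Lemma split_invK : cancel split_inv split_fun.
Proof. by move=> i; rewrite /split_inv; case: {-}_ / boolP. Qed.

Definition bsplit : bijection ({i | i \notin S} + {i | i \in S}) 'I_n :=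
  Bijection split_funK split_invK.

End SetSplit.

Definition benum (A : finType) : bijection 'I_#|A| A :=
  Bijection (@enum_valK A) (@enum_rankK A).

Section DeformationComplex.
Variables (K : fieldType) (Q : operad K).

(* Q is regarded as an operad in degree 0. There are no trees in arity n = 0, *)
(* so that this factor of the product is zero.                                *)
Definition cochain : Type :=
  forall n : nat, 'Hom(subvs_of (LieDual K 'I_n), Q 'I_n).

Definition dual_act (A B : finType) (f : bijection A B)
    (c : subvs_of (LieDual K A)) : subvs_of (LieDual K B) :=
  vsproj (LieDual K B) (mag_act f (vsval c)).

Lemma dual_actE (A B : finType) (f : bijection A B) c :
  vsval (dual_act f c) = mag_act f (vsval c).
Proof. by rewrite vsprojK // LieDual_act ?subvsP. Qed.

Definition equivariant (phi : cochain) : Prop :=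
  forall n (sigma : bijection 'I_n 'I_n) c,
    phi n (dual_act sigma c) = op_act sigma (phi n c).

(* phi maps elements of degree m to elements of degree d + m, which vanish    *)
(* unless d + m = 0 since Q is concentrated in degree 0.                      *)
Definition of_degree (d : int) (phi : cochain) : Prop :=
  forall n (m : nat) (c : subvs_of (LieDual K 'I_n)),
    (forall t : mtree 'I_n, vsval c t != 0 -> weight t = m) ->
    d + m%:Z != 0 -> phi n c = 0.

(* Hom^S(LieDual, Q)_d *)
Definition HomS (d : int) (phi : cochain) : Prop :=
  equivariant phi /\ of_degree d phi.

(* The value of phi on LieDual(A), transported along a bijection of A with    *)
(* 'I_#|A|, and extended to tspan K A by a projection onto LieDual(A).        *)
Definition cochain_at (phi : cochain) (A : finType) (c : tspan K A) : Q A :=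
  op_act (benum A)
    (phi #|A| (vsproj (LieDual K 'I_#|A|) (mag_act (bsym (benum A)) c))).

(* The product of phi and psi, for psi of degree e. The decomposition of c at *)
(* S, which lies in LieDual (x) LieDual, is expanded in the basis s (x) u of  *)
(* the ambient space, on which phi (x) psi acts with the sign                 *)
(* (-1) ^ (|psi| |s|).                                                        *)
Definition def_conv_fun (e : int) (phi psi : cochain) (n : nat)
    (c : subvs_of (LieDual K 'I_n)) : Q 'I_n :=
  \sum_(S : {set 'I_n})
    \sum_(s : mtree (option {i | i \notin S})) \sum_(u : mtree {i | i \in S})
      ((-1) ^+ (`|e| * weight s)
       * decomp (mag_act (bsym (bsplit S)) (vsval c)) s u)
      *: op_act (bsplit S)
           (op_comp (cochain_at phi (mono K s)) (cochain_at psi (mono K u))).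

Lemma def_conv_linear e phi psi n : linear (@def_conv_fun e phi psi n).
Proof.
move=> k x y; rewrite /def_conv_fun scaler_sumr -big_split; apply: eq_bigr => S _.
rewrite scaler_sumr -big_split; apply: eq_bigr => s _.
rewrite scaler_sumr -big_split; apply: eq_bigr => u _ /=.
rewrite scalerA -scalerDl; congr (_ *: _).
rewrite /decomp !ffunE -[k *: _]/(k * _).
by rewrite !mulrDr; congr (_ + _); rewrite !(mulrCA _ k).
Qed.

HB.instance Definition _ e phi psi n :=
  GRing.isSemilinear.Build K (subvs_of (LieDual K 'I_n)) (Q 'I_n) _
    (@def_conv_fun e phi psi n) (GRing.semilinear_linear (@def_conv_linear e phi psi n)).

Definition def_conv (e : int) (phi psi : cochain) : cochain :=
  fun n => linfun (@def_conv_fun e phi psi n).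

(* [phi, psi] for |phi| = d and |psi| = e *)
Definition def_bracket (d e : int) (phi psi : cochain) : cochain :=
  fun n => def_conv e phi psi n - (-1) ^+ (`|d| * `|e|) *: def_conv d psi phi n.

Variable f : operad_hom (Lie K) Q.

(* The composite LieDual(2) -> sX -> X -> Q(2): the coordinate of c along     *)
(* tree12 is its coefficient with respect to s[a_1, a_2].                     *)
Definition def_alpha_fun (c : subvs_of (LieDual K 'I_2)) : Q 'I_2 :=
  vsval c (MTree multilinear12) *: f _ (lie_bracket K).

Lemma def_alpha_linear : linear def_alpha_fun.
Proof. by move=> k x y; rewrite /def_alpha_fun !ffunE scalerDl scalerA. Qed.

HB.instance Definition _ :=
  GRing.isSemilinear.Build K (subvs_of (LieDual K 'I_2)) (Q 'I_2) _
    def_alpha_fun (GRing.semilinear_linear def_alpha_linear).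

Definition def_alpha : cochain := fun n =>
  match n with 2 => linfun def_alpha_fun | _ => 0 end.

Definition def_diff (d : int) (phi : cochain) : cochain :=
  def_bracket (-1) d def_alpha phi.

Definition def_cycle (d : int) (phi : cochain) : Prop :=
  HomS d phi /\ forall n, def_diff d phi n = 0.

Definition def_boundary (d : int) (phi : cochain) : Prop :=
  exists psi, HomS (d + 1) psi /\ forall n, def_diff (d + 1) psi n = phi n.

Definition def_acyclic : Prop :=
  forall (d : int) (phi : cochain), def_cycle d phi -> def_boundary d phi.

End DeformationComplex.

(* Main.v *)
(* The cooperad LieDual is one-dimensional in each arity, with a basis element *)
(* that permutations multiply by their signature. Hence a cochain is an        *)
(* antisymmetric element of PreLie(n), i.e. an element of degree n of the free *)
(* super pre-Lie algebra on one odd generator x, and the differential becomes  *)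
(*   d f = x f - (-1)^|f| f x - D f,                                           *)
(* where D is the odd derivation with D x = x x. Let h be the odd derivation   *)
(* substituting for x a formal element e with e a = 0 and a e = |a| a up to    *)
(* sign. Then - (d h + h d) multiplies a rooted tree by its number of tips, up *)
(* to trees with fewer tips, so that it is invertible in characteristic zero.  *)

Require Import Defs.
From HB Require Import structures.
From mathcomp Require Import all_boot all_order all_fingroup all_algebra.
From mathcomp Require Import boolp ring zify.

Set Implicit Arguments.
Unset Strict Implicit.
Unset Printing Implicit Defensive.

Import GRing.Theory.
Local Open Scope ring_scope.

(** Koszul duality between Lie and commutative algebras makes each component of the Koszul dual
    cooperad a line, spanned by [corel], on which permutations act by their signature
    ([LieDual_line], [corel_LieDual]). A cochain of degree 1 - n is therefore an antisymmetric
    element of PreLie(n). In characteristic zero these are the elements with n leaves of the free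
    super pre-Lie algebra on one odd generator x, that is, functions [ptree -> K] modulo [rel]; the
    passage is [alt], controlled by [alt_rel], [alt_gen_ideal] and [antisym_alt]. The Maurer-Cartan
    element becomes x x, and the differential becomes [diff], which sends f to x f - (-1)^|f| f x -
    D f, where |f| counts leaves and D is the odd derivation with D x = x x ([represents_diff]).

    Exactness comes from a homotopy h, called [plug]: the odd derivation replacing x by a formal
    element e with e a = 0 and a e = |a| a up to sign. Since |a| is additive, e is compatible with
    right symmetry, so h preserves relations ([plug_rsymm], [rel_plug]). The anticommutator of h
    with the differential is minus the operator [lap] ([plug_diff]). In the rooted tree model of
    pre-Lie algebras, [lap] multiplies a tree by its number of tips, up to trees with fewer tips
    ([lap_dirac], [lap_fil]). The new tip created by a product a x is accounted for by D: up to
    sign, D a and a x agree modulo trees with no more tips than a ([twist_dsub_fil]). Every tree has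
    at least one tip, and positive integers are invertible in K, so descent on the number of tips
    turns every cycle into a boundary ([diff_exact]). *)

Notation ptree := (tree unit).
Notation lf := (Leaf tt).

Definition nleaves (A : Type) (t : tree A) : nat := size (leaves t).

Lemma nleaves_Node A (a b : tree A) : nleaves (Node a b) = (nleaves a + nleaves b)%N.
Proof. exact: size_cat. Qed.

Lemma nleaves_gt0 A (t : tree A) : (0 < nleaves t)%N.
Proof. by elim: t => // a IHa b IHb; rewrite nleaves_Node addn_gt0 IHa. Qed.

(** * The free magma on one odd generator *)

(* A function f : ptree -> K stands for the formal sum of the f t *: t, where *)
(* a tree is a nonassociative monomial in the generator x = lf, of parity the *)
(* number of its leaves.                                                      *)
Section FreeMagma.
Variable K : fieldType.
Implicit Types (f g u v w : ptree -> K) (s t a b : ptree).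

Definition dirac s t : K := (t == s)%:R.
Definition tmul f g t : K := if t is Node a b then f a * g b else 0.
(** The parity automorphism; an odd derivation D satisfies D (f g) = (D f) g + (twist f) (D g). *)
Definition twist f t : K := (-1) ^+ nleaves t * f t.
Definition weigh f t : K := (nleaves t)%:R * f t.
Definition is_leaf A (t : tree A) : bool := if t is Leaf _ then true else false.

(* The odd derivation with x |-> x * x. *)
Fixpoint dsub f t : K :=
  match t with
  | Leaf _ => 0
  | Node a b => (is_leaf a && is_leaf b)%:R * f lf
      + dsub (fun a' => f (Node a' b)) a
      + (-1) ^+ nleaves a * dsub (fun b' => f (Node a b')) b
  end.

(* The odd derivation with x |-> e, for a formal element e such that e * a = 0 *)
(* and a * e = nleaves a *: a up to sign.                                      *)
Fixpoint plug f t : K :=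
  (-1) ^+ nleaves t * (nleaves t)%:R * f (Node t lf) +
  match t with
  | Leaf _ => 0
  | Node a b => plug (fun a' => f (Node a' b)) a
      + (-1) ^+ nleaves a * plug (fun b' => f (Node a b')) b
  end.

Notation lin k f g := (fun t => k * f t + g t).

Definition linmap (L : (ptree -> K) -> ptree -> K) :=
  forall k f g, L (lin k f g) = lin k (L f) (L g).

Lemma linmap0 L : linmap L -> L (fun=> 0) = fun=> 0.
Proof.
move=> lL; have := lL (-1) (fun=> 0) (fun=> 0).
have -> : lin (-1) (fun=> 0) (fun=> 0) = (fun=> 0) :> (ptree -> K).
  by apply/funext => t; ring.
move=> ->; apply/funext => t; ring.
Qed.

Lemma dsub_lin : linmap dsub.
Proof.
move=> k f g; apply/funext => t; elim: t k f g => [u|a IHa b IHb] k f g /=.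
  by rewrite mulr0 addr0.
by rewrite IHa IHb; ring.
Qed.

Lemma plug_lin : linmap plug.
Proof.
move=> k f g; apply/funext => t; elim: t k f g => [u|a IHa b IHb] k f g /=.
  by ring.
by rewrite IHa IHb; ring.
Qed.

Lemma twist_lin : linmap twist.
Proof. by move=> k f g; apply/funext => t; rewrite /twist; ring. Qed.

Lemma weigh_lin : linmap weigh.
Proof. by move=> k f g; apply/funext => t; rewrite /weigh; ring. Qed.

Lemma tmul_linl v : linmap (tmul^~ v).
Proof. by move=> k f g; apply/funext => -[u|a b] /=; ring. Qed.

Lemma tmul_linr v : linmap (tmul v).
Proof. by move=> k f g; apply/funext => -[u|a b] /=; ring. Qed.

Lemma dirac_Node a b : dirac (Node a b) = tmul (dirac a) (dirac b).
Proof.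
apply/funext => -[u|a' b'] //=; rewrite /dirac -natrM mulnb; congr (nat_of_bool _)%:R.
by apply/eqP/andP => [[-> ->] //|[/eqP-> /eqP->]].
Qed.

Notation X := (dirac lf).

Lemma diracX t : X t = (is_leaf t)%:R.
Proof. by rewrite /dirac; case: t => [[]|a b]; rewrite ?eqxx. Qed.

Lemma dsubX : dsub X = tmul X X.
Proof.
apply/funext => -[u|a b] //=; rewrite !diracX /= mulr1 -mulnb natrM.
have d0 (F : ptree -> ptree) t : (forall t, is_leaf (F t) = false) ->
    dsub (fun t => X (F t)) t = 0.
  move=> F0; have -> : (fun t => X (F t)) = fun=> 0.
    by apply/funext => t'; rewrite diracX F0.
  by rewrite (linmap0 dsub_lin).
by rewrite !d0 //; ring.
Qed.

Lemma plugX : plug X = fun=> 0.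
Proof.
apply/funext => t; elim: t => [u|a IHa b IHb] /=; rewrite !diracX /= mulr0 add0r //.
have d0 (F : ptree -> ptree) t : (forall t, is_leaf (F t) = false) ->
    plug (fun t => X (F t)) t = 0.
  move=> F0; have -> : (fun t => X (F t)) = fun=> 0.
    by apply/funext => t'; rewrite diracX F0.
  by rewrite (linmap0 plug_lin).
by rewrite !d0 //; ring.
Qed.

Lemma linmap_scale L k f : linmap L -> L (fun t => k * f t) = fun t => k * L f t.
Proof.
move=> lL; have -> : (fun t => k * f t) = lin k f (fun=> 0).
  by apply/funext => t; ring.
by rewrite lL (linmap0 lL); apply/funext => t; ring.
Qed.

Lemma linmap_scaler L k f : linmap L -> L (fun t => f t * k) = fun t => L f t * k.
Proof.
move=> lL; have -> : (fun t => f t * k) = fun t => k * f t.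
  by apply/funext => t; ring.
by rewrite linmap_scale //; apply/funext => t; ring.
Qed.

Lemma linmap_add L f g : linmap L -> L (fun t => f t + g t) = fun t => L f t + L g t.
Proof.
move=> lL; have -> : (fun t => f t + g t) = lin 1 f g.
  by apply/funext => t; ring.
by rewrite lL; apply/funext => t; ring.
Qed.

Lemma dsub_mul f g t :
  dsub (tmul f g) t = tmul (dsub f) g t + tmul (twist f) (dsub g) t.
Proof.
case: t => [u|a b] /=; first by rewrite addr0.
rewrite mulr0 add0r (linmap_scaler _ _ dsub_lin) (linmap_scale _ _ dsub_lin).
by rewrite /twist; ring.
Qed.

(** The first term is the case where the right factor is the generator itself: plugging e there
    leaves a multiple of the left factor. *)
Lemma plug_mul f g t :
  plug (tmul f g) t
  = weigh (twist f) t * g lf + tmul (plug f) g t + tmul (twist f) (plug g) t.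
Proof.
case: t => [u|a b] /=; first by rewrite /weigh /twist; ring.
rewrite (linmap_scaler _ _ plug_lin) (linmap_scale _ _ plug_lin).
by rewrite /twist /weigh; ring.
Qed.

Lemma twist_mul f g : twist (tmul f g) = tmul (twist f) (twist g).
Proof.
apply/funext => -[u|a b] /=; rewrite /twist /= ?mulr0 // nleaves_Node exprD; ring.
Qed.

Lemma twistK f : twist (twist f) = f.
Proof. by apply/funext => t; rewrite /twist mulrA -expr2 sqrr_sign mul1r. Qed.

Lemma weigh_twist f : weigh (twist f) = twist (weigh f).
Proof. by apply/funext => t; rewrite /weigh /twist; ring. Qed.

Lemma twist_dsub f : twist (dsub f) = fun t => - dsub (twist f) t.
Proof.
apply/funext => t; elim: t f => [u|a IHa b IHb] f; first by rewrite /twist /=; ring.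
have Da : dsub (fun a' => (-1) ^+ nleaves a' * f (Node a' b)) a
    = - twist (dsub (fun a' => f (Node a' b))) a by rewrite IHa opprK.
have Db : dsub (fun b' => (-1) ^+ nleaves b' * f (Node a b')) b
    = - twist (dsub (fun b' => f (Node a b'))) b by rewrite IHb opprK.
rewrite {1}/twist nleaves_Node exprD /=.
have -> : dsub (fun a' => twist f (Node a' b)) a
  = (-1) ^+ nleaves b * dsub (fun a' => (-1) ^+ nleaves a' * f (Node a' b)) a.
  have -> : (fun a' => twist f (Node a' b))
     = (fun a' => (-1) ^+ nleaves b * ((-1) ^+ nleaves a' * f (Node a' b))).
    by apply/funext => a'; rewrite /twist nleaves_Node exprD; ring.
  by rewrite (linmap_scale _ _ dsub_lin).
have -> : dsub (fun b' => twist f (Node a b')) b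
  = (-1) ^+ nleaves a * dsub (fun b' => (-1) ^+ nleaves b' * f (Node a b')) b.
  have -> : (fun b' => twist f (Node a b'))
     = (fun b' => (-1) ^+ nleaves a * ((-1) ^+ nleaves b' * f (Node a b'))).
    by apply/funext => b'; rewrite /twist nleaves_Node exprD; ring.
  by rewrite (linmap_scale _ _ dsub_lin).
rewrite Da Db /twist.
case: (boolP (is_leaf a && is_leaf b)) => [|_].
  case: a b {IHa IHb Da Db} => [[]|a b] // [[]|] //= _; rewrite ?nleaves_Node /nleaves /=; ring.
by rewrite -(signr_odd _ (nleaves a)); case: odd; rewrite /= ?expr0 ?expr1; ring.
Qed.

Lemma twist_plug f : twist (plug f) = fun t => - plug (twist f) t.
Proof.
apply/funext => t; elim: t f => [u|a IHa b IHb] f.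
  by rewrite /twist /= nleaves_Node exprD; ring.
have Da : plug (fun a' => (-1) ^+ nleaves a' * f (Node a' b)) a
    = - twist (plug (fun a' => f (Node a' b))) a by rewrite IHa opprK.
have Db : plug (fun b' => (-1) ^+ nleaves b' * f (Node a b')) b
    = - twist (plug (fun b' => f (Node a b'))) b by rewrite IHb opprK.
rewrite {1}/twist nleaves_Node exprD /=.
have -> : plug (fun a' => twist f (Node a' b)) a
  = (-1) ^+ nleaves b * plug (fun a' => (-1) ^+ nleaves a' * f (Node a' b)) a.
  have -> : (fun a' => twist f (Node a' b))
     = (fun a' => (-1) ^+ nleaves b * ((-1) ^+ nleaves a' * f (Node a' b))).
    by apply/funext => a'; rewrite /twist nleaves_Node exprD; ring.
  by rewrite (linmap_scale _ _ plug_lin).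
have -> : plug (fun b' => twist f (Node a b')) b
  = (-1) ^+ nleaves a * plug (fun b' => (-1) ^+ nleaves b' * f (Node a b')) b.
  have -> : (fun b' => twist f (Node a b'))
     = (fun b' => (-1) ^+ nleaves a * ((-1) ^+ nleaves b' * f (Node a b'))).
    by apply/funext => b'; rewrite /twist nleaves_Node exprD; ring.
  by rewrite (linmap_scale _ _ plug_lin).
rewrite Da Db /twist !nleaves_Node !exprD.
rewrite -(signr_odd _ (nleaves a)) -(signr_odd _ (nleaves b)).
by case: (odd (nleaves a)); case: (odd (nleaves b)); rewrite /= ?expr0 ?expr1; ring.
Qed.

(** The differential of the deformation complex read on coefficient functions, by
    [represents_diff]. *)
Definition diff f t : K := tmul X f t - tmul (twist f) X t - dsub f t.
Definition plug_dsub f t : K := plug (dsub f) t + dsub (plug f) t.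
(** Minus the anticommutator of [plug] and [diff], by [plug_diff]. The first summand makes [lap] the
    identity on the generator, where the other two cancel. *)
Definition lap f t : K := f lf * X t + weigh f t + plug_dsub f t.

Lemma dsub_lf f : dsub f lf = 0. Proof. by []. Qed.

Lemma dsub_mulE f g :
  dsub (tmul f g) = fun t => tmul (dsub f) g t + tmul (twist f) (dsub g) t.
Proof. by apply/funext => t; rewrite dsub_mul. Qed.

Lemma plug_mulE f g :
  plug (tmul f g) = fun t => g lf * weigh (twist f) t
    + (tmul (plug f) g t + tmul (twist f) (plug g) t).
Proof. by apply/funext => t; rewrite plug_mul; ring. Qed.

(** Each term of D has one leaf more than its argument. *)
Lemma weigh_dsub f t : weigh (dsub f) t = dsub (weigh f) t + dsub f t.
Proof.
elim: t f => [u|a IHa b IHb] f; first by rewrite /weigh /=; ring.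
have Ea : dsub (fun a' => weigh f (Node a' b)) a =
   dsub (weigh (fun a' => f (Node a' b))) a + (nleaves b)%:R * dsub (fun a' => f (Node a' b)) a.
  have -> : (fun a' => weigh f (Node a' b)) = fun a' =>
      weigh (fun a' => f (Node a' b)) a' + (nleaves b)%:R * f (Node a' b).
    by apply/funext => a'; rewrite /weigh nleaves_Node natrD; ring.
  by rewrite (linmap_add _ _ dsub_lin) (linmap_scale _ _ dsub_lin).
have Eb : dsub (fun b' => weigh f (Node a b')) b =
   dsub (weigh (fun b' => f (Node a b'))) b + (nleaves a)%:R * dsub (fun b' => f (Node a b')) b.
  have -> : (fun b' => weigh f (Node a b')) = fun b' =>
      weigh (fun b' => f (Node a b')) b' + (nleaves a)%:R * f (Node a b').
    by apply/funext => b'; rewrite /weigh nleaves_Node natrD; ring.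
  by rewrite (linmap_add _ _ dsub_lin) (linmap_scale _ _ dsub_lin).
have IH' c F : weigh (dsub F) c = dsub (weigh F) c + dsub F c ->
    dsub (weigh F) c = (nleaves c)%:R * dsub F c - dsub F c.
  by rewrite {1}/weigh => ->; rewrite addrK.
rewrite /= Ea Eb (IH' _ _ (IHa _)) (IH' _ _ (IHb _)) /weigh /= nleaves_Node natrD.
case: (boolP (is_leaf a && is_leaf b)) => [|_]; last by rewrite !mul0r; ring.
by case: a b {IHa IHb Ea Eb} => [[]|a b] // [[]|] //= _; rewrite /nleaves /=; ring.
Qed.

(** The anticommutator of two odd derivations would be an even derivation. The defect comes from the
    leaf term of [plug_mul], and is what remains of it because [weigh] and [dsub] do not commute
    ([weigh_dsub]). *)
Lemma plug_dsub_mul f g t : plug_dsub (tmul f g) t =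
  tmul (plug_dsub f) g t + tmul f (plug_dsub g) t + g lf * twist (dsub f) t.
Proof.
rewrite /plug_dsub dsub_mulE plug_mulE (linmap_add _ _ plug_lin).
rewrite (linmap_add _ _ dsub_lin) (linmap_add _ _ dsub_lin).
rewrite (linmap_scale _ _ dsub_lin) !plug_mulE !dsub_mulE twistK.
rewrite !weigh_twist dsub_lf twist_dsub twist_plug.
have -> : dsub (twist (weigh f)) t = - twist (weigh (dsub f)) t + twist (dsub f) t.
  have -> : dsub (twist (weigh f)) t = - twist (dsub (weigh f)) t.
    by rewrite twist_dsub opprK.
  rewrite /twist weigh_dsub; ring.
have -> : dsub (twist f) = fun t => - twist (dsub f) t.
  by apply/funext => u; rewrite twist_dsub opprK.
have -> : plug (twist f) = fun t => - twist (plug f) t.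
  by apply/funext => u; rewrite twist_plug opprK.
by case: t => [u|a b] /=; rewrite /twist; ring.
Qed.
End FreeMagma.
Arguments dirac {K}.
Arguments plug {K} f t : simpl never.
Arguments dsub {K} f t : simpl never.

(** * Super pre-Lie relations *)

Section RightSymmetric.
Variable K : fieldType.
Implicit Types (f g u v w : ptree -> K) (s t a b c : ptree).
Notation lin k f g := (fun t => k * f t + g t).
Notation X := (dirac (K := K) lf).

Lemma diff_lin : linmap (@diff K).
Proof.
move=> k f g; apply/funext => t; rewrite /diff twist_lin dsub_lin.
by rewrite tmul_linr tmul_linl; ring.
Qed.

(** Apart from [plug_dsub], the contributions come from plugging e into the factor x: in x f it
    kills f, while in f x it returns f times its number of leaves. The generator as a component of f
    adds the leaf term of [lap]. *)
Lemma plug_diff f t : plug (diff f) t + diff (plug f) t = - lap f t.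
Proof.
have -> : diff f = lin (-1) (lin 1 (dsub f) (tmul (twist f) X)) (tmul X f).
  by apply/funext => u; rewrite /diff; ring.
rewrite !plug_lin !plug_mulE plugX.
have -> : plug (twist f) = fun t => - twist (plug f) t.
  by apply/funext => u; rewrite twist_plug opprK.
have -> : twist X = fun t => - X t.
  by apply/funext => -[[]|a b]; rewrite /twist !diracX /nleaves /=; ring.
rewrite twistK /lap /plug_dsub /diff /weigh.
move: (plug (dsub f) t) (dsub (plug f) t) => pd dp; rewrite !diracX.
by case: t => [[]|a b] /=; rewrite /twist ?diracX /nleaves /=; ring.
Qed.

Definition assoc f g w t : K := tmul (tmul f g) w t - tmul f (tmul g w) t.
Definition rsymm (e : bool) f g w t : K :=
  assoc f g w t - (-1) ^+ e * assoc f w g t.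

Definition lin_closed (C : (ptree -> K) -> Prop) :=
  C (fun=> 0) /\ (forall k f g, C f -> C g -> C (lin k f g)).

(** Finite combinations of trees satisfying [P], given inductively so that statements about linear
    operators reduce to single trees. *)
Inductive span (P : ptree -> Prop) : (ptree -> K) -> Prop :=
| span0 : span P (fun=> 0)
| span_add k s f : P s -> span P f -> span P (lin k (dirac s) f).

(** The free super pre-Lie algebra on one odd generator is the free magma algebra modulo this
    two-sided ideal. *)
Inductive rel : (ptree -> K) -> Prop :=
| rel0 : rel (fun=> 0)
| rel_lin k f g : rel f -> rel g -> rel (lin k f g)
| rel_gen a b c : rel (rsymm (odd (nleaves b) && odd (nleaves c))
                         (dirac a) (dirac b) (dirac c))
| rel_mull s f : rel f -> rel (tmul (dirac s) f)
| rel_mulr s f : rel f -> rel (tmul f (dirac s)).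

Lemma rel_closed : lin_closed rel.
Proof. by split; [exact: rel0 | exact: rel_lin]. Qed.

Lemma lin_closed_ext (C : (ptree -> K) -> Prop) f g : C f -> f =1 g -> C g.
Proof. by move=> Cf /funext <-. Qed.

Section Closed.
Variables (C : (ptree -> K) -> Prop) (C_lin : lin_closed C).

Lemma closed_add f g : C f -> C g -> C (fun t => f t + g t).
Proof.
case: C_lin => _ Cl Cf Cg; apply: lin_closed_ext (Cl 1 _ _ Cf Cg) _ => t.
by ring.
Qed.

Lemma closed_scale k f : C f -> C (fun t => k * f t).
Proof.
case: C_lin => C0 Cl Cf; apply: lin_closed_ext (Cl k _ _ Cf C0) _ => t.
by ring.
Qed.

Lemma closed_sub f g : C f -> C g -> C (fun t => f t - g t).
Proof.
case: C_lin => _ Cl Cf Cg; apply: lin_closed_ext (Cl (-1) _ _ Cg Cf) _ => t.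
by ring.
Qed.

Lemma span_lin_ind (P : ptree -> Prop) L f : linmap L ->
  (forall s, P s -> C (L (dirac s))) -> span P f -> C (L f).
Proof.
case: C_lin => C0 Cl lL PC; elim=> [|k s g Ps _ IH].
  by rewrite (linmap0 lL).
by rewrite lL; apply: Cl => //; apply: PC.
Qed.

Lemma span_lin_ind_id (P : ptree -> Prop) f :
  (forall s, P s -> C (dirac s)) -> span P f -> C f.
Proof. by move=> PC Sf; apply: (span_lin_ind (L := id) _ PC Sf). Qed.
End Closed.

Lemma span_closed P : lin_closed (span P).
Proof.
split=> [|k f g]; first exact: span0.
elim=> [|k' s f' Ps _ IH] Sg.
  by apply: lin_closed_ext Sg _ => t; ring.
by apply: lin_closed_ext (span_add (k * k') Ps (IH Sg)) _ => t; ring.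
Qed.

Lemma span_dirac (P : ptree -> Prop) s : P s -> span P (dirac s).
Proof.
move=> Ps; apply: lin_closed_ext (span_add 1 Ps (span0 P)) _ => t; ring.
Qed.

Lemma span_sub (P P' : ptree -> Prop) f : (forall s, P s -> P' s) -> span P f -> span P' f.
Proof.
by move=> PP' Sf; apply: (span_lin_ind_id (span_closed P') _ Sf) => s /PP'; apply: span_dirac.
Qed.

Lemma span_mul (P P' P'' : ptree -> Prop) f g :
  (forall a b, P a -> P' b -> P'' (Node a b)) ->
  span P f -> span P' g -> span P'' (tmul f g).
Proof.
move=> PP Sf Sg.
apply: (span_lin_ind (span_closed P'') (tmul_linl g) _ Sf) => a Pa.
apply: (span_lin_ind (span_closed P'') (tmul_linr (dirac a)) _ Sg) => b Pb.
by rewrite -dirac_Node; apply/span_dirac/PP.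
Qed.

Notation deg n := (span (fun t => nleaves t = n)).
Notation par p := (span (fun t => odd (nleaves t) = p)).
Notation fin := (span (fun=> True)).

Lemma span_fin P f : span P f -> fin f.
Proof. exact: span_sub. Qed.

Lemma twist_dirac s : twist (K := K) (dirac s) = fun t => (-1) ^+ nleaves s * dirac s t.
Proof.
apply/funext => t; rewrite /twist /dirac.
by case: eqP => [->|_] //; rewrite !mulr0.
Qed.

Lemma weigh_dirac s : weigh (K := K) (dirac s) = fun t => (nleaves s)%:R * dirac s t.
Proof.
apply/funext => t; rewrite /weigh /dirac.
by case: eqP => [->|_] //; rewrite !mulr0.
Qed.

Lemma twist_span P f : span P f -> span P (twist f).
Proof.
apply: (span_lin_ind (span_closed P) (@twist_lin K)) => s Ps.
by rewrite twist_dirac; apply/(closed_scale (span_closed P))/span_dirac.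
Qed.

Lemma weigh_span P f : span P f -> span P (weigh f).
Proof.
apply: (span_lin_ind (span_closed P) (@weigh_lin K)) => s Ps.
by rewrite weigh_dirac; apply/(closed_scale (span_closed P))/span_dirac.
Qed.

Lemma twist_par p f : par p f -> twist f = fun t => (-1) ^+ p * f t.
Proof.
elim=> [|k s g <- _ IH]; first by apply/funext => t; rewrite /twist !mulr0.
rewrite twist_lin IH twist_dirac -(signr_odd _ (nleaves s)).
by case: (odd _); apply/funext => t /=; ring.
Qed.

Lemma par_lf f : par false f -> f lf = 0.
Proof.
elim=> // k s g os _ ->; rewrite /dirac; case: eqP => [sl|_]; last by rewrite mulr0 addr0.
by move: os; rewrite -sl.
Qed.

Lemma dsub_dirac s : deg (nleaves s).+1 (dsub (K := K) (dirac s)).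
Proof.
elim: s => [[]|a IHa b IHb].
  by rewrite dsubX -dirac_Node; apply: span_dirac.
rewrite dirac_Node dsub_mulE; apply: (closed_add (span_closed _)).
  apply: span_mul IHa (span_dirac (P := fun t => t = b) (erefl _)).
  by move=> a' _ ea ->; rewrite !nleaves_Node ea addSn.
apply: span_mul (twist_span (span_dirac (P := fun t => t = a) (erefl _))) IHb.
by move=> _ b' -> eb; rewrite !nleaves_Node eb addnS.
Qed.

Lemma dsub_deg n f : deg n f -> deg n.+1 (dsub f).
Proof.
apply: (span_lin_ind (span_closed _) (@dsub_lin K)) => s <-; exact: dsub_dirac.
Qed.

Lemma dsub_par p f : par p f -> par (~~ p) (dsub f).
Proof.
apply: (span_lin_ind (span_closed _) (@dsub_lin K)) => s <-.
by apply: span_sub (dsub_dirac s) => t ->.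
Qed.

Lemma dsub_fin f : fin f -> fin (dsub f).
Proof.
apply: (span_lin_ind (span_closed _) (@dsub_lin K)) => s _.
exact: span_fin (dsub_dirac s).
Qed.

Lemma plug_dirac s n : nleaves s = n.+1 -> deg n (plug (K := K) (dirac s)).
Proof.
elim: s n => [[]|a IHa b IHb] n.
  by move=> _; rewrite plugX; apply: span0.
have [m ea] : exists m, nleaves a = m.+1.
  by exists (nleaves a).-1; rewrite prednK ?nleaves_gt0.
have [k eb] : exists m, nleaves b = m.+1.
  by exists (nleaves b).-1; rewrite prednK ?nleaves_gt0.
rewrite nleaves_Node ea eb dirac_Node plug_mulE => -[en].
apply: (closed_add (span_closed _)).
  rewrite /dirac; case: eqP => [lb|_]; last first.
    by apply: lin_closed_ext (span0 _) _ => t; rewrite mul0r.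
  apply: (closed_scale (span_closed _)); apply/weigh_span/twist_span/span_dirac.
  by move: eb en; rewrite -lb => -[<-]; rewrite addn1 ea.
apply: (closed_add (span_closed _)).
  apply: span_mul (IHa _ ea) (span_dirac (P := fun t => t = b) (erefl _)).
  by move=> a' _ ea' ->; rewrite !nleaves_Node ea' eb.
apply: span_mul (twist_span (span_dirac (P := fun t => t = a) (erefl _))) (IHb _ eb).
by move=> _ b' -> eb'; rewrite !nleaves_Node eb' ea addSnnS.
Qed.

Lemma plug_deg n f : deg n.+1 f -> deg n (plug f).
Proof.
apply: (span_lin_ind (span_closed _) (@plug_lin K)) => s; exact: plug_dirac.
Qed.

Lemma plug_par p f : par p f -> par (~~ p) (plug f).
Proof.
apply: (span_lin_ind (span_closed _) (@plug_lin K)) => s <-.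
case: (nleaves s) (nleaves_gt0 s) (@plug_dirac s) => // n _ /(_ _ (erefl _)).
by apply: span_sub => t -> /=; rewrite negbK.
Qed.

Lemma plug_fin f : fin f -> fin (plug f).
Proof.
apply: (span_lin_ind (span_closed _) (@plug_lin K)) => s _.
case: (nleaves s) (nleaves_gt0 s) (@plug_dirac s) => // n _ /(_ _ (erefl _)).
exact: span_fin.
Qed.

Lemma rsymm_lin1 e v w : linmap (fun u => rsymm e u v w).
Proof. by move=> k f g; apply/funext => -[u|[u|a b] c]; rewrite /rsymm /assoc /=; ring. Qed.

Lemma rsymm_lin2 e u w : linmap (fun v => rsymm e u v w).
Proof.
by move=> k f g; apply/funext => -[x|[x|a b] [y|c d]]; rewrite /rsymm /assoc /=; ring.
Qed.

Lemma rsymm_lin3 e u v : linmap (fun w => rsymm e u v w).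
Proof.
by move=> k f g; apply/funext => -[x|[x|a b] [y|c d]]; rewrite /rsymm /assoc /=; ring.
Qed.

Lemma rel_rsymm p q u v w :
  fin u -> par p v -> par q w -> rel (rsymm (p && q) u v w).
Proof.
move=> Su Sv Sw.
apply: (span_lin_ind rel_closed (rsymm_lin1 _ v w) _ Su) => a _.
apply: (span_lin_ind rel_closed (rsymm_lin2 _ (dirac a) w) _ Sv) => b <-.
apply: (span_lin_ind rel_closed (rsymm_lin3 _ (dirac a) (dirac b)) _ Sw) => c <-.
exact: rel_gen.
Qed.

Lemma rel_tmull u f : fin u -> rel f -> rel (tmul u f).
Proof.
move=> Su Rf; apply: (span_lin_ind rel_closed (tmul_linl f) _ Su) => s _.
exact: rel_mull.
Qed.

Lemma rel_tmulr u f : fin u -> rel f -> rel (tmul f u).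
Proof.
move=> Su Rf; apply: (span_lin_ind rel_closed (tmul_linr f) _ Su) => s _.
exact: rel_mulr.
Qed.

Lemma rsymmE e u v w : rsymm e u v w =
  lin (-1) (tmul u (tmul v w)) (lin (- (-1) ^+ e) (tmul (tmul u w) v)
    (lin ((-1) ^+ e) (tmul u (tmul w v)) (tmul (tmul u v) w))).
Proof. by apply/funext => t; rewrite /rsymm /assoc; ring. Qed.

Lemma twist_rsymm e u v w :
  twist (rsymm e u v w) = rsymm e (twist u) (twist v) (twist w).
Proof. by rewrite !rsymmE !twist_lin !twist_mul. Qed.

Lemma dsub_rsymm p q u v w : par p v -> par q w ->
  dsub (rsymm (p && q) u v w) = lin 1 (rsymm (p && q) (dsub u) v w)
    (lin 1 (rsymm (~~ p && q) (twist u) (dsub v) w)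
           (rsymm (p && ~~ q) (twist u) (twist v) (dsub w))).
Proof.
move=> /twist_par tv /twist_par tw; rewrite !rsymmE !dsub_lin !dsub_mulE.
rewrite !twist_mul tv tw.
by apply/funext => -[x|[x|a b] [y|c d]]; case: p tv => tv; case: q tw => tw /=; ring.
Qed.

(** The correction terms of [plug_mul] cancel. Signs aside, right symmetry of u, v, e reads (u v) e
    - u (v e) = (u e) v - u (e v), and the multiplicities |u| + |v| - |v| on the left and |u| on the
    right agree. This dictates the factor |a| in the rule for a e. *)
Lemma plug_rsymm p q u v w : par p v -> par q w ->
  plug (rsymm (p && q) u v w) = lin 1 (rsymm (p && q) (plug u) v w)
    (lin 1 (rsymm (~~ p && q) (twist u) (plug v) w)
           (rsymm (p && ~~ q) (twist u) (twist v) (plug w))).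
Proof.
(* An even homogeneous function has no component on the generator, so the leaf terms survive only in
   odd parity. *)
move=> Pv Pw; have v0 : v lf = p%:R * v lf.
  by case: p Pv => Pv; rewrite ?mul1r ?mul0r // (par_lf Pv).
have w0 : w lf = q%:R * w lf.
  by case: q Pw => Pw; rewrite ?mul1r ?mul0r // (par_lf Pw).
move: Pv Pw => /twist_par tv /twist_par tw; rewrite !rsymmE !plug_lin !plug_mulE.
rewrite !twist_mul tv tw; apply/funext => t.
have wN f g a b : weigh (tmul f g) (Node a b) = weigh f a * g b + f a * weigh g b.
  by rewrite /weigh nleaves_Node natrD /=; ring.
case: t => [x|a b].
  by rewrite /weigh /twist /=; ring.
have wS k g r : weigh (fun t => k * g t) r = k * weigh g r.
  by rewrite /weigh; ring.
rewrite /= !wN !wS.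
case: p tv v0 => tv v0; case: q tw w0 => tw w0; rewrite v0 w0 {v0 w0 tv tw};
  case: a => [?|a1 a2]; case: b => [?|b1 b2] /=; try ring.
Qed.
End RightSymmetric.
Arguments span {K} P _.
Arguments rel {K} _.
Notation deg n := (span (fun t => nleaves t = n)).
Notation par p := (span (fun t => odd (nleaves t) = p)).
Notation fin := (span (fun=> True)).

(** * The homotopy *)

Section Exactness.
Variable K : fieldType.
Implicit Types (f g u v w : ptree -> K) (s t a b c : ptree).
Notation lin k f g := (fun t => k * f t + g t).
Notation X := (dirac (K := K) lf).

Lemma fin_dirac s : fin (dirac (K := K) s).
Proof. exact: span_dirac. Qed.

Lemma par_dirac s : par (odd (nleaves s)) (dirac (K := K) s).
Proof. exact: span_dirac. Qed.

Lemma rel_fin f : rel f -> fin f.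
Proof.
have mulF u v : fin u -> fin v -> fin (tmul (K := K) u v) by apply: span_mul.
elim=> {f} [|k f g _ Ff _ Fg|a b c|s f _ Ff|s f _ Ff].
- exact: span0.
- by case: (span_closed K (fun=> True)) => _; apply.
- rewrite rsymmE; have [_ cl] := span_closed K (fun=> True).
  (apply: (cl); last (apply: (cl); last apply: (cl)));
    repeat first [exact: fin_dirac | apply: (mulF)].
- exact: (mulF _ _ (fin_dirac s) Ff).
- exact: (mulF _ _ Ff (fin_dirac s)).
Qed.

Lemma rel_twist f : rel f -> rel (twist f).
Proof.
elim=> {f} [|k f g _ Rf _ Rg|a b c|s f _ Rf|s f _ Rf].
- by rewrite (linmap0 (@twist_lin K)); apply: rel0.
- by rewrite twist_lin; apply: rel_lin.
- rewrite twist_rsymm; apply: rel_rsymm.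
  + exact/twist_span/fin_dirac.
  + exact/twist_span/par_dirac.
  + exact/twist_span/par_dirac.
- rewrite twist_mul; apply: rel_tmull Rf; exact/twist_span/fin_dirac.
- rewrite twist_mul; apply: rel_tmulr Rf; exact/twist_span/fin_dirac.
Qed.

Lemma rel_dsub f : rel f -> rel (dsub f).
Proof.
elim=> {f} [|k f g _ Rf _ Rg|a b c|s f Rf RDf|s f Rf RDf].
- by rewrite (linmap0 (@dsub_lin K)); apply: rel0.
- by rewrite dsub_lin; apply: rel_lin.
- rewrite (dsub_rsymm _ (par_dirac b) (par_dirac c)).
  apply: rel_lin; last apply: rel_lin; apply: rel_rsymm.
  + exact/dsub_fin/fin_dirac.
  + exact/par_dirac.
  + exact/par_dirac.
  + exact/twist_span/fin_dirac.
  + exact/dsub_par/par_dirac.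
  + exact/par_dirac.
  + exact/twist_span/fin_dirac.
  + exact/twist_span/par_dirac.
  + exact/dsub_par/par_dirac.
- rewrite dsub_mulE; apply: (closed_add (rel_closed K)).
    by apply: rel_tmull Rf; apply/dsub_fin/fin_dirac.
  by apply: rel_tmull RDf; apply/twist_span/fin_dirac.
- rewrite dsub_mulE; apply: (closed_add (rel_closed K)).
    by apply: rel_tmulr RDf; apply/fin_dirac.
  by apply: rel_tmulr (rel_twist Rf); apply/dsub_fin/fin_dirac.
Qed.

(** The relations are homogeneous in the number of leaves. *)
Lemma rel_weigh f : rel f -> rel (weigh f).
Proof.
have wM u v : weigh (tmul (K := K) u v) = fun t => tmul (weigh u) v t + tmul u (weigh v) t.
  apply/funext => -[x|a b]; rewrite /weigh ?nleaves_Node ?natrD /=; ring.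
elim=> {f} [|k f g _ Rf _ Rg|a b c|s f Rf RDf|s f Rf RDf].
- by rewrite (linmap0 (@weigh_lin K)); apply: rel0.
- by rewrite weigh_lin; apply: rel_lin.
- set e := _ && _; have -> : weigh (rsymm e (dirac (K := K) a) (dirac b) (dirac c)) = fun t =>
     (nleaves a + nleaves b + nleaves c)%:R * rsymm e (dirac a) (dirac b) (dirac c) t.
    rewrite rsymmE !weigh_lin !wM !weigh_dirac; apply/funext.
    by case=> [x|[x|t1 t2] [y|t3 t4]] /=; rewrite !natrD; ring.
  by apply: (closed_scale (rel_closed K)); apply: rel_gen.
- rewrite wM weigh_dirac; apply: (closed_add (rel_closed K)); last exact: rel_mull.
  by apply: rel_tmull Rf; apply: (closed_scale (span_closed _ _)); apply: fin_dirac.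
- rewrite wM weigh_dirac; apply: (closed_add (rel_closed K)); first exact: rel_mulr.
  by apply: rel_tmulr Rf; apply: (closed_scale (span_closed _ _)); apply: fin_dirac.
Qed.

Lemma rel_lf f : rel f -> f lf = 0.
Proof.
by elim=> [|k u v _ -> _ ->|a b c|s u _ _|s u _ _] //=; rewrite /rsymm /assoc /=; ring.
Qed.

(** For a product with a relation on the right, the leaf term vanishes by [rel_lf]; with the
    relation on the left, it is a multiple of [weigh (twist f)], handled by [rel_weigh]. *)
Lemma rel_plug f : rel f -> rel (plug f).
Proof.
elim=> {f} [|k f g _ Rf _ Rg|a b c|s f Rf RDf|s f Rf RDf].
- by rewrite (linmap0 (@plug_lin K)); apply: rel0.
- by rewrite plug_lin; apply: rel_lin.
- rewrite (plug_rsymm _ (par_dirac b) (par_dirac c)).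
  apply: rel_lin; last apply: rel_lin; apply: rel_rsymm.
  + exact/plug_fin/fin_dirac.
  + exact/par_dirac.
  + exact/par_dirac.
  + exact/twist_span/fin_dirac.
  + exact/plug_par/par_dirac.
  + exact/par_dirac.
  + exact/twist_span/fin_dirac.
  + exact/twist_span/par_dirac.
  + exact/plug_par/par_dirac.
- have f0 := rel_lf Rf.
  rewrite plug_mulE; apply: lin_closed_ext (closed_add (rel_closed K)
    (rel_tmull (plug_fin (fin_dirac s)) Rf)
    (rel_tmull (twist_span (fin_dirac s)) RDf)) _ => t.
  by rewrite f0 mul0r add0r.
- rewrite plug_mulE; apply: rel_lin; last apply: (closed_add (rel_closed K)).
  + exact/rel_weigh/rel_twist.
  + by apply: rel_tmulr RDf; apply/fin_dirac.
  + by apply: rel_tmulr (rel_twist Rf); apply/plug_fin/fin_dirac.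
Qed.

Lemma rel_diff f : rel f -> rel (diff f).
Proof.
move=> Rf; apply: (closed_sub (rel_closed K)); last exact: rel_dsub.
apply: (closed_sub (rel_closed K)); first exact: rel_mull.
exact/rel_mulr/rel_twist.
Qed.

Lemma dsub_dsub_mul f g t :
  dsub (dsub (tmul f g)) t = tmul (dsub (dsub f)) g t + tmul f (dsub (dsub g)) t.
Proof.
rewrite dsub_mulE (linmap_add _ _ (@dsub_lin K)) !dsub_mulE twistK twist_dsub.
by case: t => [x|a b] /=; ring.
Qed.

Lemma twistX : twist X = fun t => - X t.
Proof. by apply/funext => -[[]|a b]; rewrite /twist !diracX /nleaves /=; ring. Qed.

Hypothesis charK : [pchar K] =i pred0.

Lemma rel_half f : rel (fun t => 2%:R * f t) -> rel f.
Proof.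
move=> /(closed_scale (rel_closed K) 2%:R^-1) R; apply: lin_closed_ext R _ => t.
by rewrite mulrA mulVf ?mul1r // (iffLR (pcharf0P K) charK).
Qed.

(** For two odd equal arguments, right symmetry says that twice the associator vanishes. *)
Lemma rel_assocX p f : par p f -> rel (assoc f X X).
Proof.
move=> Pf; apply: rel_half; have R := rel_rsymm (span_fin Pf) (par_dirac lf) (par_dirac lf).
by apply: lin_closed_ext R _ => t; rewrite /rsymm /=; ring.
Qed.

(** The square of an odd derivation is a derivation, so only the generator matters, where it gives
    the associator of x, x, x. *)
Lemma dsub_dsub_rel f : fin f -> rel (dsub (dsub f)).
Proof.
apply: (span_lin_ind (rel_closed K) (L := fun f => dsub (dsub f))).
  by move=> k u v; rewrite !dsub_lin.
move=> s _; elim: s => [[]|a IHa b IHb].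
  rewrite dsubX dsub_mulE dsubX twistX; apply: lin_closed_ext (rel_assocX (par_dirac lf)) _.
  by case=> [x|a b]; rewrite /assoc /=; ring.
have -> : dsub (dsub (dirac (Node a b))) = fun t => tmul (dsub (dsub (dirac a))) (dirac b) t
     + tmul (dirac (K := K) a) (dsub (dsub (dirac b))) t.
  by apply/funext => t; rewrite dirac_Node dsub_dsub_mul.
by apply: (closed_add (rel_closed K)); [apply: rel_mulr|apply: rel_mull].
Qed.

(** Besides the square of D, the terms assemble into the right symmetry relation for x, f, x and the
    associator of f, x, x. *)
Lemma diff_diff p f : par p f -> rel (diff (diff f)).
Proof.
move=> Pf; have fX := rel_assocX Pf.
have Xf := rel_rsymm (fin_dirac lf) (twist_span Pf) (par_dirac lf).
apply: lin_closed_ext (closed_add (rel_closed K) (dsub_dsub_rel (span_fin Pf))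
  (closed_sub (rel_closed K) Xf fX)) _ => t.
have -> : diff f = lin (-1) (lin 1 (dsub f) (tmul (twist f) X)) (tmul X f).
  by apply/funext => u; rewrite /diff; ring.
rewrite /diff !twist_lin !dsub_lin !twist_mul !dsub_mulE dsubX twistK.
rewrite /rsymm /assoc twistX (twist_dsub f) (twist_par Pf).
by case: p Pf {Xf} => _; case: t => [x|[x|a b] [y|c d]] /=; ring.
Qed.

(* In PreLie, the product of x with t1, then t2, and so on up to tk is the     *)
(* rooted tree with branches t1, t2, ..., tk plus rooted trees with no more    *)
(* tips (childless vertices) than it; tips is the number of tips of this tree. *)
Fixpoint tips t : nat :=
  match t with
  | Leaf _ => 1
  | Node a b => if is_leaf a then tips b else (tips a + tips b)%N
  end.

Lemma tips_gt0 t : (0 < tips t)%N.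
Proof. by elim: t => //= a IHa b IHb; case: ifP => // _; rewrite addn_gt0 IHa. Qed.

(** The filtration by number of tips on the quotient by [rel], pulled back to the free magma
    algebra. *)
Definition fil (q : nat) f : Prop := exists g r,
  [/\ span (fun t => (tips t <= q)%N) g, rel r & f = fun t => g t + r t].

Lemma fil_closed q : lin_closed (fil q).
Proof.
split=> [|k _ _ [g [r [Sg Rr ->]]] [g' [r' [Sg' Rr' ->]]]].
  exists (fun=> 0), (fun=> 0); split; [exact: span0|exact: rel0|].
  by apply/funext => t; rewrite addr0.
exists (lin k g g'), (lin k r r'); split; last by apply/funext => t; ring.
  by case: (span_closed K (fun t => (tips t <= q)%N)) => _; apply.
exact: rel_lin.
Qed.

Lemma fil_rel q f : rel f -> fil q f.
Proof.
move=> Rf; exists (fun=> 0), f; split=> //; first exact: span0.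
by apply/funext => t; rewrite add0r.
Qed.

Lemma fil_span q f : span (fun t => (tips t <= q)%N) f -> fil q f.
Proof.
move=> Sf; exists f, (fun=> 0); split=> //; first exact: rel0.
by apply/funext => t; rewrite addr0.
Qed.

Lemma fil_dirac s q : (tips s <= q)%N -> fil q (dirac s).
Proof. by move=> le; apply/fil_span/span_dirac. Qed.

Lemma fil_mono q q' f : (q <= q')%N -> fil q f -> fil q' f.
Proof.
move=> le [g [r [Sg Rr ->]]]; exists g, r; split=> //.
by apply: span_sub Sg => s /leq_trans; apply.
Qed.

Lemma fil0 f : fil 0 f -> rel f.
Proof.
move=> [g [r [Sg Rr ->]]]; apply: (closed_add (rel_closed K)) => //.
apply: (span_lin_ind_id (rel_closed K) _ Sg) => s.
by rewrite leqNgt tips_gt0.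
Qed.

Lemma fil_fin q f : fil q f -> fin f.
Proof.
move=> [g [r [/span_fin Sg /rel_fin Rr ->]]].
exact: (closed_add (span_closed K _)).
Qed.

Lemma fil_mul p q f g : fil p f -> fil q g -> fil (p + q) (tmul f g).
Proof.
move=> Ff Fg; have [f' [r [Sf Rr ef]]] := Ff; have [g' [r' [Sg Rr' eg]]] := Fg.
have -> : tmul f g = lin 1 (tmul f' g') (lin 1 (tmul r g) (tmul f' r')).
  by rewrite ef eg; apply/funext => -[x|a b] /=; ring.
case: (fil_closed (p + q)) => _ cl; apply: (cl); last apply: (cl).
- apply: fil_span; apply: span_mul Sf Sg => a b ta tb /=; case: ifP => _.
    exact: leq_trans tb (leq_addl _ _).
  exact: leq_add.
- apply/fil_rel/(rel_tmulr _ Rr)/(fil_fin Fg).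
- apply/fil_rel/(rel_tmull _ Rr')/(span_fin Sf).
Qed.

Lemma fil_mulX q f : fil q f -> fil q (tmul X f).
Proof.
move=> [g [r [Sg Rr ->]]].
have -> : tmul X (fun t => g t + r t) = lin 1 (tmul X g) (tmul X r).
  by apply/funext => -[x|a b] /=; ring.
case: (fil_closed q) => _ cl; apply: (cl).
  by apply/fil_span; apply: (span_mul _ (span_dirac K (P := fun t => t = lf) (erefl _)) Sg) => a b ->.
exact/fil_rel/rel_mull.
Qed.

Lemma fil_twist q f : fil q f -> fil q (twist f).
Proof.
move=> [g [r [Sg Rr ->]]]; rewrite (linmap_add _ _ (@twist_lin K)).
exists (twist g), (twist r); split=> //; [exact: twist_span|exact: rel_twist].
Qed.

(* On rooted trees, right multiplication by x grafts a new tip at each vertex, *)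
(* while x |-> x * x splits each vertex in two; the only splittings increasing *)
(* the number of tips are these graftings.                                     *)
Lemma twist_dsub_fil s :
  fil (tips s) (fun t => twist (dsub (dirac s)) t - tmul (dirac s) X t).
Proof.
elim: s => [[]|a IHa b IHb].
  rewrite dsubX twist_mul twistX; apply: lin_closed_ext (fil_rel _ (rel0 K)) _ => -[x|a b] /=; ring.
set Ka := (fun t => twist (dsub (dirac a)) t - _) in IHa.
set Kb := (fun t => twist (dsub (dirac b)) t - _) in IHb.
(* Right symmetry trades (a b) x for a (b x), (a x) b and a (x b). The first two are supplied by the
   induction hypotheses, and the last has no more tips than a b. *)
have Rab := rel_gen K a b lf.
have -> : (fun t => twist (dsub (dirac (Node a b))) t - tmul (dirac (Node a b)) X t)
  = lin 1 (tmul Ka (twist (dirac b))) (lin 1 (tmul (dirac a) Kb)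
     (lin 1 (tmul (dirac a) (tmul X (twist (dirac b))))
        (fun t => (-1) * rsymm (odd (nleaves b) && odd (nleaves lf)) (dirac a) (dirac b) X t))).
  apply/funext => t; rewrite dirac_Node dsub_mulE (linmap_add _ _ (@twist_lin K)).
  rewrite !twist_mul twistK /rsymm /assoc /Ka /Kb (twist_par (par_dirac b)) andbT.
  by case: t => [x|[x|t1 t2] [y|t3 t4]] /=; case: (odd _) => /=; ring.
have Fb := fil_dirac (leqnn (tips b)); have Fa := fil_dirac (leqnn (tips a)).
(* Multiplication by [a] on the left adds [tips a], except that the generator adds nothing. *)
have xF u q : fil q u -> fil (tips (Node a b) - tips b + q) (tmul (dirac a) u).
  case: a {IHa Ka Rab Fa} => [[]|a1 a2] Fu /=; last by rewrite addnK; apply: fil_mul Fu; apply: fil_dirac.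
  by rewrite subnn add0n; apply: fil_mulX.
have tb : (tips (Node a b) - tips b + tips b = tips (Node a b))%N.
  by rewrite subnK //=; case: ifP => // _; apply: leq_addl.
case: (fil_closed (tips (Node a b))) => _ cl; apply: (cl); last apply: (cl); last apply: (cl).
- case: a @Ka IHa {xF tb cl Rab Fa} => [[]|a1 a2] Ka IHa /=; last first.
    by apply: fil_mul => //; apply: fil_twist.
  (* When [a] is the generator, [fil_mul] would allow one tip too many, so exact vanishing is used
     instead. *)
  have -> : Ka = fun=> 0.
    by rewrite /Ka dsubX twist_mul twistX; apply/funext => -[x|? ?] /=; ring.
  by apply: lin_closed_ext (fil_rel _ (rel0 K)) _ => -[x|? ?] /=; ring.
- by rewrite -tb; apply: xF.
- by rewrite -tb; apply/xF/fil_mulX/fil_twist.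
- exact/fil_rel/(closed_scale (rel_closed K)).
Qed.

Lemma lap_lin : linmap (@lap K).
Proof.
move=> k f g; apply/funext => t; rewrite /lap /plug_dsub weigh_lin dsub_lin !plug_lin.
by rewrite dsub_lin; ring.
Qed.

(** The part of [lap] that obeys a product rule: it vanishes on the generator, whereas [lap] does
    not. *)
Let lap' f t : K := weigh f t + plug_dsub f t.

Lemma lap'_mul f g t :
  lap' (tmul f g) t = tmul (lap' f) g t + tmul f (lap' g) t + g lf * twist (dsub f) t.
Proof.
rewrite /lap' plug_dsub_mul; case: t => [x|a b] /=.
  by rewrite /weigh /=; ring.
by rewrite /weigh /= nleaves_Node natrD; ring.
Qed.

(** The product rule adds up the tips of the two factors. A left factor x contributes nothing, as it
    should. For a right factor x, the defect of the product rule is [twist (dsub (dirac a))], which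
    by [twist_dsub_fil] contributes a x once more: the new tip. *)
Lemma lap'_dirac s : s <> lf ->
  fil (tips s).-1 (fun t => lap' (dirac s) t - (tips s)%:R * dirac s t).
Proof.
elim: s => [[]|a IHa b IHb] // _.
have lX : lap' X = fun=> 0.
  apply/funext => t; rewrite /lap' /plug_dsub plugX (linmap0 (@dsub_lin K)) dsubX.
  rewrite plug_mulE plugX twistX weigh_dirac.
  case: t => [[]|t1 t2] /=; rewrite /weigh !diracX /nleaves /=; ring.
have IH c : (c <> lf -> fil (tips c).-1 (fun t => lap' (dirac c) t - (tips c)%:R * dirac c t)) ->
    c <> lf -> exists2 r, fil (tips c).-1 r & lap' (dirac c) = fun t => (tips c)%:R * dirac c t + r t.
  by move=> Hc /Hc Fr; exists (fun t => lap' (dirac c) t - (tips c)%:R * dirac c t); first exact: Fr; apply/funext => t /=; ring.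
rewrite dirac_Node.
have -> : lap' (tmul (dirac a) (dirac b)) = fun t => tmul (lap' (dirac a)) (dirac b) t
    + tmul (dirac a) (lap' (dirac b)) t + dirac b lf * twist (dsub (dirac a)) t.
  by apply/funext => t; apply: lap'_mul.
have Fb := fil_dirac (leqnn (tips b)); have Fa := fil_dirac (leqnn (tips a)).
case: (a =P lf) => [->|na]; case: (b =P lf) => [->|nb].
- rewrite lX dsubX twist_mul twistX diracX; apply: lin_closed_ext (fil_rel _ (rel0 K)) _.
  by case=> [x|? ?] /=; ring.
- have [r Fr ->] := IH b IHb nb; rewrite lX /dirac; case: (lf =P b) => [/esym//|_].
  apply: lin_closed_ext (fil_mulX Fr) _ => -[x|? ?] /=; rewrite /dirac; ring.
- have [r Fr ->] := IH a IHa na; rewrite lX diracX.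
  have ta : tips (Node a lf) = (tips a).+1 by case: a na {IHa Fa Fr} => [[]//|a1 a2] _ /=; rewrite addn1.
  have := fil_mul Fr (fil_dirac (leqnn (tips lf))); rewrite addn1 prednK ?tips_gt0 // => F1.
  rewrite ta /=; apply: lin_closed_ext (closed_add (fil_closed _) F1 (twist_dsub_fil a)) _ => t.
  by rewrite -[(tips a).+1]addn1 natrD; case: t => [x|? ?] /=; ring.
have [r Fr ->] := IH a IHa na; have [r' Fr' ->] := IH b IHb nb.
have -> : tips (Node a b) = (tips a + tips b)%N by case: a na {IHa Fa Fr} => [[]//|a1 a2].
have -> : dirac b lf = 0 :> K by rewrite /dirac; case: (lf =P b) => [/esym|].
have F1 := fil_mul Fr Fb; have F2 := fil_mul Fa Fr'.
have ea : ((tips a).-1 + tips b = (tips a + tips b).-1)%N by have := tips_gt0 a; lia.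
have eb : (tips a + (tips b).-1 = (tips a + tips b).-1)%N by have := tips_gt0 b; lia.
rewrite ea in F1; rewrite eb in F2.
apply: lin_closed_ext (closed_add (fil_closed _) F1 F2) _ => t.
by rewrite natrD; case: t => [x|? ?] /=; ring.
Qed.

Lemma lap_dirac s : fil (tips s).-1 (fun t => lap (dirac s) t - (tips s)%:R * dirac s t).
Proof.
case: (s =P lf) => [->|ns].
  apply: lin_closed_ext (fil_rel _ (rel0 K)) _ => t; rewrite /lap /plug_dsub plugX.
  rewrite (linmap0 (@dsub_lin K)) dsubX plug_mulE plugX twistX weigh_dirac.
  case: t => [[]|t1 t2] /=; rewrite /weigh !diracX /nleaves /=; ring.
apply: lin_closed_ext (lap'_dirac ns) _ => t; have s0 : dirac s lf = 0 :> K by rewrite /dirac; case: (lf =P s) => [/esym|].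
by rewrite /lap /lap' s0; ring.
Qed.

Lemma rel_lap f : rel f -> rel (lap f).
Proof.
move=> Rf; apply: lin_closed_ext (closed_scale (rel_closed K) (-1)
  (closed_add (rel_closed K) (rel_plug (rel_diff Rf)) (rel_diff (rel_plug Rf)))) _ => t.
by rewrite plug_diff; ring.
Qed.

(** On the top graded piece [lap] is the scalar [q.+1], by [lap_dirac]; trees with fewer tips stay
    in [fil q]. *)
Lemma lap_fil q f : fil q.+1 f -> fil q (fun t => lap f t - q.+1%:R * f t).
Proof.
move=> [g [r [Sg Rr ->]]].
have L : linmap (fun f t => lap f t - q.+1%:R * f t :> K).
  by move=> k u v; apply/funext => t; rewrite lap_lin; ring.
rewrite (linmap_add g r L); apply: (closed_add (fil_closed q)); last first.
  apply/fil_rel/(closed_sub (rel_closed K)); first exact: rel_lap.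
  exact: (closed_scale (rel_closed K)).
apply: (span_lin_ind (fil_closed q) L _ Sg) => s le.
have -> : (fun t => lap (dirac s) t - q.+1%:R * dirac s t) =
    (fun t => (lap (dirac s) t - (tips s)%:R * dirac s t)
      + ((tips s)%:R - q.+1%:R) * dirac s t) :> (ptree -> K).
  by apply/funext => t; ring.
apply: (closed_add (fil_closed q)).
  by apply: fil_mono (lap_dirac s); rewrite -ltnS prednK ?tips_gt0.
case: (tips s =P q.+1) => [->|ne].
  by apply: lin_closed_ext (fil_rel _ (rel0 K)) _ => t; ring.
by apply/(closed_scale (fil_closed q))/fil_dirac; lia.
Qed.

Lemma diff_deg m u : deg m u -> deg m.+1 (diff (K := K) u).
Proof.
move=> Du; apply: (closed_sub (span_closed _ _)); last exact: dsub_deg.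
apply: (closed_sub (span_closed _ _)).
  apply: (span_mul _ (span_dirac K (P := fun t => t = lf) (erefl _)) Du).
  by move=> a b -> eb; rewrite nleaves_Node eb.
apply: (span_mul _ (twist_span Du) (span_dirac K (P := fun t => t = lf) (erefl _))).
by move=> a b ea ->; rewrite nleaves_Node ea addn1.
Qed.

(** Descent on the filtration: for a cycle f in [fil q.+1], subtracting [lap f] divided by q + 1
    lands in [fil q], and changes f by a boundary modulo relations. In [fil 0] only relations are
    left. *)
Lemma diff_exact n f : deg n.+1 f -> rel (diff f) ->
  exists2 g, deg n g & rel (fun t => f t - diff g t).
Proof.
move=> Df Rf; have [q Ff] : exists q, fil q f.
  have tips_le t : (tips t <= nleaves t)%N.
    elim: t => //= a IHa b IHb; rewrite nleaves_Node; case: ifP => _.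
      exact: leq_trans IHb (leq_addl _ _).
    exact: leq_add.
  by exists n.+1; apply: fil_span; apply: span_sub Df => s <-.
elim: q f Df Rf Ff => [|q IHq] f Df Rf Ff.
  exists (fun=> 0); first exact: span0.
  apply: lin_closed_ext (fil0 Ff) _ => t.
  by rewrite (linmap0 (@diff_lin K)) subr0.
pose k : K := q.+1%:R^-1.
have k1 : q.+1%:R * k = 1.
  by rewrite divff // (iffLR (pcharf0P K) charK).
pose f1 t := f t - k * lap f t.
have lapE : lap f = fun t => - (plug (diff f) t + diff (plug f) t).
  by apply/funext => t; rewrite plug_diff opprK.
have Pf : par (odd n.+1) f by apply: span_sub Df => t ->.
have Dp : deg n (plug f) by apply: plug_deg.
have Df1 : deg n.+1 f1.
  apply: (closed_sub (span_closed _ _)) => //; apply: (closed_scale (span_closed _ _)).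
  rewrite lapE.
  apply: lin_closed_ext (closed_scale (span_closed K _) (-1)
    (closed_add (span_closed K _) (plug_deg (diff_deg Df)) (diff_deg Dp))) _ => t; ring.
have Rf1 : rel (diff f1).
  have -> : diff f1 = fun t => diff f t + k * (diff (plug (diff f)) t + diff (diff (plug f)) t).
    have -> : f1 = lin k (lin 1 (plug (diff f)) (diff (plug f))) f.
      by apply/funext => t; rewrite /f1 lapE; ring.
    by rewrite !diff_lin; apply/funext => t; ring.
  apply: (closed_add (rel_closed K)) => //; apply: (closed_scale (rel_closed K)).
  apply: (closed_add (rel_closed K)); first exact/rel_diff/rel_plug.
  exact: diff_diff (plug_par Pf).
have Ff1 : fil q f1.
  apply: lin_closed_ext (closed_scale (fil_closed q) (- k) (lap_fil Ff)) _ => t.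
  by rewrite /f1 mulrBr mulrA mulNr mulrC mulNr [k * _]mulrC k1; ring.
have [g Dg Rg] := IHq _ Df1 Rf1 Ff1.
(* Here f is [f1] plus k times [lap f], and [lap f] is minus [diff (plug f)] up to the relation
   [plug (diff f)]. *)
exists (fun t => g t - k * plug f t).
  by apply: (closed_sub (span_closed _ _)) => //; apply: (closed_scale (span_closed _ _)).
have Rp := closed_scale (rel_closed K) (- k) (rel_plug Rf).
apply: lin_closed_ext (closed_add (rel_closed K) Rg Rp) _ => t.
have -> : (fun t => g t - k * plug f t) = lin (- k) (plug f) g.
  by apply/funext => u; ring.
by rewrite diff_lin /f1 lapE; ring.
Qed.
End Exactness.

(** * Signs of labelled trees *)

Section PairParity.
Local Open Scope bool_scope.
Variable A : eqType.
Implicit Types (p q : A -> A -> bool) (l : seq A).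

Fixpoint pairsum p l : bool :=
  if l is a :: l' then \big[addb/false]_(b <- l') p a b (+) pairsum p l' else false.

Definition cross p (l1 l2 : seq A) : bool :=
  \big[addb/false]_(a <- l1) \big[addb/false]_(b <- l2) p a b.

Lemma cross_catl p l1 l2 l : cross p (l1 ++ l2) l = cross p l1 l (+) cross p l2 l.
Proof. exact: big_cat. Qed.

Lemma cross_catr p l l1 l2 : cross p l (l1 ++ l2) = cross p l l1 (+) cross p l l2.
Proof. by rewrite /cross -big_split; apply: eq_bigr => a _; rewrite big_cat. Qed.

Lemma cross_perml p l1 l1' l2 : perm_eq l1 l1' -> cross p l1 l2 = cross p l1' l2.
Proof. exact: perm_big. Qed.

Lemma cross_permr p l1 l2 l2' : perm_eq l2 l2' -> cross p l1 l2 = cross p l1 l2'.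
Proof. by move=> P; apply: eq_bigr => a _; apply: perm_big. Qed.

Lemma cross_perm p l1 l1' l2 l2' :
  perm_eq l1 l1' -> perm_eq l2 l2' -> cross p l1 l2 = cross p l1' l2'.
Proof. by move=> P1 P2; rewrite (cross_perml _ _ P1) (cross_permr _ _ P2). Qed.

Lemma pairsum_cat p l1 l2 :
  pairsum p (l1 ++ l2) = pairsum p l1 (+) pairsum p l2 (+) cross p l1 l2.
Proof.
elim: l1 => [|a l1 IH] /=; first by rewrite /cross big_nil addbF.
rewrite IH /cross big_cat big_cons -!addbA; congr (_ (+) _).
by rewrite addbC -!addbA; congr (_ (+) (_ (+) _)); rewrite addbC.
Qed.

Lemma pairsum_addb p q l :
  pairsum (fun a b => p a b (+) q a b) l = pairsum p l (+) pairsum q l.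
Proof. by elim: l => //= a l ->; rewrite big_split /= addbACA. Qed.

Lemma pairsum_perm p l l' : (forall a b, p a b = p b a) ->
  perm_eq l l' -> pairsum p l = pairsum p l'.
Proof.
move=> sym; elim: l l' => [|a l IH] l' P.
  by move: P; rewrite perm_sym => /perm_nilP ->.
have al' : a \in l' by rewrite -(perm_mem P) mem_head.
case/splitPr: al' P => l1 l2 P.
have P' : perm_eq l (l1 ++ l2) by rewrite -(perm_cons a) (permPl P) perm_catC /= perm_cons perm_catC.
rewrite /= (IH _ P') (perm_big _ P') !pairsum_cat /= big_cat.
have -> : cross p l1 (a :: l2)
  = \big[addb/false]_(x <- l1) p a x (+) cross p l1 l2.
  by rewrite /cross -big_split; apply: eq_bigr => x _; rewrite big_cons sym.
move: (\big[_/_]_(x <- l1) _) (\big[_/_]_(x <- l2) _) => b1 b2.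
move: (cross _ _ _) (pairsum p l1) (pairsum p l2) => b3 b4 b5.
by case: b1; case: b2; case: b3; case: b4; case: b5.
Qed.

Definition inverted (r : A -> nat) a b : bool := (r b < r a)%N.
Definition inversions (r : A -> nat) l : bool := pairsum (inverted r) l.

(** Whether two rankings disagree on a pair is symmetric in the pair, so the number of disagreements
    does not depend on the order of the list. Hence relabelling changes all leaf signs alike. *)
Lemma inversions_change r r' l l' : injective r -> injective r' -> perm_eq l l' ->
  inversions r l (+) inversions r' l = inversions r l' (+) inversions r' l'.
Proof.
move=> ir ir' P; rewrite /inversions -!pairsum_addb; apply: pairsum_perm P => a b.
rewrite /inverted; case: (a =P b) => [->//|/eqP nab].
have rab : r a != r b by rewrite (inj_eq ir).
have rab' : r' a != r' b by rewrite (inj_eq ir').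
by case: (ltngtP (r a) (r b)) rab; case: (ltngtP (r' a) (r' b)) rab'.
Qed.

(** Of two distinct elements, exactly one order is an inversion, so the two parities add up to the
    number of pairs. *)
Lemma cross_invertedC r l1 l2 : injective r -> uniq (l1 ++ l2) ->
  cross (inverted r) l1 l2 (+) cross (inverted r) l2 l1 = odd (size l1) && odd (size l2).
Proof.
move=> ir; elim: l1 => [|a l1 IH] /=.
  by rewrite /cross big_nil big1 // => b _; rewrite big_nil.
move=> /andP[na /IH{}IH].
have -> : cross (inverted r) (a :: l1) l2
   = \big[addb/false]_(b <- l2) inverted r a b (+) cross (inverted r) l1 l2.
  by rewrite /cross big_cons.
have -> : cross (inverted r) l2 (a :: l1)
   = \big[addb/false]_(b <- l2) inverted r b a (+) cross (inverted r) l2 l1.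
  by rewrite /cross -big_split; apply: eq_bigr => b _; rewrite big_cons.
rewrite addbACA IH -big_split.
have -> : \big[addb/false]_(b <- l2) (inverted r a b (+) inverted r b a) = odd (size l2).
  elim: l2 na {IH} => [|b l2 IH2]; first by rewrite big_nil.
  rewrite mem_cat inE !negb_or => /and3P[n1 nb n2].
  rewrite big_cons IH2 ?mem_cat ?negb_or ?n1 //= /inverted.
  have : r a != r b by rewrite (inj_eq ir).
  by case: ltngtP.
by case: (odd (size l1)); case: (odd (size l2)).
Qed.
End PairParity.

Lemma pairsum_map (A B : eqType) (f : A -> B) p l :
  pairsum p (map f l) = pairsum (fun a b => p (f a) (f b)) l.
Proof. by elim: l => //= a l ->; rewrite big_map. Qed.

Lemma cross_map (A B : eqType) (f g : A -> B) p (l1 l2 : seq A) :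
  cross p (map f l1) (map g l2)
  = \big[addb/false]_(a <- l1) \big[addb/false]_(b <- l2) p (f a) (g b).
Proof. by rewrite /cross big_map; apply: eq_bigr => a _; rewrite big_map. Qed.

Lemma multilinearP (A : finType) (t : tree A) :
  reflect (perm_eq (leaves t) (enum A)) (multilinear t).
Proof.
apply: (iffP forallP) => [tP|P a].
  apply/allP => a _ /=; rewrite (eqP (tP a)) count_uniq_mem ?enum_uniq //.
  by rewrite mem_enum.
by rewrite (seq.permP P) count_uniq_mem ?enum_uniq // mem_enum.
Qed.

Lemma mtree_perm (A : finType) (t : mtree A) : perm_eq (leaves t) (enum A).
Proof. exact/multilinearP/mtreeP. Qed.

Lemma nleaves_weight A (t : tree A) : nleaves t = (weight t).+1.
Proof. by elim: t => //= a IHa b IHb; rewrite nleaves_Node IHa IHb addnS. Qed.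

Lemma weight_map A B (f : A -> B) (t : tree A) : weight (tmap f t) = weight t.
Proof. by elim: t => //= a -> b ->. Qed.

Lemma nleaves_map A B (f : A -> B) (t : tree A) : nleaves (tmap f t) = nleaves t.
Proof. by rewrite /nleaves leaves_map size_map. Qed.

Lemma mtree_weight (A : finType) (t : mtree A) : (weight t).+1 = #|A|.
Proof. by rewrite -nleaves_weight cardE -(perm_size (mtree_perm t)). Qed.

(* The coordinates of a generator of LieDual(A) along trees t with the same   *)
(* leaf word differ by this sign.                                             *)
Fixpoint shape_sign A (t : tree A) : bool :=
  match t with
  | Leaf _ => false
  | Node a b => shape_sign a (+) shape_sign b (+) (odd (weight b) && odd (nleaves a))
  end.

Lemma shape_sign_map A B (f : A -> B) (t : tree A) :
  shape_sign (tmap f t) = shape_sign t.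
Proof. by elim: t => //= a -> b ->; rewrite weight_map nleaves_map. Qed.

Definition rank (A : finType) (a : A) : nat := enum_rank a.

Lemma rank_inj A : injective (@rank A).
Proof. by move=> a b /val_inj/enum_rank_inj. Qed.

Definition leaf_sign (A : finType) (t : tree A) : bool := inversions (@rank A) (leaves t).

(** The signature of [f] with respect to the enumerations of [A] and [B]. *)
Definition relabel_sign (A B : finType) (f : bijection A B) : bool :=
  inversions (@rank B) (map f (enum A)) (+) inversions (@rank A) (enum A).

Lemma leaf_sign_map (A B : finType) (f : bijection A B) (t : tree A) :
  multilinear t -> leaf_sign (tmap f t) = relabel_sign f (+) leaf_sign t.
Proof.
move=> /multilinearP P; rewrite /leaf_sign leaves_map.
have ir : injective (@rank B \o f).
  by apply: inj_comp; [exact: rank_inj|exact: can_inj (bfunK f)].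
have := inversions_change ir (@rank_inj A) P.
rewrite /relabel_sign /inversions !pairsum_map /= => <-.
by rewrite -addbA addbb addbF.
Qed.

Definition before A (s : tree (option A)) : nat :=
  find (fun o => ~~ isSome o) (leaves s).

Lemma shape_sign_graft0 A B (s : tree (option A)) (u : tree B) :
  ~~ has (fun o => ~~ isSome o) (leaves s) ->
  [/\ shape_sign (tgraft s u) = shape_sign s, weight (tgraft s u) = weight s
    & nleaves (tgraft s u) = nleaves s].
Proof.
elim: s => [[a|]|s1 IH1 s2 IH2] //=; rewrite has_cat negb_or => /andP[/IH1[e1 w1 n1] /IH2[e2 w2 n2]].
by rewrite e1 e2 w1 w2 n1 !nleaves_Node n1 n2.
Qed.

(** Induction along the path from the root to the hole. The Koszul sign of [decomp] is accounted for
    except for a sign in [before s], which [leaf_sign_graft] produces as well. *)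
Lemma shape_sign_graft A B (s : tree (option A)) (u : tree B) :
  count (fun o => ~~ isSome o) (leaves s) = 1%N ->
  weight (tgraft s u) = (weight s + weight u)%N /\
  shape_sign (tgraft s u) (+) (odd (weight u) && odd (weight_after s))
    = shape_sign s (+) shape_sign u (+) (odd (weight u) && odd (before s)).
Proof.
elim: s => [[a|]|s1 IH1 s2 IH2] //=.
  by move=> _; rewrite shape_sign_map weight_map andbF addbF.
rewrite count_cat /before /= find_cat => c12; case: ifP => h1.
  have [c1 c2] : count (fun o => ~~ isSome o) (leaves s1) = 1%N
      /\ count (fun o => ~~ isSome o) (leaves s2) = 0%N.
    by move: h1 c12; rewrite has_count; lia.
  have h2 : ~~ has (fun o : option A => ~~ isSome o) (leaves s2) by rewrite has_count c2.
  have [w1 e1] := IH1 c1; have [e2 w2 n2] := shape_sign_graft0 u h2.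
  rewrite e2 w1 w2 !nleaves_weight w1; split; first by lia.
  have -> : shape_sign (tgraft s1 u) = shape_sign s1 (+) shape_sign u
      (+) (odd (weight u) && odd (before s1)) (+) (odd (weight u) && odd (weight_after s1)).
    by rewrite -e1 -addbA addbb addbF.
  rewrite !oddS !oddD /before.
  move: (shape_sign s1) (shape_sign s2) (shape_sign u) (odd (find _ _)) => [] [] [] [];
  by case: (odd (weight s1)); case: (odd (weight s2)); case: (odd (weight u));
    case: (odd (weight_after s1)).
have h1' : ~~ has (fun o : option A => ~~ isSome o) (leaves s1) by rewrite h1.
have c2 : count (fun o => ~~ isSome o) (leaves s2) = 1%N.
  by move: h1' c12; rewrite has_count; lia.
have [w2 e2] := IH2 c2; have [e1 w1 n1] := shape_sign_graft0 u h1'.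
rewrite e1 w2 w1 n1; split; first by lia.
have -> : shape_sign (tgraft s2 u) = shape_sign s2 (+) shape_sign u
    (+) (odd (weight u) && odd (before s2)) (+) (odd (weight u) && odd (weight_after s2)).
  by rewrite -e2 -addbA addbb addbF.
rewrite !nleaves_weight -[size (leaves s1)]/(nleaves s1) nleaves_weight !oddS !oddD /= /before.
move: (shape_sign s1) (shape_sign s2) (shape_sign u) (odd (find _ _)) => [] [] [] [];
by case: (odd (weight s1)); case: (odd (weight s2)); case: (odd (weight u));
  case: (odd (weight_after s2)).
Qed.

Lemma option_seq_split (A : eqType) (l : seq (option A)) :
  count_mem None l = 1%N -> exists m1 m2,
    l = map Some m1 ++ None :: map Some m2.
Proof.
have noN (l' : seq (option A)) : count_mem None l' = 0%N -> exists m, l' = map Some m.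
  elim: l' => [|[a|] l' IH] //=; first by exists [::].
  by move=> /IH[m ->]; exists (a :: m).
elim: l => [|[a|] l IH] //=.
  by move=> /IH[m1 [m2 ->]]; exists (a :: m1), m2.
by move=> [/noN[m ->]]; exists [::], m.
Qed.

Lemma mtree_split (A : finType) (s : mtree (option A)) : exists m1 m2,
  [/\ leaves s = map Some m1 ++ None :: map Some m2, perm_eq (m1 ++ m2) (enum A)
    & before s = size m1].
Proof.
have /forallP sP := mtreeP s; have [m1 [m2 e]] := option_seq_split (eqP (sP None)).
exists m1, m2; split=> //.
  apply/allP => a _ /=; have -> : count_mem a (enum A) = 1%N.
    by rewrite count_uniq_mem ?enum_uniq // mem_enum.
  rewrite -(eqP (sP (Some a))).
  by rewrite e !count_cat /= !count_map; apply/eqP; congr (_ + _)%N; apply: eq_count.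
by rewrite /before e find_cat has_map (eq_has (a2 := pred0)) // has_pred0 /= size_map addn0.
Qed.

(** The leaf word of the grafted tree is that of [s] with the hole replaced by the leaves of [u].
    Moving this block to the end, compared with moving the hole to the end, costs [weight u]
    transpositions for each leaf after the hole; all the rest depends on [A] and [B] only. *)
Lemma leaf_sign_graft (A B : finType) : exists e : bool,
  forall (s : mtree (option A)) (u : mtree B),
  leaf_sign (tgraft s u)
  = e (+) leaf_sign s (+) leaf_sign u (+) (odd (weight u) && odd (before s)).
Proof.
pose AB : finType := (A + B)%type.
pose p := inverted (@rank AB); pose q := inverted (@rank (option A)).
pose rA a := rank (inl a : AB); pose rB b := rank (inr b : AB).
pose rS a := rank (Some a : option A).
pose eA := enum A; pose eB := enum B.
have irA : injective rA by move=> a b /rank_inj[].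
have irB : injective rB by move=> a b /rank_inj[].
have irS : injective rS by move=> a b /rank_inj[].
(* The last two terms are the parity of |A| (|B| - 1): they convert the number of leaves after the
   hole into [before s]. *)
exists (inversions rA eA (+) inversions rS eA (+) (inversions rB eB (+) inversions (@rank B) eB)
  (+) cross p (map inl eA) (map inr eB) (+) cross q (map Some eA) [:: None]
  (+) (odd #|A| && odd #|B|) (+) odd #|A|).
move=> s u; have [m1 [m2 [es pm eb]]] := mtree_split s.
have pu := mtree_perm u.
have lg : leaves (tgraft s u) = map inl m1 ++ map inr (leaves u) ++ map inl m2.
  rewrite leaves_bind es map_cat flatten_cat /= leaves_map; congr (_ ++ (_ ++ _)).
    by elim: (m1) => //= a m ->.
  by elim: (m2) => //= a m ->.
have uq : uniq (map (inl : A -> AB) m2 ++ map (inr : B -> AB) (leaves u)).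
  rewrite cat_uniq !map_inj_uniq; try by move=> ? ? [].
  rewrite (perm_uniq pu) enum_uniq andbT.
  have : uniq (m1 ++ m2) by rewrite (perm_uniq pm) enum_uniq.
  rewrite cat_uniq => /and3P[_ _ ->] /=.
  by apply/hasPn => _ /mapP[b _ ->]; apply/mapP => -[].
have uq' : uniq (map Some m2 ++ [:: None]).
  rewrite cats1 rcons_uniq map_inj_uniq; last by move=> ? ? [].
  have : uniq (m1 ++ m2) by rewrite (perm_uniq pm) enum_uniq.
  by rewrite cat_uniq => /and3P[_ _ ->]; rewrite andbT; apply/mapP => -[].
have cu := cross_invertedC (@rank_inj AB) uq; have cn := cross_invertedC (@rank_inj _) uq'.
have -> : leaf_sign (tgraft s u) = inversions rA (m1 ++ m2) (+) inversions rB (leaves u)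
    (+) cross p (map inl eA) (map inr eB) (+) (odd (size m2) && odd #|B|).
  rewrite /leaf_sign lg /inversions !pairsum_cat !cross_catr !pairsum_map.
  rewrite -[inverted (@rank AB)]/p.
  have -> : cross p (map inl eA) (map inr eB)
     = cross p (map inl m1) (map inr (leaves u)) (+) cross p (map inl m2) (map inr (leaves u)).
    rewrite -cross_catl -map_cat; apply: cross_perm; rewrite perm_sym; exact: perm_map.
  rewrite !size_map (perm_size pu) -cardE in cu.
  rewrite -cu -/p (cross_map inl inl p m1 m2) -[\big[_/_]_(a <- m1) _]/(cross (inverted rA) m1 m2).
  rewrite -![pairsum (fun a b : A => _) _]/(pairsum (inverted rA) _).
  rewrite -[pairsum (fun a b : B => _) _]/(pairsum (inverted rB) _).
  move: (cross (inverted rA) _ _) => b4; do 3![move: (cross p _ _)].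
  move: (pairsum _ m1) (pairsum _ m2) (pairsum _ (leaves u)).
  by case: b4; do 6!case.
have -> : leaf_sign s = inversions rS (m1 ++ m2) (+) cross q (map Some eA) [:: None]
    (+) odd (size m2).
  rewrite /leaf_sign es /inversions -cat1s !pairsum_cat !cross_catr !pairsum_map -/q.
  have -> : cross q (map Some eA) [:: None]
     = cross q (map Some m1) [:: None] (+) cross q (map Some m2) [:: None].
    by rewrite -cross_catl -map_cat; apply: cross_perml; rewrite perm_sym; apply: perm_map.
  rewrite size_map andbT in cn; rewrite -cn -/q (cross_map Some Some q m1 m2).
  rewrite -[\big[_/_]_(a <- m1) _]/(cross (inverted rS) m1 m2).
  rewrite -![pairsum (fun a b : A => _) _]/(pairsum (inverted rS) _).
  have -> : pairsum q [:: None] = false by rewrite /= big_nil.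
  move: (cross (inverted rS) _ _) => b4; do 3![move: (cross q _ _)].
  move: (pairsum _ m1) (pairsum _ m2).
  by case: b4; do 5!case.
have -> : inversions rA (m1 ++ m2)
    = inversions rS (m1 ++ m2) (+) (inversions rA eA (+) inversions rS eA).
  by rewrite -(inversions_change irA irS pm) addbCA addbb addbF.
have -> : inversions rB (leaves u)
    = leaf_sign u (+) (inversions rB eB (+) inversions (@rank B) eB).
  by rewrite -(inversions_change irB (@rank_inj B) pu) addbCA addbb addbF.
have oA : odd #|A| = odd (size m1) (+) odd (size m2).
  by rewrite -oddD -size_cat (perm_size pm) cardE.
rewrite eb oA -(mtree_weight u) oddS.
move: (inversions rS (m1 ++ m2)) (inversions rS eA) (inversions rA eA) => b1 b2 b3.
move: (leaf_sign u) (inversions _ eB) (inversions rB eB) (cross q _ _) => b4 b5 b6 b7.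
move: (cross p _ _) (odd (size m1)) (odd (size m2)) (odd (weight u)) => b8 b9 c1 c2.
case: b1; case: b2; case: b3 => //=; case: b4; case: b5; case: b6 => //=;
by case: b7; case: b8; case: b9; case: c1; case: c2.
Qed.

Lemma mtree_count_hole (A : finType) (s : mtree (option A)) :
  count (fun o => ~~ isSome o) (leaves s) = 1%N.
Proof.
have /forallP/(_ None)/eqP <- := mtreeP s.
by apply: eq_count => -[].
Qed.

(** The sign of the coordinate along [t] of the generator [corel] of the Koszul dual cooperad. *)
Definition corel_sign (A : finType) (t : tree A) : bool := shape_sign t (+) leaf_sign t.

Lemma corel_sign_map (A B : finType) (f : bijection A B) (t : mtree A) :
  corel_sign (mrelabel f t) = relabel_sign f (+) corel_sign t.
Proof. by rewrite /corel_sign /= shape_sign_map leaf_sign_map ?mtreeP // addbCA. Qed.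

(** The two [before] signs cancel. Hence the decomposition of [corel] is, up to one global sign, the
    tensor product of two generators. *)
Lemma corel_sign_graft (A B : finType) : exists e : bool,
  forall (s : mtree (option A)) (u : mtree B),
  corel_sign (mgraft s u) (+) (odd (weight u) && odd (weight_after s))
  = e (+) corel_sign s (+) corel_sign u.
Proof.
have [e He] := leaf_sign_graft A B; exists e => s u.
have [_] := shape_sign_graft u (mtree_count_hole s).
rewrite /corel_sign /= He.
move: (shape_sign (tgraft s u)) (shape_sign s) (shape_sign u) => b1 b2 b3.
move: (leaf_sign s) (leaf_sign u) (_ && _) (_ && _) => b4 b5 b6 b7.
by case: e {He}; case: b1; case: b2; case: b3; case: b6; case: b7 => // _;
  case: b4; case: b5.
Qed.

(** * The Koszul dual cooperad of Lie is one-dimensional *)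

(* The maps t |-> C[t[sigma]] of labelled trees, built from partial           *)
(* compositions: both operadic ideals and subcooperads are stable under them. *)
Inductive substitution : forall B A : finType, (mtree B -> mtree A) -> Prop :=
| subst_relabel (B A : finType) (f : bijection B A) : substitution (mrelabel f)
| subst_graftl (A B : finType) (u : mtree B) :
    substitution (fun s : mtree (option A) => mgraft s u)
| subst_graftr (A B : finType) (s : mtree (option A)) :
    substitution (fun u : mtree B => mgraft s u)
| subst_comp (C B A : finType) (P : mtree B -> mtree A) (Q : mtree C -> mtree B) :
    substitution P -> substitution Q -> substitution (P \o Q).

Lemma bij_option (B : finType) (b : B) :
  exists e : bijection B (option {x | x != b}), e b = None /\
    forall x : {x | x != b}, e (val x) = Some x.
Proof.
pose f (y : B) : option {x | x != b} := insub y.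
pose g (o : option {x | x != b}) : B := if o is Some x then val x else b.
have fK : cancel f g.
  by move=> y; rewrite /f /g; case: insubP => [x _ <-|/negPn/eqP ->].
have gK : cancel g f.
  case=> [x|]; rewrite /f /g ?valK //; case: insubP => // x xb eb.
  by move: xb; rewrite eqxx.
exists (Bijection fK gK); split; first exact: (gK None).
by move=> x; apply: (gK (Some x)).
Qed.

Lemma multilinear_map_bij (B A : finType) (f : B -> A) (t : mtree B) :
  multilinear (tmap f t) -> exists e : bijection B A, e =1 f.
Proof.
move=> /multilinearP; rewrite leaves_map => P.
have uf : uniq (map f (leaves t)) by rewrite (perm_uniq P) enum_uniq.
have bt b : b \in leaves t by rewrite (perm_mem (mtree_perm t)) mem_enum.
have at' a : a \in map f (leaves t) by rewrite (perm_mem P) mem_enum.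
pose g a := projT1 (cid2 (mapP (at' a))).
have gK : cancel g f by move=> a; rewrite /g; case: cid2 => b /= _.
have fI : injective f.
  move=> b b' eb; rewrite -(nth_index b (bt b)) -(nth_index b (bt b')); congr nth; apply/eqP.
  by rewrite -(nth_uniq (f b) _ _ uf) ?size_map ?index_mem // !(nth_map b) ?index_mem // !nth_index ?eb.
have fK : cancel f g by move=> b; apply: fI; rewrite gK.
by exists (Bijection fK gK).
Qed.

Lemma weight_bind A B (sigma : A -> tree B) (t : tree A) :
  (weight t <= weight (tbind t sigma))%N.
Proof. by elim: t => //= a IHa b IHb; rewrite ltnS leq_add. Qed.

(** Induction on the number of vertices added by [sigma]. If [sigma b] is not a leaf, grafting a
    cherry at [b] creates its root and leaves one vertex fewer to add. Otherwise [sigma] is a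
    relabelling, bijective because its result on [t0] is multilinear. *)
Lemma subst_bind (B A : finType) (sigma : B -> tree A) (t0 : mtree B) :
  multilinear (tbind t0 sigma) -> exists2 P : mtree B -> mtree A,
    substitution P & forall t, mtree_val (P t) = tbind t sigma.
Proof.
have [n] := ubnP (weight (tbind t0 sigma) - weight t0).
elim: n B sigma t0 => // n IHn B sigma t0 lt_n ml.
have [/existsP[b nb]|] := boolP [exists b, ~~ is_leaf (sigma b)]; last first.
  rewrite negb_exists => /forallP al.
  have {}al b : exists a, sigma b = Leaf a.
    by have := al b; rewrite negbK; case: (sigma b) => // a _; exists a.
  pose f b := projT1 (cid (al b)).
  have sf b : sigma b = Leaf (f b) by rewrite /f; case: cid.
  have {}ml : multilinear (tmap f t0) by rewrite /tmap -(eq_tbind _ sf).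
  have [e ef] := multilinear_map_bij ml; exists (mrelabel e); first exact: subst_relabel.
  by move=> t /=; apply: eq_tbind => b /=; rewrite ef sf.
have [e [eb ee]] := bij_option b.
case sb: (sigma b) nb => [//|t1 t2] _.
pose C : finType := ({x | x != b} + 'I_2)%type.
pose cherry := MTree multilinear12.
pose sigma' (c : C) := match c with
  | inl x => sigma (val x) | inr i => if i == i2_1 then t1 else t2 end.
have bindE t : tbind (tgraft (tmap e t) cherry) sigma' = tbind t sigma.
  rewrite /tgraft tbind_map tbindA; apply: eq_tbind => y /=.
  have [->|ny] := eqVneq y b; first by rewrite eb /= sb.
  by rewrite -[y]/(val (exist (fun x => x != b) y ny)) ee.
pose t0' : mtree C := mgraft (mrelabel e t0) cherry.
have w0 : weight t0' = (weight t0).+1.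
  rewrite /= (shape_sign_graft _ (mtree_count_hole (mrelabel e t0))).1 /=.
  by rewrite weight_map addn1.
have eb0 : tbind t0' sigma' = tbind t0 sigma by rewrite -bindE.
have le0 := weight_bind sigma' t0'; rewrite w0 eb0 in le0.
have [||P sP PE] := IHn C sigma' t0'; rewrite ?eb0 ?w0 //.
  by move: lt_n le0; lia.
exists (P \o ((fun s => mgraft s cherry) \o mrelabel e)).
  by apply: subst_comp sP _; apply: subst_comp (subst_graftl _ _) (subst_relabel _).
by move=> t /=; rewrite PE /= bindE.
Qed.

(** A context is listed from the hole outwards; the boolean says that the hole lies in the left
    subtree. *)
Fixpoint plug_ctx A (C : seq (bool * tree A)) (t : tree A) : tree A :=
  if C is (isl, u) :: C' then plug_ctx C' (if isl then Node t u else Node u t) else t.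

Lemma multilinear_hole_left :
  multilinear (Node (Leaf None) (Leaf (Some tt))).
Proof. by apply/forallP => -[[]|]. Qed.

Lemma multilinear_hole_right :
  multilinear (Node (Leaf (Some tt)) (Leaf None)).
Proof. by apply/forallP => -[[]|]. Qed.

Lemma subst_ctx (B A : finType) (C : seq (bool * tree A)) (sigma : B -> tree A)
    (t0 : mtree B) : multilinear (plug_ctx C (tbind t0 sigma)) ->
  exists2 P : mtree B -> mtree A,
    substitution P & forall t, mtree_val (P t) = plug_ctx C (tbind t sigma).
Proof.
elim: C B sigma t0 => [|[isl v] C IH] B sigma t0 /=; first exact: subst_bind.
pose s0 : mtree (option unit) :=
  if isl then MTree multilinear_hole_left else MTree multilinear_hole_right.
pose D : finType := (unit + B)%type.
pose sigma' (d : D) := match d with inl _ => v | inr b => sigma b end.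
have bindE t : tbind (tgraft s0 t) sigma' = if isl then Node (tbind t sigma) v
                                        else Node v (tbind t sigma).
  by rewrite /s0; case: (isl) => /=; rewrite tbind_map.
rewrite -bindE -[tgraft s0 t0]/(mtree_val (mgraft s0 t0)) => /IH[P sP PE].
exists (P \o (fun u => mgraft s0 u)); first exact: (subst_comp sP (subst_graftr B s0)).
by move=> t; rewrite /= PE /= bindE.
Qed.

Section Substitution.
Variable K : fieldType.

Definition push (B A : finType) (P : mtree B -> mtree A) (v : tspan K B) : tspan K A :=
  \sum_(t : mtree B) v t *: mono K (P t).

Lemma push_linear (B A : finType) (P : mtree B -> mtree A) : linear (push P).
Proof.
move=> k x y; rewrite /push scaler_sumr -big_split; apply: eq_bigr => t _ /=.
by rewrite !ffunE scalerDl scalerA.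
Qed.

Lemma push_mono (B A : finType) (P : mtree B -> mtree A) (t : mtree B) :
  push P (mono K t) = mono K (P t).
Proof.
rewrite /push (bigD1 t) //= monoE eqxx scale1r big1 ?addr0 // => u ut.
by rewrite monoE (negbTE ut) scale0r.
Qed.

Lemma push_ideal (I : forall A : finType, {vspace tspan K A}) (B A : finType)
    (P : mtree B -> mtree A) : is_ideal (P := Mag K) I -> substitution P ->
  forall v, v \in I B -> push P v \in I A.
Proof.
move=> [actI compl compr]; elim=> {B A P} [B A f|A B u|A B s|C B A P Q _ IHP _ IHQ] v vI.
- suff -> : push (mrelabel f) v = mag_act f v by apply: actI.
  move: v {vI}; apply: tspan_ext; [exact: push_linear|exact: mag_act_linear|move=> t].
  by rewrite push_mono mag_act_mono.
- suff -> : push (fun s => mgraft s u) v = mag_comp v (mono K u) by apply: compl.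
  move: v {vI}; apply: tspan_ext; [exact: push_linear|exact: mag_comp_linearl|move=> t].
  by rewrite push_mono mag_comp_mono.
- suff -> : push (fun u => mgraft s u) v = mag_comp (mono K s) v by apply: compr.
  move: v {vI}; apply: tspan_ext; [exact: push_linear|exact: mag_comp_linearr|move=> t].
  by rewrite push_mono mag_comp_mono.
suff -> : push (P \o Q) v = push P (push Q v) by apply/IHP/IHQ.
move: v {vI}; apply: tspan_ext; first exact: push_linear.
  by move=> k x y; rewrite !push_linear.
by move=> t; rewrite !push_mono.
Qed.

Definition corel (A : finType) : tspan K A := [ffun t : mtree A => (-1) ^+ corel_sign t].

(** The restriction of coordinates along [P], with the sign for which [corel] restricts to
    [corel]. *)
Definition pull (B A : finType) (P : mtree B -> mtree A) (c : tspan K A) : tspan K B :=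
  [ffun t => (-1) ^+ (corel_sign (P t) (+) corel_sign t) * c (P t)].

(** Evaluating one tensor factor of the decomposition of [c] at a fixed tree leaves a combination of
    the other factors, which lie in [LieDual]; [corel_sign_graft] matches the signs. *)
Lemma pull_LieDual (B A : finType) (P : mtree B -> mtree A) : substitution P ->
  forall c, c \in LieDual K A -> pull P c \in LieDual K B.
Proof.
have [_ actD decD] := LieDual_subcooperad K.
elim=> {B A P} [B A f|A B u|A B s|C B A P Q _ IHP _ IHQ] c cD.
- suff -> : pull (mrelabel f) c = (-1) ^+ relabel_sign f *: mag_act (bsym f) c.
    by rewrite memvZ ?actD.
  apply/ffunP => t; rewrite !ffunE corel_sign_map -addbA addbb addbF; congr (_ * c _).
  exact: val_inj.
- have [e He] := corel_sign_graft A B.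
  have [l [lP lE]] := decD _ _ _ cD.
  suff -> : pull (fun s => mgraft s u) c
      = (-1) ^+ (e (+) corel_sign u) *: \sum_(p <- l) p.2 u *: p.1.
    rewrite memvZ // big_seq rpred_sum // => p /lP[p1 _]; by rewrite memvZ.
  apply/ffunP => t; rewrite !ffunE sum_ffunE.
  under eq_bigr do rewrite ffunE [_ *: _]mulrC.
  rewrite -lE /decomp [_ *: _]mulrA -(signr_odd _ (_ * _)) oddM -signr_addb; congr ((-1) ^+ _ * _).
  have := He t u; rewrite -[mtree_val (mgraft _ _)]/(mtree_val (mgraft t u)).
  move: (corel_sign (mgraft t u)) (_ && _) => b1 b2 e1.
  have -> : b1 = e (+) corel_sign t (+) corel_sign u (+) b2 by rewrite -e1 -addbA addbb addbF.
  by case: b2 {e1}; case: e {He}; case: (corel_sign t); case: (corel_sign u).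
- have [e He] := corel_sign_graft A B.
  have [l [lP lE]] := decD _ _ _ cD.
  suff -> : pull (fun u => mgraft s u) c
      = (-1) ^+ (e (+) corel_sign s) *: \sum_(p <- l) p.1 s *: p.2.
    rewrite memvZ // big_seq rpred_sum // => p /lP[_ p2]; by rewrite memvZ.
  apply/ffunP => t; rewrite !ffunE sum_ffunE.
  under eq_bigr do rewrite ffunE [_ *: _]/(_ * _).
  rewrite -lE /decomp [_ *: _]mulrA -(signr_odd _ (_ * _)) oddM -signr_addb; congr ((-1) ^+ _ * _).
  have := He s t; rewrite -[mtree_val (mgraft _ _)]/(mtree_val (mgraft s t)).
  move: (corel_sign (mgraft s t)) (_ && _) => b1 b2 e1.
  have -> : b1 = e (+) corel_sign s (+) corel_sign t (+) b2 by rewrite -e1 -addbA addbb addbF.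
  by case: b2 {e1}; case: e {He}; case: (corel_sign s); case: (corel_sign t).
suff -> : pull (P \o Q) c = pull Q (pull P c) by apply/IHQ/IHP.
apply/ffunP => t; rewrite !ffunE mulrA -signr_addb /=.
by rewrite addbACA [corel_sign _ (+) corel_sign (Q t)]addbC addbACA addbb addFb addbC.
Qed.
End Substitution.

Lemma rank_ord n (i : 'I_n) : rank i = i.
Proof. by rewrite /rank enum_rank_ord. Qed.

Lemma leaf_sign_ord n (t : tree 'I_n) : leaf_sign t = inversions (@nat_of_ord n) (leaves t).
Proof.
rewrite /leaf_sign /inversions; elim: (leaves t) => //= i l ->; congr (_ (+) _).
by apply: eq_bigr => j _; rewrite /inverted !rank_ord.
Qed.

Lemma tree_weight0 A (t : tree A) : weight t = 0%N -> exists a, t = Leaf a.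
Proof. by case: t => // a _; exists a. Qed.

Lemma tree_weight1 A (t : tree A) : weight t = 1%N -> exists a b, t = Node (Leaf a) (Leaf b).
Proof. by case: t => // -[a|? ?] [b|? ?] //= _; exists a, b. Qed.

Lemma tree_weight2 A (t : tree A) : weight t = 2%N -> exists i j k,
  t = Node (Node (Leaf i) (Leaf j)) (Leaf k) \/ t = Node (Leaf i) (Node (Leaf j) (Leaf k)).
Proof.
case: t => //= a b [w]; have [wa|wa] : weight a = 1%N /\ weight b = 0%N
    \/ weight a = 0%N /\ weight b = 1%N by lia.
  have [/tree_weight1[i [j ->]] /tree_weight0[k ->]] := wa.
  by exists i, j, k; left.
have [/tree_weight0[k ->] /tree_weight1[i [j ->]]] := wa.
by exists k, i, j; right.
Qed.

Section Uniqueness.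
Variable K : fieldType.

Lemma corel_jacobi : corel K 'I_3 = \sum_(t <- jacobi_trees) cotree K t.
Proof.
apply/ffunP => t; rewrite sum_ffunE.
rewrite /jacobi_trees !big_cons big_nil !ffunE /corel_sign leaf_sign_ord.
have : uniq (leaves t) by rewrite (perm_uniq (mtree_perm t)) enum_uniq.
have /eqP : (weight t).+1 = 3 by rewrite mtree_weight card_ord.
rewrite eqSS => /eqP /tree_weight2[i [j [k [-> | ->]]]];
case: i => [[|[|[|//]]] ?]; case: j => [[|[|[|//]]] ?] //;
case: k => [[|[|[|//]]] ?] //= _; rewrite /inversions /= !big_cons !big_nil /inverted /=; ring.
Qed.

Lemma LieDual_corelations c : c \in LieDual K 'I_3 -> exists k, c = k *: corel K 'I_3.
Proof.
by move=> /(subvP (LieDual_corel K)) /vlineP[k ->]; exists k; rewrite corel_jacobi.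
Qed.

Lemma LieDual_antisym c (t t' : mtree 'I_2) : c \in LieDual K 'I_2 ->
  mtree_val t = tree12 -> mtree_val t' = tree21 -> c t' = - c t.
Proof.
have [sub _ _] := LieDual_subcooperad K.
move=> /(subvP (sub _)); move: c; apply: vspan_ind => [c [u ->]||k x y].
- move=> et et'; rewrite !ffunE et et' /tree12 /tree21.
  have /eqP : (weight u).+1 = 2 by rewrite mtree_weight card_ord.
  rewrite eqSS => /eqP /tree_weight1[i [j ->]] /=; ring.
- by move=> _ _; rewrite !ffunE oppr0.
- by move=> ex ey et et'; rewrite !ffunE ex // ey // opprD scalerN.
Qed.

(** The ratio to the coordinate of [corel]: [c] is a multiple of [corel] when this is constant. *)
Definition normalized (A : finType) (c : tspan K A) (t : mtree A) : K :=
  (-1) ^+ corel_sign t * c t.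

Lemma pull_normalized (A B : finType) (P : mtree B -> mtree A) c t :
  normalized (pull P c) t = normalized c (P t).
Proof. by rewrite /normalized ffunE mulrA -signr_addb addbCA addbb addbF. Qed.

Lemma normalized3 c (t t' : mtree 'I_3) : c \in LieDual K 'I_3 ->
  normalized c t = normalized c t'.
Proof.
move=> /LieDual_corelations[k ->]; rewrite /normalized !ffunE.
by rewrite ![k *: _]/(k * _) !(mulrCA _ k) -!signr_addb !addbb.
Qed.

Lemma normalized2 c (t t' : mtree 'I_2) : c \in LieDual K 'I_2 ->
  mtree_val t = tree12 -> mtree_val t' = tree21 -> normalized c t = normalized c t'.
Proof.
move=> cD et et'; rewrite /normalized (LieDual_antisym cD et et') /corel_sign.
rewrite !leaf_sign_ord et et' /inversions /= !big_cons !big_nil /inverted /=; ring.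
Qed.

Section Constant.
Variables (A : finType) (c : tspan K A).
Hypothesis cD : c \in LieDual K A.

(** Replacing the subtree [t] by [t'], in any context, does not affect the normalized coordinate of
    [c]. *)
Let equiv (t t' : tree A) : Prop := perm_eq (leaves t) (leaves t') /\
  forall C (m m' : mtree A), mtree_val m = plug_ctx C t -> mtree_val m' = plug_ctx C t' ->
    normalized c m = normalized c m'.

Lemma plug_ctx_perm C (t t' : tree A) : perm_eq (leaves t) (leaves t') ->
  perm_eq (leaves (plug_ctx C t)) (leaves (plug_ctx C t')).
Proof.
elim: C t t' => [|[isl u] C IH] t t' //= P; apply: IH.
by case: isl => /=; rewrite ?perm_cat2l ?perm_cat2r.
Qed.

Let equiv_refl t : equiv t t.
Proof. by split=> // C m m' e e'; congr normalized; apply: val_inj; rewrite /= e e'. Qed.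

Let equiv_sym t t' : equiv t t' -> equiv t' t.
Proof.
move=> [P E]; split; first by rewrite perm_sym.
by move=> C m m' e e'; rewrite (E C m' m).
Qed.

Let equiv_trans t2 t1 t3 : equiv t1 t2 -> equiv t2 t3 -> equiv t1 t3.
Proof.
move=> [P E] [P' E']; split; first exact: perm_trans P'.
move=> C m m' e e'.
have ml : multilinear (plug_ctx C t2).
  apply: multilinear_perm (mtreeP m); rewrite e; apply: plug_ctx_perm.
  by rewrite perm_sym.
by rewrite (E C m (MTree ml)) // (E' C (MTree ml) m').
Qed.

Let equiv_Node a b a' b' : equiv a a' -> equiv b b' -> equiv (Node a b) (Node a' b').
Proof.
move=> [P E] [P' E']; apply: (equiv_trans (t2 := Node a' b)).
  split=> [|C m m' e e']; first by rewrite /= perm_cat2r.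
  exact: (E ((true, b) :: C)).
split=> [|C m m' e e']; first by rewrite /= perm_cat2l.
exact: (E' ((false, a') :: C)).
Qed.

(** The antisymmetry in arity two, pulled back along the substitution of [a] and [b] in the
    context. *)
Let equiv_comm a b : equiv (Node a b) (Node b a).
Proof.
split=> [|C m m' e e']; first by rewrite /= perm_catC.
pose sigma (i : 'I_2) := if i == i2_1 then a else b.
pose t := MTree multilinear12; pose t' := MTree multilinear21.
have ml : multilinear (plug_ctx C (tbind t sigma)) by rewrite -[tbind _ _]/(Node a b) -e mtreeP.
have [P sP PE] := subst_ctx ml.
have -> : m = P t by apply: val_inj; rewrite /= PE e.
have -> : m' = P t' by apply: val_inj; rewrite /= PE e'.
by rewrite -!pull_normalized; apply: normalized2 => //; apply: pull_LieDual.
Qed.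

Lemma multilinear_lcomb : multilinear (lcomb i3_1 i3_2 i3_3).
Proof. by apply: multilinear_jacobi; rewrite mem_head. Qed.

Lemma multilinear_rcomb : multilinear (rcomb i3_1 i3_2 i3_3).
Proof. by apply/forallP => -[[|[|[|m]]] ?]. Qed.

(** In arity three the corelations are the line of [corel], so that both bracketings have the same
    normalized coordinate; this too is pulled back to an arbitrary context. *)
Let equiv_assoc a b d : equiv (Node (Node a b) d) (Node a (Node b d)).
Proof.
split=> [|C m m' e e']; first by rewrite /= catA.
pose sigma (i : 'I_3) := if i == i3_1 then a else if i == i3_2 then b else d.
pose t := MTree multilinear_lcomb; pose t' := MTree multilinear_rcomb.
have ml : multilinear (plug_ctx C (tbind t sigma)).
  by rewrite -[tbind _ _]/(Node (Node a b) d) -e mtreeP.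
have [P sP PE] := subst_ctx ml.
have -> : m = P t by apply: val_inj; rewrite /= PE e.
have -> : m' = P t' by apply: val_inj; rewrite /= PE e'.
by rewrite -!pull_normalized; apply: normalized3; apply: pull_LieDual.
Qed.

Fixpoint comb (a : A) (l : seq A) : tree A :=
  if l is b :: l' then Node (Leaf a) (comb b l') else Leaf a.

Let comb_cat a l b l' : equiv (Node (comb a l) (comb b l')) (comb a (l ++ b :: l')).
Proof.
elim: l a => [|d l IH] a /=; first exact: equiv_refl.
exact: equiv_trans (equiv_assoc _ _ _) (equiv_Node (equiv_refl _) (IH d)).
Qed.

Let equiv_comb t : exists a l, leaves t = a :: l /\ equiv t (comb a l).
Proof.
elim: t => [a|t1 [a [l [e1 E1]]] t2 [b [l' [e2 E2]]]].
  by exists a, [::]; split=> //; apply: equiv_refl.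
exists a, (l ++ b :: l'); split; first by rewrite /= e1 e2.
exact: equiv_trans (equiv_Node E1 E2) (comb_cat _ _ _ _).
Qed.

Let comb_swap a b l : equiv (comb a (b :: l)) (comb b (a :: l)).
Proof.
case: l => [|d l]; first exact: equiv_comm.
apply: equiv_trans (equiv_sym (equiv_assoc _ _ _)) _.
apply: equiv_trans (equiv_Node (equiv_comm _ _) (equiv_refl _)) _.
exact: equiv_assoc.
Qed.

Let comb_perm a l b l' : perm_eq (a :: l) (b :: l') -> equiv (comb a l) (comb b l').
Proof.
have [n] := ubnP (size l); elim: n a l b l' => // n IH a l b l' lt_n P.
have tail x m m' : (size m < n.+1)%N -> perm_eq m m' -> equiv (comb x m) (comb x m').
  case: m => [|y m] le; first by rewrite perm_sym => /perm_nilP ->; apply: equiv_refl.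
  case: m' => [/perm_nilP//|y' m'] Pm.
  by apply: equiv_Node; [exact: equiv_refl|exact: IH].
have sl : size l = size l' by have /perm_size[] := P.
have [eab|nab] := eqVneq a b.
  by move: P; rewrite eab perm_cons; apply: tail.
have al : a \in l' by have := perm_mem P a; rewrite mem_head inE (negbTE nab).
have Pr := perm_to_rem al; set r := rem a l' in Pr.
have Pl : perm_eq l (b :: r).
  rewrite -(perm_cons a) (permPl P); rewrite -(perm_cons b) in Pr.
  exact: perm_trans Pr (permEl (perm_catCA [:: b] [:: a] r)).
apply: equiv_trans (tail _ _ _ lt_n Pl) _; apply: equiv_trans (comb_swap _ _ _) _.
by apply: equiv_sym; apply: tail Pr; rewrite -sl.
Qed.

(** By commutativity and associativity, every tree can be moved to the same right comb: normalized
    coordinates behave like functions of a commutative associative product. *)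
Lemma LieDual_normalized (t t' : mtree A) : normalized c t = normalized c t'.
Proof.
have [a [l [e E]]] := equiv_comb t; have [b [l' [e' E']]] := equiv_comb t'.
have P : perm_eq (a :: l) (b :: l').
  by rewrite -e -e' (permPl (mtree_perm t)) perm_sym mtree_perm.
have [_ /(_ [::] t t')] := equiv_trans E (equiv_trans (comb_perm P) (equiv_sym E')).
exact.
Qed.

End Constant.

Lemma LieDual_line (A : finType) (c : tspan K A) (t : mtree A) :
  c \in LieDual K A -> c = normalized c t *: corel K A.
Proof.
move=> cD; apply/ffunP => u; rewrite !ffunE (LieDual_normalized cD t u) /normalized.
by rewrite /GRing.scale /= mulrAC -signr_addb addbb mul1r.
Qed.

End Uniqueness.

(** * Existence of the generator of the Koszul dual cooperad *)

Fixpoint isot (A : eqType) (t u : tree A) : bool :=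
  match t, u with
  | Leaf a, Leaf b => a == b
  | Node t1 t2, Node u1 u2 => isot t1 u1 && isot t2 u2 || isot t1 u2 && isot t2 u1
  | _, _ => false
  end.

Section Isotopy.
Variable A : eqType.
Implicit Types t u v : tree A.

Lemma isot_refl t : isot t t.
Proof. by elim: t => [a|t1 /= -> t2 ->] /=; rewrite ?eqxx. Qed.

Lemma isot_sym t u : isot t u = isot u t.
Proof.
elim: t u => [a|t1 IH1 t2 IH2] [b|u1 u2] //=.
by rewrite !IH1 !IH2 [isot u2 t1 && _]andbC.
Qed.

Lemma isot_trans : transitive (@isot A).
Proof.
move=> u t v; elim: u t v => [a|u1 IH1 u2 IH2] [b|t1 t2] [d|v1 v2] //=.
  by move=> /eqP -> /eqP ->.
move=> /orP[]/andP[x1 x2] /orP[]/andP[y1 y2]; apply/orP.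
- by left; rewrite (IH1 _ _ x1 y1) (IH2 _ _ x2 y2).
- by right; rewrite (IH1 _ _ x1 y1) (IH2 _ _ x2 y2).
- by right; rewrite (IH2 _ _ x1 y2) (IH1 _ _ x2 y1).
- by left; rewrite (IH2 _ _ x1 y2) (IH1 _ _ x2 y1).
Qed.

Lemma isot_perm t u : isot t u -> perm_eq (leaves t) (leaves u).
Proof.
elim: t u => [a|t1 IH1 t2 IH2] [b|u1 u2] //=; first by move=> /eqP ->.
case/orP => /andP[/IH1 P1 /IH2 P2]; first exact: perm_cat.
by rewrite perm_catC; apply: perm_cat.
Qed.

Lemma isot_weight t u : isot t u -> weight t = weight u.
Proof. by move=> /isot_perm/perm_size[]; rewrite -!/(nleaves _) !nleaves_weight => -[]. Qed.
End Isotopy.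

Section Existence.
Variable K : fieldType.

Lemma corel_sign_Node (A : finType) (a b : tree A) :
  corel_sign (Node a b) = corel_sign a (+) corel_sign b
    (+) (odd (weight b) && odd (nleaves a)) (+) cross (inverted (@rank A)) (leaves a) (leaves b).
Proof.
rewrite /corel_sign /leaf_sign /inversions /= pairsum_cat.
move: (shape_sign a) (shape_sign b) (_ && _) (cross _ _ _) => b1 b2 b3 b4.
by case: b1; case: b2; case: b3; case: b4; case: (pairsum _ _); case: (pairsum _ _).
Qed.

(** An element [cotree t] is supported on the trees obtained from [t] by exchanging subtrees. As the
    leaves are distinct, at most one of the two terms at each vertex is nonzero, and the sign of an
    exchange is the change of [corel_sign]. *)
Lemma coord_treeE (A : finType) (t u : tree A) : uniq (leaves t) ->
  coord_tree K t u = (isot t u)%:R * (-1) ^+ (corel_sign t (+) corel_sign u).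
Proof.
elim: t u => [a|t1 IH1 t2 IH2] [b|u1 u2]; rewrite ?mul0r //.
  by move=> _ /=; case: eqP => [->|_]; rewrite ?mul0r // addbb mulr1.
move=> U; have := U; rewrite cat_uniq => /and3P[U1 dis U2].
have ne : forall v, ~~ (isot t1 v && isot t2 v).
  move=> v; apply/negP => /andP[/isot_perm P1 /isot_perm P2].
  have [x xt] : exists x, x \in leaves t1.
    by move: (nleaves_gt0 t1); rewrite /nleaves; case: (leaves t1) => // x l _; exists x; rewrite mem_head.
  have xt2 : x \in leaves t2 by rewrite (perm_mem P2) -(perm_mem P1).
  by move/hasPn: dis => /(_ x xt2); rewrite /= xt.
rewrite [coord_tree _ _ _]/= [isot _ _]/= !IH1 ?IH2 // !corel_sign_Node.
have [/andP[i1 i2]|n12] := boolP (isot t1 u1 && isot t2 u2).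
  have -> : isot t2 u1 = false by have := ne u1; rewrite i1 => /negbTE.
  rewrite i1 i2 -(isot_weight i2) -(cross_perm _ (isot_perm i1) (isot_perm i2)).
  rewrite !nleaves_weight -(isot_weight i1) mul0r !mulr0 subr0 /= !mul1r -signr_addb.
  congr ((-1) ^+ (nat_of_bool _)); move: (_ && _) (cross _ _ _) => b1 b2.
  by case: b1; case: b2; case: (corel_sign t1); case: (corel_sign t2); case: (corel_sign u1);
    case: (corel_sign u2).
have [/andP[i1 i2]|n21] := boolP (isot t1 u2 && isot t2 u1); last first.
  have -> k k' : (isot t1 u1)%:R * k * ((isot t2 u2)%:R * k') = 0 :> K.
    by rewrite mulrACA -natrM mulnb (negbTE n12) mul0r.
  have -> k k' : (isot t1 u2)%:R * k * ((isot t2 u1)%:R * k') = 0 :> K.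
    by rewrite mulrACA -natrM mulnb (negbTE n21) mul0r.
  by rewrite mulr0 subr0 mul0r.
have -> : isot t2 u2 = false by have := ne u2; rewrite i1 => /negbTE.
rewrite i1 i2 mul0r mulr0 sub0r /= !mul1r -signr_addb.
rewrite -(cross_perm _ (isot_perm i2) (isot_perm i1)) !nleaves_weight -(isot_weight i1) -(isot_weight i2).
have cC := cross_invertedC (@rank_inj A) U.
rewrite -!/(nleaves _) !nleaves_weight in cC.
have -> : cross (inverted (@rank A)) (leaves t2) (leaves t1) =
   cross (inverted (@rank A)) (leaves t1) (leaves t2)
    (+) (odd (weight t1).+1 && odd (weight t2).+1) by rewrite -cC addKb.
rewrite -(signr_odd _ (_ * _)) oddM -signr_addb -signrN /=; congr ((-1) ^+ (nat_of_bool _)).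
move: (cross _ _ _) => b1.
by case: (corel_sign t1); case: (corel_sign t2); case: (corel_sign u1);
  case: (corel_sign u2); case: b1; case: (odd (weight t1)); case: (odd (weight t2)).
Qed.

Hypothesis charK : [pchar K] =i pred0.

(** [corel] is a signed sum of one [cotree] for each class of trees under exchange of subtrees.
    Averaging over the class, of size [N t], avoids choosing representatives. *)
Lemma corel_cofree (A : finType) : corel K A \in cofree K A.
Proof.
pose N (t : mtree A) := #|[pred u : mtree A | isot t u]|.
have N0 t : (N t)%:R != 0 :> K.
  rewrite (iffLR (pcharf0P K) charK) -lt0n; apply/card_gt0P; exists t.
  by rewrite inE isot_refl.
have NE (t u : mtree A) : isot t u -> N t = N u.
  move=> tu; apply: eq_card => v; rewrite !inE.
  by apply/idP/idP; apply: isot_trans => //; rewrite isot_sym.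
have -> : corel K A = \sum_(t : mtree A) ((-1) ^+ corel_sign t / (N t)%:R) *: cotree K t.
  apply/ffunP => u; rewrite ffunE sum_ffunE.
  under eq_bigr => t _.
    rewrite !ffunE coord_treeE ?(perm_uniq (mtree_perm t)) ?enum_uniq //.
    over.
  have -> : (-1) ^+ corel_sign u = \sum_(t : mtree A | isot u t) ((-1) ^+ corel_sign u / (N u)%:R) :> K.
    by rewrite sumr_const -[RHS]mulr_natr -[#|_|]/(N u) divfK.
  rewrite [RHS](bigID (fun t : mtree A => isot u t)) /= addrC [X in X + _]big1 ?add0r.
    apply: eq_bigr => t ut; rewrite isot_sym ut mul1r (NE _ _ ut).
    by rewrite /GRing.scale /= mulrAC -signr_addb addKb.
  by move=> t /negbTE nut; rewrite isot_sym nut mul0r scaler0.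
by apply: rpred_sum => t _; apply: rpredZ; apply: mem_vspan; exists t.
Qed.

Lemma corel_act (A B : finType) (f : bijection A B) :
  mag_act f (corel K A) = (-1) ^+ relabel_sign (bsym f) *: corel K B.
Proof. by apply/ffunP => t; rewrite !ffunE corel_sign_map signr_addb. Qed.

Lemma corel_decomp (A B : finType) : exists e : bool, forall s u,
  decomp (corel K (A + B)%type) s u = (-1) ^+ e * (corel K (option A) s * corel K B u).
Proof.
have [e He] := corel_sign_graft A B; exists e => s u.
rewrite /decomp !ffunE -(signr_odd _ (_ * _)) oddM -!signr_addb; congr ((-1) ^+ (nat_of_bool _)).
by rewrite addbC He addbA.
Qed.

(** The lines spanned by [corel] form a subcooperad satisfying the corelations, and [LieDual] is the
    largest one. *)
Lemma corel_LieDual (A : finType) : corel K A \in LieDual K A.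
Proof.
pose D (B : finType) := <[corel K B]>%VS.
apply: (subvP (@LieDual_max K D _ _ A)); last exact: memv_line.
- split=> [B|B C f c|B C c].
  + by rewrite -memvE corel_cofree.
  + move=> /vlineP[k ->].
    by rewrite -[_ *: _]addr0 mag_act_linear (linear_zero (mag_act_linear f)) addr0 corel_act !memvZ ?memv_line.
  move=> /vlineP[k ->]; have [e He] := corel_decomp B C.
  exists [:: ((k * (-1) ^+ e) *: corel K (option B), corel K C)]; split.
    by move=> p; rewrite inE => /eqP -> /=; rewrite memvZ ?memv_line.
  move=> s u; rewrite big_seq1 /= ffunE.
  have -> : decomp (k *: corel K (B + C)%type) s u = k * decomp (corel K (B + C)%type) s u.
    by rewrite /decomp ffunE /GRing.scale /= mulrCA.
  by rewrite He !mulrA.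
- by rewrite /D corel_jacobi subvv.
Qed.
End Existence.

(** * Antisymmetric elements of PreLie *)

Definition shp A (t : tree A) : ptree := tmap (fun=> tt) t.

Lemma shp_map A B (f : A -> B) (t : tree A) : shp (tmap f t) = shp t.
Proof. by rewrite /shp tmap_comp. Qed.

Lemma nleaves_shp A (t : tree A) : nleaves (shp t) = nleaves t.
Proof. exact: nleaves_map. Qed.

Lemma weight_shp A (t : tree A) : weight (shp t) = weight t.
Proof. exact: weight_map. Qed.

Lemma tree_eq A (t t' : tree A) : shp t = shp t' -> leaves t = leaves t' -> t = t'.
Proof.
elim: t t' => [a|t1 IH1 t2 IH2] [b|u1 u2] //= => [_ [->] //|[e1 e2] e].
have s1 : size (leaves t1) = size (leaves u1).
  by rewrite -!/(nleaves _) -nleaves_shp [shp t1]e1 nleaves_shp.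
have := congr1 (take (size (leaves t1))) e; rewrite {2}s1 !take_size_cat // => l1.
have := congr1 (drop (size (leaves t1))) e; rewrite {2}s1 !drop_size_cat // => l2.
by rewrite (IH1 u1) // (IH2 u2).
Qed.

Fixpoint fill A (a : A) (s : ptree) (l : seq A) : tree A :=
  match s with
  | Leaf _ => Leaf (head a l)
  | Node s1 s2 => Node (fill a s1 (take (nleaves s1) l)) (fill a s2 (drop (nleaves s1) l))
  end.

Lemma shp_fill A (a : A) s l : shp (fill a s l) = s.
Proof.
rewrite /shp; elim: s l => [[]|s1 IH1 s2 IH2] l //=.
by rewrite -[in RHS](IH1 (take (nleaves s1) l)) -[in RHS](IH2 (drop (nleaves s1) l)).
Qed.

Lemma leaves_fill A (a : A) s l : size l = nleaves s -> leaves (fill a s l) = l.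
Proof.
elim: s l => [[]|s1 IH1 s2 IH2] l /=; first by case: l => [|b [|]].
rewrite nleaves_Node => sl; rewrite IH1 ?IH2 ?cat_take_drop ?size_drop ?sl ?addKn //.
by rewrite size_takel // sl leq_addr.
Qed.

Lemma mtree_of_shape n (s : ptree) : nleaves s = n -> exists t : mtree 'I_n, shp t = s.
Proof.
case: n => [|n] sn; first by have := nleaves_gt0 s; rewrite sn.
have ml : multilinear (fill ord0 s (enum 'I_n.+1)).
  by apply/multilinearP; rewrite leaves_fill // size_enum_ord sn.
by exists (MTree ml); apply: shp_fill.
Qed.

Definition bperm (A : finType) (s : {perm A}) : bijection A A :=
  Bijection (permK s) (permKV s).

Lemma relabel_bij (A : finType) (t t' : mtree A) : shp t = shp t' ->
  exists s : {perm A}, mrelabel (bperm s) t = t'.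
Proof.
move=> e.
have bt a : a \in leaves t by rewrite (perm_mem (mtree_perm t)) mem_enum.
have ut : uniq (leaves t) by rewrite (perm_uniq (mtree_perm t)) enum_uniq.
have ut' : uniq (leaves t') by rewrite (perm_uniq (mtree_perm t')) enum_uniq.
have st : size (leaves t) = size (leaves t').
  by rewrite (perm_size (mtree_perm t)) (perm_size (mtree_perm t')).
pose f a := nth a (leaves t') (index a (leaves t)).
have fI : injective f.
  move=> a b; rewrite /f (set_nth_default a) -?st ?index_mem // => /eqP.
  rewrite nth_uniq -?st ?index_mem // => /eqP ei.
  by rewrite -(nth_index a (bt a)) ei (nth_index _ (bt b)).
exists (perm fI); apply: val_inj; apply: tree_eq; first by rewrite /= shp_map.
rewrite /= leaves_map; case E: (leaves t) => [|a0 l].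
  by move: st; rewrite E => /esym/size0nil ->.
rewrite -E; apply: (@eq_from_nth _ a0); rewrite ?size_map // => i lt_i.
rewrite (nth_map a0) // /= permE /f index_uniq //; apply: set_nth_default.
by rewrite -st.
Qed.

Lemma mrelabel_inj (A : finType) (t : mtree A) : injective (fun s : {perm A} => mrelabel (bperm s) t).
Proof.
move=> s s' /(congr1 (fun t : mtree A => leaves t)); rewrite /= !leaves_map => e.
apply/permP => a.
have bt : a \in leaves t by rewrite (perm_mem (mtree_perm t)) mem_enum.
have := congr1 (fun l => nth a l (index a (leaves t))) e.
by rewrite !(nth_map a) ?index_mem // nth_index.
Qed.

(** Permutations act simply transitively on the labellings of a given shape. *)
Lemma sum_shape (V : nmodType) (A : finType) (t : mtree A) (F : mtree A -> V) :
  \sum_(u : mtree A | shp u == shp t) F u = \sum_(s : {perm A}) F (mrelabel (bperm s) t).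
Proof.
rewrite -[RHS](big_map (fun s : {perm A} => mrelabel (bperm s) t) xpredT F) -[LHS]big_filter.
apply: perm_big; apply: uniq_perm.
- by rewrite filter_uniq // index_enum_uniq.
- by rewrite map_inj_uniq ?index_enum_uniq //; apply: mrelabel_inj.
move=> u; rewrite mem_filter mem_index_enum andbT; apply/eqP/mapP => [/esym/relabel_bij[s <-]|[s _ ->]].
  by exists s; rewrite ?mem_index_enum.
exact: shp_map.
Qed.

Section Alternating.
Variable K : fieldType.
Implicit Types (f g : ptree -> K).

(** The antisymmetric element of the magmatic operad with coefficients [f]: the labels are distinct
    odd copies of x. *)
Definition alt (A : finType) f : tspan K A :=
  [ffun t : mtree A => (-1) ^+ leaf_sign t * f (shp t)].

Lemma alt_lin (A : finType) k f g : alt A (fun t => k * f t + g t) = k *: alt A f + alt A g.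
Proof.
by apply/ffunP => t; rewrite !ffunE mulrDr /GRing.scale /= mulrCA.
Qed.

Lemma alt0 (A : finType) : alt A (fun=> 0) = 0.
Proof. by apply/ffunP => t; rewrite !ffunE mulr0. Qed.

Lemma alt_act (A B : finType) (e : bijection A B) f :
  mag_act e (alt A f) = (-1) ^+ relabel_sign (bsym e) *: alt B f.
Proof.
apply/ffunP => t; rewrite !ffunE leaf_sign_map ?mtreeP // shp_map signr_addb.
by rewrite /GRing.scale /= mulrA.
Qed.

Lemma alt_dirac (A : finType) (t : mtree A) :
  alt A (dirac (shp t)) = (-1) ^+ leaf_sign t *:
    \sum_(s : {perm A}) (-1) ^+ relabel_sign (bperm s) *: mag_act (bperm s) (mono K t).
Proof.
transitivity (\sum_(u : mtree A | shp u == shp t) (-1) ^+ leaf_sign u *: mono K u).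
  apply/ffunP => u; rewrite !ffunE sum_ffunE /dirac.
  have [eu|nu] := eqVneq (shp u) (shp t).
    rewrite (bigD1 u) ?eu //= ffunE monoE eqxx big1 ?addr0 // => v /andP[_ nv].
    by rewrite ffunE monoE eq_sym (negbTE nv) scaler0.
  rewrite mulr0 big1 // => v ev; rewrite ffunE monoE.
  by have [uv|_] := eqVneq u v; [move: nu; rewrite uv ev|rewrite scaler0].
rewrite sum_shape scaler_sumr; apply: eq_bigr => s _.
by rewrite mag_act_mono scalerA -signr_addb leaf_sign_map ?mtreeP // addbC.
Qed.

Lemma alt_dirac0 n s : nleaves s <> n -> alt 'I_n (dirac s) = 0.
Proof.
move=> ns; apply/ffunP => t; rewrite !ffunE /dirac; case: eqP => [es|]; last by rewrite mulr0.
by case: ns; rewrite -es nleaves_shp nleaves_weight mtree_weight card_ord.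
Qed.

Lemma span_support (P : ptree -> Prop) f n :
  (forall t, f t != 0 -> P t /\ nleaves t = n) -> span P f.
Proof.
move=> fP; pose l := undup (trees_upto unit n).
have : f = fun t => \sum_(s <- l) f s * dirac s t.
  apply/funext => t; have [f0|/fP[_ tn]] := eqVneq (f t) 0.
    rewrite big1_seq // => s _; rewrite /dirac; case: eqP => [<-|_]; rewrite ?f0 ?mul0r //.
    by rewrite mulr0.
  have tl : t \in l by rewrite mem_undup; apply: mem_trees_upto; rewrite -tn.
  rewrite (bigD1_seq t) ?undup_uniq //= /dirac eqxx mulr1 big1 ?addr0 // => s ns.
  by rewrite eq_sym (negbTE ns) mulr0.
move=> ->; elim: l => [|s l IH].
  by rewrite (_ : (fun t => _) = fun=> 0); [exact: span0|apply/funext => t; rewrite big_nil].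
rewrite (_ : (fun t => _) = fun t => f s * dirac s t + \sum_(s <- l) f s * dirac s t); last first.
  by apply/funext => t; rewrite big_cons.
have [f0|/fP[Ps _]] := eqVneq (f s) 0; last exact: span_add.
by rewrite f0; apply: lin_closed_ext IH _ => t; rewrite mul0r add0r.
Qed.

End Alternating.

(** * Super pre-Lie relations antisymmetrize into the pre-Lie ideal *)

Lemma inversions_cat (A : eqType) (r : A -> nat) l1 l2 : inversions r (l1 ++ l2) =
  inversions r l1 (+) inversions r l2 (+) cross (inverted r) l1 l2.
Proof. exact: pairsum_cat. Qed.

Lemma inversions_ctx (A : eqType) (r : A -> nat) C (x y : tree A) :
  perm_eq (leaves x) (leaves y) ->
  inversions r (leaves (plug_ctx C x)) (+) inversions r (leaves (plug_ctx C y))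
  = inversions r (leaves x) (+) inversions r (leaves y).
Proof.
elim: C x y => [|[isl u] C IH] x y P //=; rewrite IH.
  by case: isl => /=; rewrite !inversions_cat ?(cross_perm _ P (perm_refl _))
    ?(cross_perm _ (perm_refl _) P); case: (inversions _ _); case: (inversions _ _);
    case: (inversions _ _); case: (cross _ _ _).
by case: isl => /=; rewrite ?perm_cat2l ?perm_cat2r.
Qed.

Lemma plug_ctx_shp A (t : tree A) C s : shp t = plug_ctx C s ->
  exists C' s', [/\ t = plug_ctx C' s', shp s' = s & forall u : tree A,
    shp (plug_ctx C' u) = plug_ctx C (shp u)].
Proof.
elim: C s => [|[isl v] C IH] s /=; first by move=> e; exists [::], t.
case: isl => /IH[C' [s' [-> e12 e]]]; case: s' e12 => [//|t1 t2] [e1 e2].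
  exists ((true, t2) :: C'), t1; split=> // u /=.
  by rewrite e -[shp (Node u t2)]/(Node (shp u) (shp t2)) [shp t2]e2.
exists ((false, t1) :: C'), t2; split=> // u /=.
by rewrite e -[shp (Node t1 u)]/(Node (shp t1) (shp u)) [shp t1]e1.
Qed.

Lemma uniq_ctx (A : eqType) C (x : tree A) : uniq (leaves (plug_ctx C x)) -> uniq (leaves x).
Proof.
elim: C x => [|[isl u] C IH] x //= /IH; case: isl; rewrite /= cat_uniq => /and3P[] //.
Qed.

Lemma scale_rsymm (K : fieldType) (V : lmodType K) (x y : K) (g1 g2 g3 g4 : V) :
  y * y = 1 -> x *: (g1 - g2 - (g3 - g4)) =
  -1 *: (x *: g2) + (- y *: (x * y *: g3) + (y *: (x * y *: g4) + x *: g1)).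
Proof.
move=> y1; rewrite !scalerA mulN1r mulNr !(mulrCA y) y1 mulr1 !scaleNr.
by rewrite !scalerBr opprB !addrA [RHS](ACl (4*1*3*2)).
Qed.

Section IdealFromRel.
Variable K : fieldType.
Let I := gen_ideal (@prelie_rel K).

Fixpoint ctx_fun (C : seq (bool * ptree)) (f : ptree -> K) : ptree -> K :=
  if C is (isl, u) :: C' then
    ctx_fun C' (if isl then tmul f (dirac u) else tmul (dirac u) f)
  else f.

Lemma ctx_fun_lin C : linmap (ctx_fun C).
Proof.
elim: C => [|[isl u] C IH] k f g //=; rewrite -IH; congr ctx_fun.
by case: isl; [apply: tmul_linl|apply: tmul_linr].
Qed.

Lemma ctx_fun_dirac C t : ctx_fun C (dirac t) = dirac (plug_ctx C t).
Proof. by elim: C t => [|[isl u] C IH] t //=; case: isl; rewrite -dirac_Node IH. Qed.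

Lemma prelie_ctx (A : finType) C (a b c : tree A) :
  multilinear (plug_ctx C (Node (Node a b) c)) ->
  (mono K (plug_ctx C (Node (Node a b) c)) - mono K (plug_ctx C (Node a (Node b c))))
  - (mono K (plug_ctx C (Node (Node a c) b)) - mono K (plug_ctx C (Node a (Node c b))))
  \in I A.
Proof.
move=> ml; pose sigma (i : 'I_3) := if i == i3_1 then a else if i == i3_2 then b else c.
have mk (t : tree 'I_3) : multilinear t -> exists m : mtree 'I_3, mtree_val m = t.
  by move=> mt; exists (MTree mt).
have [t1 e1] := mk _ multilinear_lcomb; have [t2 e2] := mk _ multilinear_rcomb.
have [t3 e3] : exists m : mtree 'I_3, mtree_val m = lcomb i3_1 i3_3 i3_2.
  by apply: mk; apply/forallP => -[[|[|[|m]]] ?].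
have [t4 e4] : exists m : mtree 'I_3, mtree_val m = rcomb i3_1 i3_3 i3_2.
  by apply: mk; apply/forallP => -[[|[|[|m]]] ?].
have ml1 : multilinear (plug_ctx C (tbind t1 sigma)) by rewrite e1.
have [P sP PE] := subst_ctx ml1.
have rI : rsym (@mono K 'I_3) i3_1 i3_2 i3_3 \in I 'I_3.
  exact: mem_gen_ideal (@prelie_rsym K).
have := push_ideal (gen_idealP (@prelie_rel K)) sP rI.
have pl := push_linear (K := K) P.
rewrite /rsym -e1 -e2 -e3 -e4 !(linear_sub pl) !push_mono !PE e1 e2 e3 e4.
by [].
Qed.

(** This is the antisymmetrization of an ordinary pre-Lie relation in a context: exchanging the leaf
    blocks of [b'] and [c'] produces exactly the sign of the super relation. *)
Lemma alt_rsymm n C a b c :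
  alt 'I_n (ctx_fun C (rsymm (odd (nleaves b) && odd (nleaves c))
    (dirac a) (dirac b) (dirac c))) \in I 'I_n.
Proof.
set e := _ && _.
pose s1 := plug_ctx C (Node (Node a b) c); pose s2 := plug_ctx C (Node a (Node b c)).
pose s3 := plug_ctx C (Node (Node a c) b); pose s4 := plug_ctx C (Node a (Node c b)).
rewrite rsymmE !ctx_fun_lin -!dirac_Node !ctx_fun_dirac !alt_lin -/s1 -/s2 -/s3 -/s4.
have ctx_size (x y : ptree) : nleaves x = nleaves y -> nleaves (plug_ctx C x) = nleaves (plug_ctx C y).
  elim: (C) x y => [|[isl u] C' IH] x y //= exy; apply: IH.
  by case: isl; rewrite !nleaves_Node exy.
have n12 : nleaves s2 = nleaves s1 by apply: ctx_size; rewrite !nleaves_Node; lia.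
have n13 : nleaves s3 = nleaves s1 by apply: ctx_size; rewrite !nleaves_Node; lia.
have n14 : nleaves s4 = nleaves s1 by apply: ctx_size; rewrite !nleaves_Node; lia.
have [sn|ns] := eqVneq (nleaves s1) n; last first.
  by rewrite !alt_dirac0 ?scaler0 ?addr0 ?mem0v //; apply/eqP; rewrite ?n12 ?n13 ?n14.
have [t et] := mtree_of_shape sn.
have [C' [t' [tE e3 eC]]] := plug_ctx_shp et.
case: t' tE e3 => [//|[//|a' b'] c'] tE [ea eb ec].
have ml1 : multilinear (plug_ctx C' (Node (Node a' b') c')) by rewrite -tE mtreeP.
have mlx x : perm_eq (leaves x) (leaves (Node (Node a' b') c')) -> multilinear (plug_ctx C' x).
  by move=> P; apply: multilinear_perm ml1; apply: plug_ctx_perm.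
have P2 : perm_eq (leaves (Node a' (Node b' c'))) (leaves (Node (Node a' b') c')).
  by rewrite /= catA.
have P3 : perm_eq (leaves (Node (Node a' c') b')) (leaves (Node (Node a' b') c')).
  by rewrite /= -!catA perm_cat2l perm_catC.
have P4 : perm_eq (leaves (Node a' (Node c' b'))) (leaves (Node (Node a' b') c')).
  by rewrite /= -!catA perm_cat2l perm_catC.
have mk (x : tree 'I_n) : multilinear x -> exists m : mtree 'I_n, mtree_val m = x.
  by move=> mx; exists (MTree mx).
have [t1 e1] := mk _ ml1; have [t2 e2] := mk _ (mlx _ P2).
have [t3 e3] := mk _ (mlx _ P3); have [t4 e4] := mk _ (mlx _ P4).
have -> : s1 = shp t1 by rewrite e1 eC /s1 -ea -eb -ec.
have -> : s2 = shp t2 by rewrite e2 eC /s2 -ea -eb -ec.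
have -> : s3 = shp t3 by rewrite e3 eC /s3 -ea -eb -ec.
have -> : s4 = shp t4 by rewrite e4 eC /s4 -ea -eb -ec.
have U : uniq (leaves b' ++ leaves c').
  have : uniq (leaves t1) by rewrite (perm_uniq (mtree_perm t1)) enum_uniq.
  by rewrite e1 => /uniq_ctx; rewrite /= -catA cat_uniq => /and3P[].
have l2 : leaf_sign t2 = leaf_sign t1.
  have : leaf_sign t2 (+) leaf_sign t1 = false.
    by rewrite /leaf_sign e1 e2 inversions_ctx //= catA addbb.
  by case: (leaf_sign t1); case: (leaf_sign t2).
have eE : e = odd (nleaves b') && odd (nleaves c') by rewrite /e -eb -ec !nleaves_shp.
have l34 x : perm_eq (leaves x) (leaves (Node (Node a' b') c')) ->
    leaves x = leaves a' ++ leaves c' ++ leaves b' ->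
    leaf_sign (plug_ctx C' x) = leaf_sign t1 (+) e.
  move=> Px lx; rewrite -[LHS]addbF -(addbb (leaf_sign t1)) addbA addbC; congr (_ (+) _).
  rewrite /leaf_sign e1 inversions_ctx // lx /= -catA !inversions_cat.
  rewrite (cross_perm _ (perm_refl _) (permEl (perm_catC (leaves c') _))).
  rewrite eE -(cross_invertedC (@rank_inj _) U).
  move: (inversions _ (leaves a')) (inversions _ (leaves b')) (inversions _ (leaves c')) => i1 i2 i3.
  move: (cross _ (leaves a') _) (cross _ (leaves b') _) (cross _ (leaves c') _) => i4 i5 i6.
  by case: i1; case: i2; case: i3; case: i4; case: i5; case: i6.
have l3 : leaf_sign t3 = leaf_sign t1 (+) e by rewrite e3; apply: l34 => //=; rewrite catA.
have l4 : leaf_sign t4 = leaf_sign t1 (+) e by rewrite e4; apply: l34.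
pose G v := \sum_(s : {perm 'I_n}) (-1) ^+ relabel_sign (bperm s) *: mag_act (K := K) (bperm s) v.
have GI v : v \in I 'I_n -> G v \in I 'I_n.
  move=> vI; apply: rpred_sum => s _; apply: rpredZ.
  by have [actI _ _] := gen_idealP (@prelie_rel K); apply: actI.
have Gl : linear G.
  move=> k x y; rewrite /G scaler_sumr -big_split; apply: eq_bigr => s _ /=.
  by rewrite mag_act_linear scalerDr !scalerA mulrC.
rewrite !alt_dirac -!/(G _) l2 l3 l4 !signr_addb.
have := GI _ (prelie_ctx ml1); rewrite !(linear_sub Gl).
rewrite -e1 -e2 -e3 -e4.
move=> /(rpredZ ((-1) ^+ leaf_sign t1)).
by rewrite (@scale_rsymm K _ _ ((-1) ^+ e)) // -signr_addb addbb.
Qed.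

Lemma alt_rel f : rel f -> forall n, alt 'I_n f \in I 'I_n.
Proof.
(* Generalizing over the context absorbs the multiplications in the definition of [rel]. *)
move=> Rf n; rewrite -[f]/(ctx_fun [::] f).
elim: Rf [::] => {f} [|k f g _ If _ Ig|a b c|s f _ If|s f _ If] C.
- by rewrite (linmap0 (ctx_fun_lin C)) alt0 mem0v.
- by rewrite ctx_fun_lin alt_lin; apply: rpredD => //; apply: rpredZ.
- exact: alt_rsymm.
- exact: (If ((false, s) :: C)).
- exact: (If ((true, s) :: C)).
Qed.
End IdealFromRel.

(** * From the pre-Lie ideal back to super pre-Lie relations *)

Lemma linear_scale (K : fieldType) (U V : lmodType K) (f : U -> V) k u :
  linear f -> f (k *: u) = k *: f u.
Proof. by move=> lf; rewrite -[k *: u]addr0 lf (linear_zero lf) addr0. Qed.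

Lemma perm_leaves_bind (A : finType) B (C : eqType) (h : B -> C) (sigma : A -> tree B) (t t' : mtree A) :
  perm_eq (map h (leaves (tbind t sigma))) (map h (leaves (tbind t' sigma))).
Proof.
have P : perm_eq (leaves t) (leaves t').
  by rewrite (permPl (mtree_perm t)) perm_sym mtree_perm.
apply/seq.permP => p; rewrite !leaves_bind !map_flatten !count_flatten -!map_comp.
by apply: perm_sumn; apply: perm_map.
Qed.

Section RelFromIdeal.
Variable K : fieldType.
Let inv (l : seq nat) := inversions id l.

(* The labels are odd variables, sorted before they are all set to x. *)
Definition ev (t : tree nat) : ptree -> K :=
  fun s => (-1) ^+ inversions id (leaves t) * dirac (shp t) s.

Lemma ev_Node t1 t2 : ev (Node t1 t2) = fun s =>
  (-1) ^+ cross (inverted id) (leaves t1) (leaves t2) * tmul (ev t1) (ev t2) s.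
Proof.
apply/funext => s; rewrite /ev inversions_cat !signr_addb -[shp _]/(Node (shp t1) (shp t2)).
by rewrite dirac_Node; case: s => [x|a b] /=; ring.
Qed.

Lemma ev_fin t : fin (ev t).
Proof. by apply: (closed_scale (span_closed K _)); apply: fin_dirac. Qed.

Definition evs (A : finType) (sigma : A -> tree nat) (v : tspan K A) : ptree -> K :=
  fun s => \sum_(t : mtree A) v t * ev (tbind t sigma) s.

Lemma evs_linear (A : finType) (sigma : A -> tree nat) s :
  linear (fun v => evs sigma v s : K^o).
Proof.
move=> k x y; rewrite /evs scaler_sumr -big_split; apply: eq_bigr => t _ /=.
by rewrite !ffunE mulrDl /GRing.scale /= -mulrA.
Qed.

Lemma evs_mono (A : finType) (sigma : A -> tree nat) (t : mtree A) :
  evs sigma (mono K t) = ev (tbind t sigma).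
Proof.
apply/funext => s; rewrite /evs (bigD1 t) //= monoE eqxx mul1r big1 ?addr0 // => u nu.
by rewrite monoE (negbTE nu) mul0r.
Qed.

(** Quantifying over all substitutions of trees with distinct odd labels makes these vectors an
    operadic ideal ([evs_rel_ideal]), to which minimality of the generated ideal applies. *)
Definition evs_rel (A : finType) (v : tspan K A) : Prop :=
  forall sigma : A -> tree nat, (forall t : mtree A, uniq (leaves (tbind t sigma))) ->
  rel (evs sigma v).

Lemma evs_rel_lin (A : finType) k (x y : tspan K A) :
  evs_rel x -> evs_rel y -> evs_rel (k *: x + y).
Proof.
move=> Rx Ry sigma U; apply: lin_closed_ext (rel_lin k (Rx _ U) (Ry _ U)) _ => s.
by rewrite [RHS](evs_linear sigma s k x y).
Qed.

Lemma evs_rel0 (A : finType) : evs_rel (0 : tspan K A).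
Proof.
move=> sigma U; apply: lin_closed_ext (rel0 K) _ => s.
by rewrite [RHS](linear_zero (evs_linear sigma s)).
Qed.

Lemma evs_rel_span (A : finType) (v : tspan K A) : v \in vspan (@evs_rel A) -> evs_rel v.
Proof. by apply: vspan_ind; [|exact: evs_rel0|exact: evs_rel_lin]. Qed.

Lemma rel_sum (T : finType) (F : T -> ptree -> K) (k : T -> K) :
  (forall i, rel (F i)) -> rel (fun s => \sum_i k i * F i s).
Proof.
move=> RF; elim: (index_enum T) => [|i l IH].
  by apply: lin_closed_ext (rel0 K) _ => s; rewrite big_nil.
by apply: lin_closed_ext (rel_lin (k i) (RF i) IH) _ => s; rewrite big_cons.
Qed.

(** Only the hole of [s] depends on [u], and all [u] have the same leaves. The reordering signs are
    therefore constant, and the fixed factors can be pulled out vertex by vertex down to the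
    hole. *)
Lemma evs_rel_graft (A B : finType) (sigma : (A + B)%type -> tree nat) (y : tspan K B)
    (s : tree (option A)) :
  let rho (u : mtree B) o := if o is Some a then sigma (inl a) else tbind u (sigma \o inr) in
  evs_rel y -> count_mem None (leaves s) = 1%N ->
  (forall u, uniq (leaves (tbind s (rho u)))) ->
  rel (K := K) (fun r => \sum_(u : mtree B) y u * ev (tbind s (rho u)) r).
Proof.
move=> rho Ry.
have const s' u u' : count_mem None (leaves s') = 0%N -> tbind s' (rho u) = tbind s' (rho u').
  elim: s' => [[a|]|s1 IH1 s2 IH2] //=; rewrite count_cat => /eqP.
  by rewrite addn_eq0 => /andP[/eqP/IH1 -> /eqP/IH2 ->].
have Pr s' u u' : perm_eq (leaves (tbind s' (rho u))) (leaves (tbind s' (rho u'))).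
  elim: s' => [[a|]|s1 IH1 s2 IH2] //=; last exact: perm_cat.
  by have := perm_leaves_bind id (sigma \o inr) u u'; rewrite !map_id.
elim: s => [[a|]|s1 IH1 s2 IH2] //=.
  by move=> _ U; apply: lin_closed_ext (Ry _ U) _ => r.
rewrite count_cat => c U.
(* A tree [u0] serves to name the constant sign; without any tree the sum is empty. *)
case: (pickP (xpredT : pred (mtree B))) => [u0 _|noB]; last first.
  by apply: lin_closed_ext (rel0 K) _ => r; rewrite big1 // => u; have := noB u.
have add1 x z : (x + z = 1 -> x = 1 /\ z = 0 \/ x = 0 /\ z = 1)%N by lia.
have [[c1 c2]|[c1 c2]] := add1 _ _ c.
  have U1 u : uniq (leaves (tbind s1 (rho u))) by have := U u; rewrite cat_uniq => /and3P[].
  pose e := cross (inverted id) (leaves (tbind s1 (rho u0))) (leaves (tbind s2 (rho u0))).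
  have R := closed_scale (rel_closed K) ((-1) ^+ e)
    (rel_tmulr (ev_fin (tbind s2 (rho u0))) (IH1 c1 U1)).
  apply: lin_closed_ext R _ => r.
  have -> : tmul (K := K) (fun r => \sum_u y u * ev (tbind s1 (rho u)) r) (ev (tbind s2 (rho u0))) r
      = \sum_u y u * tmul (ev (tbind s1 (rho u))) (ev (tbind s2 (rho u0))) r.
    case: r => [x|r1 r2] /=; first by rewrite big1 // => u _; rewrite mulr0.
    by rewrite mulr_suml; apply: eq_bigr => u _; rewrite -mulrA.
  rewrite mulr_sumr; apply: eq_bigr => u _; rewrite ev_Node mulrCA.
  by rewrite (const s2 u u0 c2) /e (cross_perml _ _ (Pr s1 u u0)).
have U2 u : uniq (leaves (tbind s2 (rho u))) by have := U u; rewrite cat_uniq => /and3P[].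
pose e := cross (inverted id) (leaves (tbind s1 (rho u0))) (leaves (tbind s2 (rho u0))).
have R := closed_scale (rel_closed K) ((-1) ^+ e)
  (rel_tmull (ev_fin (tbind s1 (rho u0))) (IH2 c2 U2)).
apply: lin_closed_ext R _ => r.
have -> : tmul (K := K) (ev (tbind s1 (rho u0))) (fun r => \sum_u y u * ev (tbind s2 (rho u)) r) r
    = \sum_u y u * tmul (ev (tbind s1 (rho u0))) (ev (tbind s2 (rho u))) r.
  case: r => [x|r1 r2] /=; first by rewrite big1 // => u _; rewrite mulr0.
  by rewrite mulr_sumr; apply: eq_bigr => u _; rewrite mulrCA.
rewrite mulr_sumr; apply: eq_bigr => u _; rewrite ev_Node mulrCA.
by rewrite (const s1 u u0 c1) /e (cross_permr _ _ (Pr s2 u u0)).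
Qed.

(** Substituting into a composite amounts to substituting into the root tree, with the hole sent to
    the substituted upper tree. When [x] is the relation, this is again a substitution; the case of
    [y] is [evs_rel_graft]. *)
Lemma evs_rel_ideal : is_ideal (P := Mag K) (fun A => vspan (@evs_rel A)).
Proof.
split.
- move=> A B f v /evs_rel_span Rv; apply: mem_vspan => sigma U.
  change (op_act f v) with (mag_act f v).
  have Uf (t : mtree A) : uniq (leaves (tbind t (sigma \o f))).
    by have := U (mrelabel f t); rewrite /= tbind_map.
  apply: lin_closed_ext (Rv _ Uf) _ => s; move: v {Rv}.
  apply: (@tspan_ext K A K^o); [exact: evs_linear| |].
    by move=> k x y; rewrite mag_act_linear [LHS]evs_linear.
  by move=> t; rewrite mag_act_mono !evs_mono /= tbind_map.
- move=> A B x y /evs_rel_span Rx; apply: mem_vspan => sigma U.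
  change (op_comp x y) with (mag_comp x y).
  pose rho (u : mtree B) o := if o is Some a then sigma (inl a) else tbind u (sigma \o inr).
  have rhoE (s : tree (option A)) (u : mtree B) : tbind (tgraft s u) sigma = tbind s (rho u).
    by rewrite /tgraft tbindA; apply: eq_tbind => -[a|] //=; rewrite tbind_map.
  have Ux u (s : mtree (option A)) : uniq (leaves (tbind s (rho u))).
    by have := U (mgraft s u); rewrite /= rhoE.
  apply: lin_closed_ext (rel_sum y (fun u => Rx _ (Ux u))) _ => r.
  move: x {Rx}; apply: (@tspan_ext K (option A) K^o).
  + move=> k x x'; rewrite scaler_sumr -big_split; apply: eq_bigr => u _ /=.
    by rewrite [evs _ _ _]evs_linear mulrDr /GRing.scale /= mulrCA.
  + by move=> k x x'; rewrite mag_comp_linearl [LHS]evs_linear.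
  move=> s; move: y; apply: (@tspan_ext K B K^o).
  + move=> k x x'; rewrite scaler_sumr -big_split; apply: eq_bigr => u _ /=.
    by rewrite !ffunE mulrDl /GRing.scale /= -mulrA.
  + by move=> k x x'; rewrite mag_comp_linearr [LHS]evs_linear.
  move=> u; rewrite mag_comp_mono evs_mono /= rhoE (bigD1 u) //= monoE eqxx mul1r evs_mono.
  by rewrite big1 ?addr0 // => u' nu; rewrite monoE (negbTE nu) mul0r.
move=> A B x y /evs_rel_span Ry; apply: mem_vspan => sigma U.
change (op_comp x y) with (mag_comp x y).
pose rho (u : mtree B) o := if o is Some a then sigma (inl a) else tbind u (sigma \o inr).
have rhoE (s : tree (option A)) (u : mtree B) : tbind (tgraft s u) sigma = tbind s (rho u).
  by rewrite /tgraft tbindA; apply: eq_tbind => -[a|] //=; rewrite tbind_map.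
have Rs (s : mtree (option A)) : rel (K := K) (fun r => \sum_(u : mtree B) y u * ev (tbind s (rho u)) r).
  apply: evs_rel_graft => //; first by have /forallP/(_ None)/eqP := mtreeP s.
  by move=> u; have := U (mgraft s u); rewrite /= rhoE.
apply: lin_closed_ext (rel_sum x Rs) _ => r; move: x.
apply: (@tspan_ext K (option A) K^o).
+ move=> k x x'; rewrite scaler_sumr -big_split; apply: eq_bigr => s _ /=.
  by rewrite !ffunE mulrDl /GRing.scale /= -mulrA.
+ by move=> k x x'; rewrite mag_comp_linearl [LHS]evs_linear.
move=> s; rewrite (bigD1 s) //= monoE eqxx mul1r [X in _ + X]big1 ?addr0; last first.
  by move=> s' ns; rewrite monoE (negbTE ns) mul0r.
move: y {Ry Rs}; apply: (@tspan_ext K B K^o).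
+ move=> k x x'; rewrite scaler_sumr -big_split; apply: eq_bigr => u _ /=.
  by rewrite !ffunE mulrDl /GRing.scale /= -mulrA.
+ by move=> k x x'; rewrite mag_comp_linearr [LHS]evs_linear.
move=> u; rewrite mag_comp_mono evs_mono /= rhoE (bigD1 u) //= monoE eqxx mul1r.
by rewrite big1 ?addr0 // => u' nu; rewrite monoE (negbTE nu) mul0r.
Qed.

Lemma evs_rel_prelie (A : finType) (v : Mag K A) : prelie_rel v -> v \in vspan (@evs_rel A).
Proof.
case=> {A v}; apply: mem_vspan => sigma U.
have mk (t : tree 'I_3) : multilinear t -> exists m : mtree 'I_3, mtree_val m = t.
  by move=> mt; exists (MTree mt).
have [t1 e1] := mk _ multilinear_lcomb; have [t2 e2] := mk _ multilinear_rcomb.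
have [t3 e3] : exists m : mtree 'I_3, mtree_val m = lcomb i3_1 i3_3 i3_2.
  by apply: mk; apply/forallP => -[[|[|[|m]]] ?].
have [t4 e4] : exists m : mtree 'I_3, mtree_val m = rcomb i3_1 i3_3 i3_2.
  by apply: mk; apply/forallP => -[[|[|[|m]]] ?].
rewrite -e1 -e2 -e3 -e4.
pose a := sigma i3_1; pose b := sigma i3_2; pose c := sigma i3_3.
have Ubc : uniq (leaves b ++ leaves c).
  by have := U t1; rewrite e1 /= -catA cat_uniq => /and3P[].
apply: lin_closed_ext (closed_scale (rel_closed K) ((-1) ^+ inv (leaves a ++ leaves b ++ leaves c))
  (rel_gen K (shp a) (shp b) (shp c))) _ => r.
have ls x y : evs sigma (x - y) r = evs sigma x r - evs sigma y r.
  exact: (linear_sub (evs_linear sigma r)).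
rewrite !ls !evs_mono e1 e2 e3 e4 /rsymm /assoc.
have evE t r' : ev t r' = (-1) ^+ inv (leaves t) * dirac (shp t) r' by [].
have nE (t : tree nat) : odd (nleaves (shp t)) = odd (nleaves t) by rewrite nleaves_shp.
rewrite !evE !nE -!dirac_Node /= -/a -/b -/c -!catA.
have -> : inv (leaves a ++ leaves c ++ leaves b)
    = inv (leaves a ++ leaves b ++ leaves c) (+) (odd (nleaves b) && odd (nleaves c)).
  rewrite /inv !inversions_cat (cross_perm _ (perm_refl _) (permEl (perm_catC (leaves c) _))).
  rewrite -(cross_invertedC (@inj_id nat) Ubc).
  move: (inversions _ (leaves a)) (inversions _ (leaves b)) (inversions _ (leaves c)) => i1 i2 i3.
  move: (cross _ (leaves a) _) (cross _ (leaves b) _) (cross _ (leaves c) _) => i4 i5 i6.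
  by case: i1; case: i2; case: i3; case: i4; case: i5; case: i6.
rewrite signr_addb; ring.
Qed.

(** The ideal of [evs_rel] contains the pre-Lie relation, hence the generated ideal; the claim is
    its instance at the substitution of the labels themselves. *)
Lemma gen_ideal_rel n (v : tspan K 'I_n) : v \in gen_ideal (@prelie_rel K) 'I_n ->
  rel (K := K) (fun s => \sum_(t : mtree 'I_n) v t * ((-1) ^+ leaf_sign t * dirac (shp t) s)).
Proof.
move=> /(subvP (gen_ideal_min evs_rel_ideal evs_rel_prelie 'I_n)) /evs_rel_span Rv.
have U (t : mtree 'I_n) : uniq (leaves (tbind t (Leaf \o @nat_of_ord n))).
  rewrite -/(tmap _ _) leaves_map map_inj_uniq; last exact: val_inj.
  by rewrite (perm_uniq (mtree_perm t)) enum_uniq.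
apply: lin_closed_ext (Rv _ U) _ => s; apply: eq_bigr => t _; congr (_ * _).
by rewrite /ev -/(tmap _ _) shp_map leaf_sign_ord leaves_map /inversions pairsum_map.
Qed.

Hypothesis charK : [pchar K] =i pred0.

Lemma natr_neq0 m : (0 < m)%N -> m%:R != 0 :> K.
Proof. by rewrite (iffLR (pcharf0P K) charK) lt0n. Qed.

Lemma card_perm_neq0 n : #|{perm 'I_n}|%:R != 0 :> K.
Proof. by apply: natr_neq0; apply/card_gt0P; exists 1%g. Qed.

(** Evaluating [alt f] by sorting labels counts each labelling of a shape once, which gives n! times
    [f]; dividing by n! yields the converse of [alt_rel]. *)
Lemma alt_gen_ideal n f : (forall t, f t != 0 -> nleaves t = n) ->
  alt 'I_n f \in gen_ideal (@prelie_rel K) 'I_n -> rel f.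
Proof.
move=> f0 /gen_ideal_rel R.
apply: lin_closed_ext (closed_scale (rel_closed K) (#|{perm 'I_n}|%:R^-1) R) _ => s.
have -> : \sum_(t : mtree 'I_n) alt 'I_n f t * ((-1) ^+ leaf_sign t * dirac (shp t) s)
    = \sum_(t : mtree 'I_n | shp t == s) f s.
  rewrite [RHS]big_mkcond; apply: eq_bigr => t _.
  rewrite ffunE /dirac eq_sym; case: eqP => [<-|_]; last by rewrite !mulr0.
  by rewrite mulr1 mulrC mulrA -expr2 sqrr_sign mul1r.
have [fs0|/f0/mtree_of_shape[t <-]] := eqVneq (f s) 0.
  by rewrite fs0 big1 ?mulr0.
by rewrite sum_shape sumr_const -[RHS]mul1r -[X in _ * X]mulr_natl mulrA mulVf ?card_perm_neq0.
Qed.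

(** The function [f] comes from antisymmetrizing a lift of [a] and dividing by n!. *)
Lemma antisym_alt n (a : PreLie K 'I_n) :
  (forall s : {perm 'I_n},
     op_act (bsym (bperm s)) a = (-1) ^+ relabel_sign (bperm s) *: a) ->
  exists f, (forall t, f t != 0 -> nleaves t = n) /\ a = quot_proj (@prelie_rel K) 'I_n (alt 'I_n f).
Proof.
move=> sym; have [v av] := quot_piK a.
pose N : K := #|{perm 'I_n}|%:R.
pose f s := N^-1 * \sum_(t : mtree 'I_n | shp t == s) (-1) ^+ leaf_sign t * v t.
exists f; split=> [t|].
  apply: contraNeq => nt; rewrite /f big1 ?mulr0 // => u /eqP ut.
  by case/eqP: nt; rewrite -ut nleaves_shp nleaves_weight mtree_weight card_ord.
have -> : alt 'I_n f = N^-1 *: \sum_(s : {perm 'I_n})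
    (-1) ^+ relabel_sign (bperm s) *: mag_act (bsym (bperm s)) v.
  apply/ffunP => t; rewrite !ffunE sum_ffunE /f sum_shape /GRing.scale /= mulrCA; congr (_ * _).
  rewrite mulr_sumr; apply: eq_bigr => s _; rewrite !ffunE (leaf_sign_map (bperm s)) ?mtreeP //.
  rewrite mulrA -signr_addb addbCA addbb addbF /GRing.scale /=; congr (_ * v _).
rewrite linearZ linear_sum /=.
have -> : \sum_(s : {perm 'I_n}) quot_proj (@prelie_rel K) 'I_n
     ((-1) ^+ relabel_sign (bperm s) *: mag_act (bsym (bperm s)) v) = N *: a.
  rewrite /N scaler_nat -sumr_const; apply: eq_bigr => s _; rewrite linearZ /=.
  have -> : quot_proj (@prelie_rel K) 'I_n (mag_act (bsym (bperm s)) v) = op_act (bsym (bperm s)) a.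
    by rewrite (oh_act (quot_proj (@prelie_rel K)) (bsym (bperm s)) v) av.
  by rewrite sym scalerA -signr_addb addbb scale1r.
by rewrite scalerA mulVf ?card_perm_neq0 // scale1r.
Qed.
End RelFromIdeal.

(** * The differential of the deformation complex *)

(* One entry for each subtree p.2 of t, with None marking its place in p.1.   *)
Fixpoint splits A (t : tree A) : seq (tree (option A) * tree A) :=
  (Leaf None, t) ::
  match t with
  | Leaf _ => [::]
  | Node a b => [seq (Node p.1 (tmap Some b), p.2) | p <- splits a]
             ++ [seq (Node (tmap Some a) p.1, p.2) | p <- splits b]
  end.

Definition insert A (s : tree (option A)) (u : tree A) : tree A :=
  tbind s (fun o => if o is Some a then Leaf a else u).

Lemma insert_map A (t u : tree A) : insert (tmap Some t) u = t.
Proof. by rewrite /insert tbind_map -[RHS]tbind_Leaf; apply: eq_tbind. Qed.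

Definition hole A (s : tree (option A)) : nat := count (fun o => ~~ isSome o) (leaves s).

Lemma hole_map A (t : tree A) : hole (tmap Some t) = 0%N.
Proof. by rewrite /hole leaves_map count_map; elim: (leaves t). Qed.

Lemma hole_Node A (s1 s2 : tree (option A)) : hole (Node s1 s2) = (hole s1 + hole s2)%N.
Proof. exact: count_cat. Qed.

Lemma hole0 A (s : tree (option A)) u : hole s = 0%N -> s = tmap Some (insert s u).
Proof.
elim: s => [[a|]|s1 IH1 s2 IH2] //; rewrite hole_Node => /eqP; rewrite addn_eq0 => /andP[/eqP h1 /eqP h2].
by rewrite [LHS](congr2 Node (IH1 h1) (IH2 h2)).
Qed.

Lemma mem_splits (A : eqType) (t : tree A) s u :
  ((s, u) \in splits t) = (hole s == 1%N) && (insert s u == t).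
Proof.
apply/idP/andP => [|[/eqP]].
  elim: t s u => [a|a IHa b IHb] s u /=; rewrite inE.
    by rewrite ?orbF => /eqP[-> ->].
  case/predU1P => [[-> ->] //|]; rewrite mem_cat => /orP[]/mapP[[s' u'] + [-> ->]] /=.
    move=> /IHa[/eqP h /eqP <-]; rewrite hole_Node h hole_map; split=> //.
    by rewrite -[insert _ _]/(Node (insert s' u') (insert (tmap Some b) u')) insert_map.
  move=> /IHb[/eqP h /eqP <-]; rewrite hole_Node h hole_map; split=> //.
  by rewrite -[insert _ _]/(Node (insert (tmap Some a) u') (insert s' u')) insert_map.
elim: s t => [[a|]|s1 IH1 s2 IH2] t //.
  by move=> _ /eqP <-; case: u => *; rewrite mem_head.
rewrite hole_Node => h12 /eqP <-; have [[h1 h2]|[h1 h2]] :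
    (hole s1 = 1 /\ hole s2 = 0 \/ hole s1 = 0 /\ hole s2 = 1)%N by lia.
  rewrite /= inE mem_cat; apply/orP; right; apply/orP; left; apply/mapP.
  by exists (s1, u); rewrite ?IH1 //= [X in Node _ X](hole0 u h2).
rewrite /= inE mem_cat; apply/orP; right; apply/orP; right; apply/mapP.
by exists (s2, u); rewrite ?IH2 //= [X in Node X _](hole0 u h1).
Qed.

Lemma splits_uniq (A : eqType) (t : tree A) : uniq (splits t).
Proof.
elim: t => [a|a IHa b IHb] //=.
have inj1 : injective (fun p : tree (option A) * tree A => (Node p.1 (tmap Some b), p.2)).
  by move=> [s u] [s' u'] [-> ->].
have inj2 : injective (fun p : tree (option A) * tree A => (Node (tmap Some a) p.1, p.2)).
  by move=> [s u] [s' u'] [-> ->].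
rewrite mem_cat negb_or cat_uniq !map_inj_uniq // IHa IHb /= andbT.
apply/andP; split; first by apply/andP; split; apply/mapP => -[].
apply/hasPn => _ /mapP[[s u] sb ->]; apply/mapP => -[[s' u'] sa [e _]].
by move: sa; rewrite mem_splits -e hole_map.
Qed.

Lemma splits_head A (t : tree A) : exists l,
  splits t = (Leaf None, t) :: l /\ all (fun p => ~~ is_leaf p.1) l.
Proof.
case: t => [a|a b]; first by exists [::].
by eexists; split; first reflexivity; rewrite all_cat !all_map; apply/andP; split; apply: sub_all (all_predT _).
Qed.

Lemma splits_map A B (f : A -> B) (t : tree A) :
  splits (tmap f t) = [seq (tmap (omap f) p.1, tmap f p.2) | p <- splits t].
Proof.
elim: t => [a|a IHa b IHb] //=.
rewrite -!/(tmap _ _) IHa IHb map_cat -!map_comp; congr (_ :: _ ++ _).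
  apply: eq_map => p; congr (Node _ _, _).
  by change (tmap Some (tmap f b) = tmap (omap f) (tmap Some b)); rewrite !tmap_comp.
apply: eq_map => p; congr (Node _ _, _).
by change (tmap Some (tmap f a) = tmap (omap f) (tmap Some a)); rewrite !tmap_comp.
Qed.

Lemma splits_leaves (A : eqType) (t : tree A) s u : (s, u) \in splits t ->
  perm_eq (leaves t) (pmap id (leaves s) ++ leaves u).
Proof.
rewrite mem_splits => /andP[/eqP h /eqP <-].
elim: s h => [[a|]|s1 IH1 s2 IH2] //; rewrite hole_Node => h12.
have P0 s' : hole s' = 0%N -> leaves (insert s' u) = pmap id (leaves s').
  move=> /(hole0 u) e; rewrite [in RHS]e leaves_map.
  by elim: (leaves _) => //= a l <-.
have [[h1 h2]|[h1 h2]] :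
    (hole s1 = 1 /\ hole s2 = 0 \/ hole s1 = 0 /\ hole s2 = 1)%N by lia.
  rewrite -[insert _ _]/(Node (insert s1 u) (insert s2 u)) /= pmap_cat (P0 s2) //.
  apply/seq.permP => q; rewrite !count_cat (seq.permP (IH1 h1)) count_cat.
  by rewrite addnAC.
rewrite -[insert _ _]/(Node (insert s1 u) (insert s2 u)) /= pmap_cat (P0 s1) //.
by rewrite -catA perm_cat2l; apply: IH2.
Qed.

Lemma tree_lift (T : eqType) (P : pred T) (t : tree T) : all P (leaves t) ->
  exists t' : tree {x | P x}, tmap val t' = t.
Proof.
elim: t => [a|a IHa b IHb] /=.
  by rewrite andbT => Pa; exists (Leaf (exist _ a Pa)).
by rewrite all_cat => /andP[/IHa[a' <-] /IHb[b' <-]]; exists (Node a' b').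
Qed.

Lemma tree_option_lift (T : eqType) (P : pred T) (t : tree (option T)) :
  all (fun o => if o is Some x then P x else true) (leaves t) ->
  exists t' : tree (option {x | P x}), tmap (omap val) t' = t.
Proof.
elim: t => [[a|]|a IHa b IHb] /=.
- by rewrite andbT => Pa; exists (Leaf (Some (exist _ a Pa))).
- by exists (Leaf None).
by rewrite all_cat => /andP[/IHa[a' <-] /IHb[b' <-]]; exists (Node a' b').
Qed.

Section SubsetSplits.
Variables (n : nat) (t : mtree 'I_n).

Lemma tmap_inj A B (f : A -> B) : injective f -> injective (tmap f).
Proof.
move=> fI; elim=> [a|a IHa b IHb] [c|c d] //=; first by move=> [/fI ->].
by move=> [/IHa -> /IHb ->].
Qed.

Definition emb1 (S : {set 'I_n}) (s : mtree (option {i | i \notin S})) : tree (option 'I_n) :=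
  tmap (omap val) s.
Definition emb2 (S : {set 'I_n}) (u : mtree {i | i \in S}) : tree 'I_n := tmap val u.

Lemma insert_emb (S : {set 'I_n}) (s : mtree (option {i | i \notin S}))
    (u : mtree {i | i \in S}) :
  tmap (bsplit S) (tgraft s u) = insert (emb1 s) (emb2 u).
Proof.
rewrite /insert /emb1 /emb2 tbind_map /tgraft tmap_bind; apply: eq_tbind => -[a|] //=.
by rewrite tmap_comp; apply: eq_tmap.
Qed.

Lemma splits_emb (S : {set 'I_n}) (s : mtree (option {i | i \notin S})) (u : mtree {i | i \in S}) :
  ((emb1 s, emb2 u) \in splits t) = (mrelabel (bsplit S) (mgraft s u) == t).
Proof.
rewrite mem_splits -insert_emb -(inj_eq val_inj) /=.
have -> : hole (emb1 s) = 1%N.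
  rewrite /hole leaves_map count_map -(mtree_count_hole s).
  by apply: eq_count => -[].
by [].
Qed.

Lemma emb2_set (S : {set 'I_n}) (u : mtree {i | i \in S}) : S = [set i | i \in leaves (emb2 u)].
Proof.
apply/setP => i; rewrite inE /emb2 leaves_map; apply/idP/mapP => [iS|[[j jS] _ ->] //].
by exists (exist _ i iS); rewrite // (perm_mem (mtree_perm u)) mem_enum.
Qed.

Lemma splits_lift p : p \in splits t ->
  exists (S : {set 'I_n}) (s : mtree (option {i | i \notin S})) (u : mtree {i | i \in S}),
  p = (emb1 s, emb2 u).
Proof.
case: p => s u pt; have := pt; rewrite mem_splits => /andP[/eqP hs _].
have P := splits_leaves pt; pose S := [set i | i \in leaves u].
have U : uniq (pmap id (leaves s) ++ leaves u).
  by rewrite -(perm_uniq P) (perm_uniq (mtree_perm t)) enum_uniq.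
have alli i : i \in pmap id (leaves s) ++ leaves u.
  by rewrite -(perm_mem P) (perm_mem (mtree_perm t)) mem_enum.
have := U; rewrite cat_uniq => /and3P[Us dis Uu].
have [u' eu] : exists u' : tree {i | i \in S}, tmap val u' = u.
  by apply: tree_lift; apply/allP => i iu; rewrite inE.
have sP i : (Some i \in leaves s) = (i \in pmap id (leaves s)).
  by elim: (leaves s) => //= -[j|] l; rewrite ?inE /= ?inE => <- //.
have [s' es] : exists s' : tree (option {i | i \notin S}), tmap (omap val) s' = s.
  apply: tree_option_lift; apply/allP => -[i|] // is_; rewrite inE.
  by apply: contraL is_ => iu; rewrite sP; move/hasPn: dis => /(_ i iu).
have ovI : injective (omap (val : {i | i \notin S} -> 'I_n)).
  by move=> [x|] [y|] //= [/val_inj ->].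
have mu : multilinear u'.
  apply/forallP => i; apply/eqP; have ui : i \in leaves u'.
    by rewrite -(mem_map val_inj) -leaves_map eu; have := valP i; rewrite inE.
  by rewrite count_uniq_mem ?ui // -(map_inj_uniq val_inj) -leaves_map eu.
have ms : multilinear s'.
  apply/forallP => -[i|].
    have e : count_mem (Some i) (leaves s') = count_mem (val i) (pmap id (leaves s)).
      by rewrite -es leaves_map; elim: (leaves s') => //= -[j|] l /= -> //.
    rewrite e count_uniq_mem //; have := alli (val i); rewrite mem_cat => /orP[-> //|iu].
    by have := valP i; rewrite inE iu.
  rewrite -[X in _ == X]hs -es /hole leaves_map count_map; apply/eqP.
  by apply: eq_count => -[].
exists S, (MTree ms), (MTree mu); by rewrite /emb1 /emb2 /= es eu.
Qed.

Lemma emb1_inj (S : {set 'I_n}) : injective (@emb1 S).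
Proof.
move=> s s' /tmap_inj e; apply: val_inj; apply: e.
by move=> [x|] [y|] //= [/val_inj ->].
Qed.

Lemma emb2_inj (S : {set 'I_n}) : injective (@emb2 S).
Proof. by move=> u u' /(tmap_inj val_inj) e; apply: val_inj. Qed.

(** If grafting [u] into [s] gives [t], then [u] is a subtree of [t] and [S] its set of leaves; so
    the nonzero terms of the convolution at [t] are indexed by the subtrees of [t]. *)
Lemma sum_splits (V : nmodType) (G : tree (option 'I_n) -> tree 'I_n -> V) :
  \sum_(S : {set 'I_n}) \sum_(s : mtree (option {i | i \notin S}))
    \sum_(u : mtree {i | i \in S} | mrelabel (bsplit S) (mgraft s u) == t)
      G (emb1 s) (emb2 u)
  = \sum_(p <- splits t) G p.1 p.2.
Proof.
transitivity (\sum_(p <- splits t) \sum_(S : {set 'I_n})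
   \sum_(s : mtree (option {i | i \notin S})) \sum_(u : mtree {i | i \in S} | p == (emb1 s, emb2 u)) G p.1 p.2).
  rewrite [RHS]exchange_big; apply: eq_bigr => S _; rewrite [RHS]exchange_big; apply: eq_bigr => s _.
  rewrite [RHS](exchange_big_dep xpredT) //= big_mkcond; apply: eq_bigr => u _.
  rewrite -splits_emb; case: ifP => [st|nst].
    rewrite -[RHS]big_filter (@eq_filter _ _ (pred1 (emb1 s, emb2 u))) //.
    by rewrite filter_pred1_uniq ?splits_uniq // big_seq1.
  by rewrite big1_seq // => p /andP[/eqP ->]; rewrite nst.
rewrite big_seq [RHS]big_seq; apply: eq_bigr => p /splits_lift[S [s [u ep]]].
rewrite (bigD1 S) //= (bigD1 s) //= (bigD1 u) ?ep ?eqxx //=.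
rewrite big1 => [|u' /andP[/eqP[/emb2_inj ->]]]; last by rewrite eqxx.
rewrite addr0 big1 ?addr0 => [|s' ns]; last first.
  by rewrite big1 // => u' /eqP[/emb1_inj es]; rewrite es eqxx in ns.
rewrite big1 ?addr0 // => S' nS; rewrite big1 // => s' _; rewrite big1 // => u' /eqP[_ eu].
by case/eqP: nS; rewrite [S'](emb2_set u') -eu -emb2_set.
Qed.
End SubsetSplits.

(** * The convolution product on coefficient functions *)

Section Convolution.
Variable K : fieldType.
Implicit Types (f g : ptree -> K).

(** Here [e] is the degree of the second cochain. The first part of the sign moves it past the root
    tree, the second comes from sorting the labels ([leaf_sign_graft]). *)
Definition conv (e : nat) f g (t : ptree) : K :=
  \sum_(p <- splits t) (-1) ^+ (odd (e * weight p.1) (+) (odd (weight p.2) && odd (before p.1)))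
    * (f (shp p.1) * g (shp p.2)).

Lemma before_map A B (h : A -> B) (s : tree (option A)) : before (tmap (omap h) s) = before s.
Proof. by rewrite /before leaves_map find_map; apply: eq_find => -[]. Qed.

Lemma conv_shp A e f g (t : tree A) : conv e f g (shp t) =
  \sum_(p <- splits t) (-1) ^+ (odd (e * weight p.1) (+) (odd (weight p.2) && odd (before p.1)))
    * (f (shp p.1) * g (shp p.2)).
Proof.
rewrite /conv -[shp t]/(tmap (fun=> tt) t) splits_map big_map; apply: eq_bigr => -[s u] _ /=.
by rewrite !weight_map before_map !shp_map.
Qed.

(** The same constant [e] governs the decomposition of [corel] and the leaf signs, so it drops out
    of [conv]. *)
Lemma decomp_sign n (S : {set 'I_n}) : exists e : bool,
  forall (s : mtree (option {i | i \notin S})) (u : mtree {i | i \in S}),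
  decomp (mag_act (bsym (bsplit S)) (corel K 'I_n)) s u
    = (-1) ^+ e * (corel K _ s * corel K _ u) /\
  leaf_sign (mrelabel (bsplit S) (mgraft s u))
    = e (+) leaf_sign s (+) leaf_sign u (+) (odd (weight u) && odd (before s)).
Proof.
have [e He] := corel_sign_graft {i | i \notin S} {i | i \in S}.
exists (relabel_sign (bsplit S) (+) e) => s u.
have rs : relabel_sign (bsym (bsym (bsplit S))) = relabel_sign (bsplit S) by [].
split.
  rewrite corel_act rs /decomp !ffunE /GRing.scale /= -(signr_odd _ (_ * _)) oddM.
  rewrite -!signr_addb; congr ((-1) ^+ (nat_of_bool _)).
  have := He s u; rewrite -/(mgraft s u).
  move: (corel_sign (mgraft s u)) (corel_sign s) (corel_sign u) (relabel_sign _) (_ && _).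
  by case: e {He} => -[] [] [] [] [].
rewrite leaf_sign_map ?mtreeP // -!addbA; congr (_ (+) _).
have [_] := shape_sign_graft u (mtree_count_hole s).
have := He s u; rewrite /corel_sign.
rewrite -[mtree_val (mgraft s u)]/(tgraft s u).
move: (shape_sign (tgraft s u)) (shape_sign s) (shape_sign u) => b1 b2 b3.
move: (leaf_sign (tgraft s u)) (leaf_sign s) (leaf_sign u) => b4 b5 b6.
move: (odd _ && odd (before s)) (odd _ && odd _) => b7 b8.
by case: b7; case: b8; case: b1; case: b2; case: b3 => //= + _; case: e {He}; case: b4; case: b5; case: b6.
Qed.

(** The values on [corel] determine a cochain, by [cochain_ext]. *)
Definition represents (phi : cochain (PreLie K)) f : Prop :=
  forall n, phi n (vsproj (LieDual K 'I_n) (corel K 'I_n))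
            = quot_proj (@prelie_rel K) 'I_n (alt 'I_n f).

Hypothesis charK : [pchar K] =i pred0.

Lemma cochain_at_linear (phi : cochain (PreLie K)) (A : finType) : linear (@cochain_at _ _ phi A).
Proof.
move=> k x y; rewrite /cochain_at mag_act_linear.
by rewrite !linearP op_act_linear.
Qed.

Lemma cochain_at_corel phi f (A : finType) : represents phi f ->
  cochain_at phi (corel K A) = quot_proj (@prelie_rel K) A (alt A f).
Proof.
move=> R; rewrite /cochain_at corel_act.
have -> k : phi #|A| (vsproj (LieDual K 'I_#|A|) (k *: corel K 'I_#|A|))
    = k *: quot_proj (@prelie_rel K) 'I_#|A| (alt 'I_#|A| f) by rewrite -R !linearZ.
rewrite [LHS](linear_scale _ _ (op_act_linear _)) -(oh_act (quot_proj (@prelie_rel K))).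
rewrite -[LHS]linearZ; congr ((quot_proj (@prelie_rel K) A : _ -> _) _).
rewrite -[@op_act _ (Mag K) _ _ _ _]/(mag_act (benum A) (alt 'I_#|A| f)).
have -> : alt A f = mag_act (benum A) (mag_act (bsym (benum A)) (alt A f)).
  rewrite -(@mag_act_comp _ _ _ _ _ _ (bid A)) ?mag_act_id // => a.
  by rewrite /= enum_rankK.
by rewrite alt_act (linear_scale _ _ (mag_act_linear _)).
Qed.

Lemma linear_sum2 (U V W : lmodType K) (I J : finType) (F : U -> V -> W)
    (x : I -> K) (y : J -> K) (u : I -> U) (v : J -> V) :
  (forall v, linear (F^~ v)) -> (forall u, linear (F u)) ->
  \sum_i \sum_j (x i * y j) *: F (u i) (v j) = F (\sum_i x i *: u i) (\sum_j y j *: v j).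
Proof.
move=> Fl Fr.
have suml (T : finType) (X Y : lmodType K) (G : X -> Y) (k : T -> K) (w : T -> X) : linear G ->
    G (\sum_i k i *: w i) = \sum_i k i *: G (w i).
  move=> Gl; elim: (index_enum T) => [|i l IH]; first by rewrite !big_nil (linear_zero Gl).
  by rewrite !big_cons Gl IH.
rewrite (suml _ _ _ (F^~ _)) //; apply: eq_bigr => i _.
by rewrite (suml _ _ _ (F _)) // scaler_sumr; apply: eq_bigr => j _; rewrite scalerA.
Qed.

(** As the decomposition of [corel] is a signed tensor product of generators, the double sum over
    trees reassembles, by bilinearity, into the composite of two antisymmetric elements for each
    subset; the coefficient at [t] is then collected with [sum_splits]. *)
Lemma def_conv_corel (phi psi : cochain (PreLie K)) f g (d : int) n :
  represents phi f -> represents psi g ->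
  def_conv d phi psi n (vsproj (LieDual K 'I_n) (corel K 'I_n))
  = quot_proj (@prelie_rel K) 'I_n (alt 'I_n (conv `|d|%N f g)).
Proof.
move=> Rf Rg; rewrite /def_conv lfunE /= /def_conv_fun vsprojK ?corel_LieDual //.
pose sg (S : {set 'I_n}) := odd (`|d| * #|{: {i | i \notin S}}|) (+) projT1 (cid (decomp_sign S)).
pose W (S : {set 'I_n}) : Mag K 'I_n :=
  mag_act (bsplit S) (mag_comp (alt (option {i | i \notin S}) f) (alt {i | i \in S} g)).
have wS (S : {set 'I_n}) (s : mtree (option {i | i \notin S})) :
    weight s = #|{: {i | i \notin S}}|.
  by apply/succn_inj; rewrite mtree_weight card_option.
transitivity (quot_proj (@prelie_rel K) 'I_n (\sum_(S : {set 'I_n}) (-1) ^+ sg S *: W S)).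
  rewrite linear_sum; apply: eq_bigr => S _.
  pose F (x : tspan K (option {i | i \notin S})) (y : tspan K {i | i \in S}) :=
    op_act (bsplit S) (op_comp (cochain_at phi x) (cochain_at psi y)).
  have Fl y : linear (F^~ y).
    move=> k x x'; rewrite /F (cochain_at_linear phi k x x').
    by rewrite (op_comp_linearl (cochain_at psi y)) op_act_linear.
  have Fr x : linear (F x).
    move=> k y y'; rewrite /F (cochain_at_linear psi k y y').
    by rewrite (op_comp_linearr (cochain_at phi x)) op_act_linear.
  transitivity ((-1) ^+ sg S *: F (corel K (option {i | i \notin S})) (corel K {i | i \in S})).
    rewrite [X in F X _]tspan_expand [X in F _ X]tspan_expand -linear_sum2 // scaler_sumr.
    apply: eq_bigr => s _; rewrite scaler_sumr; apply: eq_bigr => u _.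
    rewrite scalerA /sg; case: cid => e /= He; have [-> _] := He s u.
    by rewrite wS signr_addb signr_odd mulrA.
  rewrite linearZ /= /F (cochain_at_corel _ Rf) (cochain_at_corel _ Rg); congr (_ *: _).
  by rewrite -(oh_comp (quot_proj (@prelie_rel K))) -(oh_act (quot_proj (@prelie_rel K))).
congr ((quot_proj (@prelie_rel K) 'I_n : _ -> _) _); apply/ffunP => t.
pose H (s : tree (option 'I_n)) (u : tree 'I_n) : K :=
  (-1) ^+ (odd (`|d| * weight s) (+) (odd (weight u) && odd (before s))) * (f (shp s) * g (shp u)).
rewrite sum_ffunE ffunE conv_shp -[\sum_(p <- splits t) _]/(\sum_(p <- splits t) H p.1 p.2).
rewrite -sum_splits mulr_sumr; apply: eq_bigr => S _.
have -> : W S = \sum_(s : mtree (option {i | i \notin S})) \sum_(u : mtree {i | i \in S})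
    (alt _ f s * alt _ g u) *: mono K (mrelabel (bsplit S) (mgraft s u)).
  rewrite /W [X in mag_comp X _]tspan_expand [X in mag_comp _ X]tspan_expand.
  rewrite -(linear_sum2 (F := fun x y => mag_act (bsplit S) (mag_comp x y))); last 2 first.
  - by move=> y k x x'; rewrite mag_comp_linearl mag_act_linear.
  - by move=> x k y y'; rewrite mag_comp_linearr mag_act_linear.
  by apply: eq_bigr => s _; apply: eq_bigr => u _; rewrite mag_comp_mono mag_act_mono.
rewrite ffunE sum_ffunE scaler_sumr mulr_sumr; apply: eq_bigr => s _.
rewrite sum_ffunE scaler_sumr mulr_sumr [RHS]big_mkcond; apply: eq_bigr => u _.
rewrite ffunE monoE eq_sym; case: eqP => [et|_]; last by rewrite !scaler0.
rewrite -et !ffunE /sg; case: cid => e /= He; have [_ ->] := He s u.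
rewrite /H /emb1 /emb2 !weight_map before_map !shp_map wS oddM.
rewrite /GRing.scale /= mulr1 !signr_addb.
move: ((-1) ^+ (odd `|d| && _)) ((-1) ^+ e) ((-1) ^+ leaf_sign s) ((-1) ^+ leaf_sign u).
move: (f (shp s)) (g (shp u)) => x y k1 k2 k3 k4.
by case: (odd (weight u) && odd (before s)); rewrite ?expr0 ?expr1; ring.
Qed.
End Convolution.

(** * Comparison with the deformation complex *)

Section Differential.
Variable K : fieldType.
Implicit Types (f g : ptree -> K).
Notation cherry := (Node lf lf).

Lemma shp_id (t : ptree) : shp t = t.
Proof. by apply: tmap_id; case. Qed.

Lemma before_Nodel A (s1 s2 : tree (option A)) : hole s1 = 1%N ->
  before (Node s1 s2) = before s1.
Proof. by rewrite /hole /before /= find_cat has_count => ->. Qed.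

Lemma before_Noder A (a : tree A) (s : tree (option A)) :
  before (Node (tmap Some a) s) = (nleaves a + before s)%N.
Proof.
rewrite /before /= find_cat leaves_map has_map (eq_has (a2 := pred0)) // has_pred0.
by rewrite size_map.
Qed.

Lemma dirac_cherry (t : ptree) : dirac cherry t = tmul (dirac lf) (dirac lf) t :> K.
Proof. by rewrite dirac_Node. Qed.

(** Both sides run over the cherries of [t], evaluate [f] on the tree with the cherry contracted to
    a leaf, and have the sign of the leaves before it. *)
Lemma splits_dsub f (t : ptree) :
  \sum_(p <- splits t) (-1) ^+ odd (before p.1) * (f (shp p.1) * dirac cherry (shp p.2)) = dsub f t.
Proof.
elim: t f => [[]|a IHa b IHb] f.
  by rewrite big_seq1 /= !mulr0.
rewrite /= big_cons big_cat !big_map shp_id dirac_Node /= !diracX.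
rewrite /dsub -!/(dsub _ _) -IHa -IHb /= expr0 mul1r addrA.
congr (_ + _ + _); first by rewrite -natrM mulnb mulrC.
  rewrite big_seq [RHS]big_seq; apply: eq_bigr => -[s u] /=.
  rewrite mem_splits => /andP[/eqP h _]; rewrite before_Nodel //.
  by rewrite -[shp (Node s _)]/(Node (shp s) (shp (tmap Some b))) shp_map shp_id -dirac_Node.
rewrite mulr_sumr; apply: eq_bigr => -[s u] _ /=; rewrite before_Noder.
rewrite -[shp (Node _ s)]/(Node (shp (tmap Some a)) (shp s)) shp_map shp_id -dirac_Node.
by rewrite !signr_odd exprD -!mulrA.
Qed.

Lemma conv_dsub (d : nat) f t : (forall s, f s != 0 -> odd d = odd (weight s)) ->
  conv 1 f (dirac cherry) t = (-1) ^+ odd d * dsub f t.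
Proof.
move=> fd; rewrite -splits_dsub mulr_sumr; apply: eq_bigr => -[s u] _ /=.
have [->|/fd] := eqVneq (f (shp s)) 0; first by rewrite !mul0r !mulr0.
rewrite weight_shp mul1n => <-; rewrite /dirac; case: eqP => [eu|_]; last by rewrite !mulr0.
by rewrite -(weight_shp u) eu /= signr_addb mulrA.
Qed.

Arguments before {A} s : simpl never.

(** With the cherry as root tree, only the splittings at the two children of the root of [t]
    survive, and the other child has to be a leaf. *)
Lemma conv_bracket (d : nat) f t : (forall s, f s != 0 -> odd d = odd (weight s)) ->
  conv d (dirac cherry) f t = tmul (dirac lf) f t - tmul (twist f) (dirac lf) t.
Proof.
move=> fd; case: t => [[]|a b].
  by rewrite /conv big_seq1 /dirac /= mul0r mulr0 subr0.
rewrite /conv [splits _]/= big_cons big_cat !big_map.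
have [la [-> /allP na]] := splits_head a; have [lb [-> /allP nb]] := splits_head b.
have leaf_shp A (s : tree A) : is_leaf (shp s) = is_leaf s by case: s.
have bN : before (Leaf None : tree (option unit)) = 0%N by [].
rewrite !big_cons !big1_seq; last 2 first.
- move=> -[s u] /andP[_ /nb /= /negbTE ns].
  by rewrite -[shp (Node _ _)]/(Node (shp (tmap Some a)) (shp s)) dirac_Node /= !diracX
    !leaf_shp ns mulr0 mul0r mulr0.
- move=> -[s u] /andP[_ /na /= /negbTE ns].
  by rewrite -[shp (Node _ _)]/(Node (shp s) (shp (tmap Some b))) dirac_Node /= !diracX
    !leaf_shp ns mul0r mul0r mulr0.
rewrite /= !shp_id.
rewrite -[shp (Node _ (tmap Some b))]/(Node lf (shp (tmap Some b))).
rewrite -[shp (Node (tmap Some a) _)]/(Node (shp (tmap Some a)) lf) !shp_map !shp_id.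
rewrite (_ : before (Node _ _) = nleaves a); last first.
  by rewrite [LHS](before_Noder a (Leaf None)) addn0.
rewrite ?andbF !addbF !addn0 add0n !weight_map muln0 /=.
rewrite !dirac_Node /= !diracX mul0r mulr0 add0r !addr0.
have fE s : (-1) ^+ odd d * f s = (-1) ^+ odd (weight s) * f s.
  by have [->|/fd ->] := eqVneq (f s) 0; rewrite ?mulr0.
rewrite mul1r mulr1 /twist nleaves_weight addrC; congr (_ + _).
  case: a {na} => [x|a1 a2] /=; last by rewrite !mul0r mulr0.
  by rewrite muln1 andbT addbC signr_addb !mul1r -mulrA fE mulrA -signr_addb addbb mul1r.
case: b {nb} => [x|b1 b2] /=; last by rewrite !mul0r !mulr0 oppr0.
by rewrite muln1 mul1r mulr1 fE signr_odd exprS mulN1r mulNr opprK.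
Qed.

Hypothesis charK : [pchar K] =i pred0.

(** The image of the Lie bracket is the antisymmetrization of the product, which corresponds to x
    x. *)
Lemma represents_alpha : represents (def_alpha (lie_to_prelie K)) (dirac cherry).
Proof.
move=> n; have [->|n2] := eqVneq n 2; last first.
  have -> : def_alpha (lie_to_prelie K) n = 0 by case: n n2 => [|[|[|]]].
  rewrite lfunE /= alt_dirac0 ?linear0 //.
  by move=> e; case/eqP: n2; rewrite -e.
rewrite /def_alpha lfunE /= /def_alpha_fun vsprojK ?corel_LieDual //.
have -> : corel K 'I_2 (MTree multilinear12) = 1.
  rewrite ffunE /corel_sign leaf_sign_ord /inversions /= !big_cons !big_nil /inverted /=.
  by rewrite expr0.
rewrite scale1r lie_to_prelie_bracket /prelie_prod /prelie_prod_op -linearB /=.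
congr ((quot_proj (@prelie_rel K) 'I_2 : _ -> _) _); apply/ffunP => t; rewrite !ffunE leaf_sign_ord.
have : uniq (leaves t) by rewrite (perm_uniq (mtree_perm t)) enum_uniq.
have /eqP : (weight t).+1 = 2 by rewrite mtree_weight card_ord.
rewrite eqSS => /eqP /tree_weight1[i [j ->]]; rewrite dirac_cherry /= !diracX /=.
case: i => [[|[|//]] ?]; case: j => [[|[|//]] ?] // _;
  rewrite /inversions /= !big_cons !big_nil /inverted /=; ring.
Qed.

(** The sign of the graded bracket cancels the one in [conv_dsub], which leaves - D f. *)
Lemma represents_diff (d : int) phi f : represents phi f ->
  (forall s, f s != 0 -> odd `|d|%N = odd (weight s)) ->
  represents (def_diff (lie_to_prelie K) d phi) (diff f).
Proof.
move=> R fd n; rewrite /def_diff /def_bracket.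
rewrite add_lfunE opp_lfunE scale_lfunE (def_conv_corel charK _ _ represents_alpha R).
rewrite (def_conv_corel charK _ _ R represents_alpha) -linearZ -linearB.
congr ((quot_proj (@prelie_rel K) 'I_n : _ -> _) _); apply/ffunP => t; rewrite !ffunE.
rewrite (conv_bracket _ fd) (conv_dsub _ fd) /diff /GRing.scale /=.
rewrite mul1n -(signr_odd _ `|d|).
by case: (odd `|d|); ring.
Qed.

Lemma tspan_noleaves (A : finType) (c c' : tspan K A) : (mtree A -> False) -> c = c'.
Proof. by move=> no; apply/ffunP => t; case: (no t). Qed.

Lemma cochain_ext (phi psi : cochain (PreLie K)) n :
  phi n (vsproj (LieDual K 'I_n) (corel K 'I_n)) = psi n (vsproj (LieDual K 'I_n) (corel K 'I_n)) ->
  phi n = psi n.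
Proof.
move=> E; apply/lfunP => c; have [t _|no] := pickP (xpredT : pred (mtree 'I_n)).
  have -> : c = normalized (vsval c) t *: vsproj (LieDual K 'I_n) (corel K 'I_n).
    by rewrite -linearZ /= -LieDual_line ?vsvalK ?subvsP.
  by rewrite !linearZ /= E.
have -> : c = 0 by apply: val_inj; apply: tspan_noleaves => t; have := no t.
by rewrite !linear0.
Qed.

Definition rep_fun g n (t : mtree 'I_n) (c : subvs_of (LieDual K 'I_n)) : PreLie K 'I_n :=
  normalized (vsval c) t *: quot_proj (@prelie_rel K) 'I_n (alt 'I_n g).

Lemma rep_linear g n t : linear (@rep_fun g n t).
Proof.
move=> k x y; rewrite /rep_fun /normalized linearP /= !ffunE scalerA -scalerDl.
by congr (_ *: _); rewrite mulrDr /GRing.scale /= mulrCA.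
Qed.

HB.instance Definition _ g n t :=
  GRing.isSemilinear.Build K (subvs_of (LieDual K 'I_n)) (PreLie K 'I_n) _
    (@rep_fun g n t) (GRing.semilinear_linear (@rep_linear g n t)).

(** Any tree [t] can be picked, since normalized coordinates do not depend on it; in arity zero
    there is none, and the component is zero. *)
Definition rep g : cochain (PreLie K) := fun n =>
  if [pick t : mtree 'I_n] is Some t then linfun (@rep_fun g n t) else 0.

Lemma rep_funE g n (t : mtree 'I_n) c : linfun (@rep_fun g n t) c = rep_fun g t c.
Proof. exact: lfunE. Qed.

Lemma rep_represents g : represents (rep g) g.
Proof.
move=> n; rewrite /rep; case: pickP => [t _|no].
  rewrite rep_funE /rep_fun vsprojK ?corel_LieDual // /normalized ffunE.
  by rewrite -signr_addb addbb scale1r.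
rewrite zero_lfunE (@tspan_noleaves _ (alt 'I_n g) 0) ?linear0 // => t.
by have := no t.
Qed.

Lemma rep_HomS (d : int) g : (forall s, g s != 0 -> d + (weight s)%:Z = 0) -> HomS d (rep g).
Proof.
move=> gd; split=> [n sigma c|n m c cm dm]; rewrite /rep; case: pickP => [t _|no].
- rewrite !rep_funE /rep_fun dual_actE (linear_scale _ _ (op_act_linear _)).
  rewrite -(oh_act (quot_proj (@prelie_rel K))).
  rewrite -[@op_act _ (Mag K) _ _ _ _]/(mag_act sigma (alt 'I_n g)) alt_act linearZ scalerA.
  congr (_ *: _); rewrite {1}(LieDual_line t (subvsP c)) (linear_scale _ _ (mag_act_linear _)) corel_act.
  rewrite {1}/normalized !ffunE /GRing.scale /= mulrCA; congr (_ * _).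
  by rewrite mulrCA -signr_addb addbb mulr1.
- by rewrite !zero_lfunE (linear_zero (op_act_linear _)).
- rewrite rep_funE /rep_fun; have [->|c0] := eqVneq (normalized (vsval c) t) 0; first by rewrite scale0r.
  have wt : weight t = m.
    by apply: cm; apply: contraNneq c0 => ct0; rewrite /normalized ct0 mulr0.
  suff -> : alt 'I_n g = 0 by rewrite linear0 scaler0.
  apply/ffunP => u; rewrite !ffunE; have [->|/gd] := eqVneq (g (shp u)) 0; first by rewrite mulr0.
  have -> : weight (shp u) = m by rewrite weight_shp -wt; apply/succn_inj; rewrite !mtree_weight.
  by move=> e; rewrite e eqxx in dm.
by rewrite zero_lfunE.
Qed.

(** A cochain of degree d lives in arity 1 - d alone, where equivariance makes its value on [corel]
    antisymmetric, so that [antisym_alt] applies. *)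
Lemma HomS_represents (d : int) phi : HomS d phi ->
  exists f, represents phi f /\ forall s, f s != 0 -> d + (weight s)%:Z = 0.
Proof.
move=> [eqv dg].
have dg0 n : d + n.-1%:Z != 0 -> phi n (vsproj (LieDual K 'I_n) (corel K 'I_n)) = 0.
  move=> dn; apply: dg dn => t _.
  by apply/succn_inj; rewrite mtree_weight card_ord; case: n t => // t; have := mtree_weight t; rewrite card_ord.
have no0 (t : mtree 'I_0) : False by have := mtree_weight t; rewrite card_ord.
have phi0 c : phi 0%N c = 0.
  by rewrite (_ : c = 0) ?linear0 //; apply: val_inj; apply: tspan_noleaves.
have altn0 n f : (forall t : mtree 'I_n, f (shp t) = 0) -> alt 'I_n f = 0.
  by move=> f0; apply/ffunP => t; rewrite !ffunE f0 mulr0.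
have [[n dn]|d1] : (exists n : nat, d = - n%:Z) \/ (forall n : nat, d + n%:Z != 0).
- case: d {eqv dg dg0} => [[|m]|m]; first by left; exists 0%N.
    by right=> n; apply/eqP; lia.
  by left; exists m.+1; rewrite NegzE.
- pose a := phi n.+1 (vsproj (LieDual K 'I_n.+1) (corel K 'I_n.+1)).
  have [s|f [f0 ea]] := antisym_alt charK (a := a).
    rewrite /a -eqv; set c := dual_act _ _.
    have -> : c = (-1) ^+ relabel_sign (bperm s) *: vsproj (LieDual K 'I_n.+1) (corel K 'I_n.+1).
      by apply: val_inj; rewrite /= dual_actE !vsprojK ?corel_LieDual // corel_act.
    by rewrite linearZ.
  exists f; split=> [m|s /f0]; last first.
    by rewrite nleaves_weight dn => -[->]; rewrite addNr.
  have [->|nm] := eqVneq m n.+1; first exact: ea.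
  rewrite altn0 ?linear0; last first.
    move=> t; apply: contraNeq nm => /f0; rewrite nleaves_shp nleaves_weight => <-.
    by rewrite mtree_weight card_ord.
  case: m nm => [|m] nm; first exact: phi0.
  by apply: dg0; rewrite dn /= addrC subr_eq0 eqz_nat.
exists (fun=> 0); split=> [m|s]; last by rewrite eqxx.
by rewrite alt0 linear0 dg0.
Qed.

Lemma span_supportP (P : ptree -> Prop) f : span P f -> forall t, f t != 0 -> P t.
Proof.
elim=> [|k s g Ps _ IH] t; first by rewrite eqxx.
rewrite /dirac; have [-> //|_] := eqVneq t s; rewrite mulr0 add0r; exact: IH.
Qed.

Lemma def_acyclic_lie_to_prelie : def_acyclic (lie_to_prelie K).
Proof.
move=> d phi [Hphi cyc]; have [f [Rf fd]] := HomS_represents Hphi.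
have par s : f s != 0 -> odd `|d|%N = odd (weight s).
  by move=> /fd e; have -> : `|d|%N = weight s by lia.
have Rd := represents_diff Rf par.
have [g [gd Rg]] : exists g, (forall s, g s != 0 -> d + 1 + (weight s)%:Z = 0)
    /\ rel (fun t => f t - diff g t).
  (* A nonzero coefficient of [f] fixes its number of leaves in terms of d; for [f] zero, take [g]
     zero. *)
  have [[s0 f0]|nof] := pselect (exists s, f s != 0); last first.
    exists (fun=> 0); split; first by move=> s; rewrite eqxx.
    apply: lin_closed_ext (rel0 K) _ => t; rewrite (linmap0 (@diff_lin K)) subr0.
    by have [//|ft] := eqVneq (f t) 0; case: nof; exists t.
  have dE : d = - (weight s0)%:Z by have := fd _ f0; lia.
  have Df : deg (weight s0).+1 f.
    apply: (span_support (n := (weight s0).+1)) => t /fd e.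
    by rewrite nleaves_weight; split; lia.
  have Rdf : rel (diff f).
    (* The arity of [diff f] is one more than the arity [(weight s0).+1] of [f]. *)
    apply: (alt_gen_ideal charK (n := (weight s0).+2)).
      exact: span_supportP (diff_deg Df).
    by apply/quot_proj_eq0; rewrite -Rd cyc zero_lfunE.
  have [g Dg Rg] := diff_exact charK Df Rdf.
  exists g; split=> // s /(span_supportP Dg); rewrite nleaves_weight dE; lia.
exists (rep g); split; first exact: rep_HomS.
move=> n; apply: cochain_ext.
have par1 s : g s != 0 -> odd `|(d + 1)%R|%N = odd (weight s).
  by move=> /gd e; have -> : `|(d + 1)%R|%N = weight s by lia.
rewrite (represents_diff (rep_represents g) par1) Rf; apply/eqP.
rewrite eq_sym -subr_eq0 -linearB; apply/eqP/quot_proj_eq0.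
suff <- : alt 'I_n (fun t => f t - diff g t) = alt 'I_n f - alt 'I_n (diff g) by apply: alt_rel.
by apply/ffunP => t; rewrite !ffunE mulrBr.
Qed.
End Differential.

Theorem theorem3p3 (K : fieldType) (charK : [pchar K]%R =i pred0) :
  def_acyclic (lie_to_prelie K).
Proof. exact: def_acyclic_lie_to_prelie charK. Qed.
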